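(* Let $c>0$, $b\ge0$, $T>0$. Let $\alpha_h\in C^1([0,T];V_h)$ satisfy $\alpha_0\le\alpha_h(x,t)\le\alpha_1$ on $\overline\Omega\times[0,T]$ for constants $\alpha_0,\alpha_1>0$ independent of the discretization parameters, and assume there is $\gamma\in(0,1)$ with $$\|\dot\alpha_h/\alpha_h\|_{L^1(0,T;L^\infty(\Omega))}=\int_0^T\sup_{x\in\Omega}\Big|\frac{\dot\alpha_h(x,t)}{\alpha_h(x,t)}\Big|\,dt\le\gamma .$$ Let $\psi_{0,h},\psi_{1,h}\in V_h$. Then, provided the penalty parameter $\beta$ in $\chi$ is sufficiently large, the linear semi-discrete problem: find $\psi_h\in C^2([0,T];V_h)$ with $$(\alpha_h\ddot\psi_h,v_h)_{L^2(\Omega)}+a_h(\tilde\psi_h,v_h)=0\quad\forall v_h\in V_h,\ t\in(0,T],\qquad (\psi_h(0),\dot\psi_h(0))=(\psi_{0,h},\psi_{1,h}),$$ has a unique solution, and it satisfies $$\max_{t\in[0,T]}E[\psi_h](t)\le C\,E[\psi_h](0),$$ where $C>0$ does not depend on the mesh size, the number of faces of a mesh element, or on $c,b$, but may depend on the polynomial degree $p$ (and on $\gamma$).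
   Context: Let $\Omega\subset\mathbb{R}^d$, $d\in\{2,3\}$, be a bounded convex polygonal/polyhedral domain, and let $\mathcal{T}_h$ be a member of a family of meshes of $\Omega$ consisting of disjoint open polygonal/polyhedral elements $\kappa$ of diameter $h_\kappa$. Mesh assumptions (constants uniform over the family): $h_\kappa^d\ge|\kappa|\ge C h_\kappa^d$; every $\kappa$ admits a sub-triangulation into at most $m$ (fixed) shape-regular simplices $\mathtt{s}_i$ with $|\mathtt{s}_i|\ge C|\kappa|$; $\max_\kappa h_\kappa/\min_\kappa h_\kappa\le C$. Faces: intersections of $(d-1)$-dimensional facets of neighboring elements or with $\partial\Omega$ (in 3D subdivided into co-planar triangles); $\mathcal{F}_h=\mathcal{F}_h^i\cup\mathcal{F}_h^b$ (interior/boundary faces). For an integer $p\ge1$, $V_h=\{v\in L^2(\Omega): v|_\kappa\in\mathcal{P}_p(\kappa)\ \forall\kappa\}$ ($\mathcal P_p$: polynomials of total degree $\le p$); $\nabla_h$ is the broken gradient. On interior $F\subset\partial\kappa^+\cap\partial\kappa^-$: $\llbracket w\rrbracket=w^+\mathbf{n}^++w^-\mathbf{n}^-$ (for vectors with a dot product), $\{\!\{w\}\!\}=(w^++w^-)/2$ (traces $w^\pm$ from $\kappa^\pm$, outward normals $\mathbf n^\pm$); on boundary faces $\llbracket w\rrbracket=w\mathbf{n}$, $\{\!\{w\}\!\}=w$. Stabilization: $\chi|_F=c^2\beta\max_{\kappa\in\{\kappa^\pm\}}p^2/h_\kappa$ on interior faces, $\chi|_F=c^2\beta p^2/h_\kappa$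 on boundary faces $F\subset\partial\kappa$, with $\beta>0$. $\langle\psi,v\rangle_{\mathcal{F}}=\sum_{F\in\mathcal{F}}(\psi,v)_{L^2(F)}$, $\|\psi\|_{\mathcal F}=\langle\psi,\psi\rangle_{\mathcal F}^{1/2}$. DG bilinear form: $a_h(\psi,v_h)=c^2(\nabla_h\psi,\nabla_hv_h)_{L^2}-\langle\{\!\{c^2\nabla_h\psi\}\!\},\llbracket v_h\rrbracket\rangle_{\mathcal{F}_h}-\langle\llbracket\psi\rrbracket,\{\!\{c^2\nabla_hv_h\}\!\}\rangle_{\mathcal{F}_h}+\langle\chi\llbracket\psi\rrbracket,\llbracket v_h\rrbracket\rangle_{\mathcal{F}_h}$. Notation: $\tilde\psi_h=\psi_h+\frac{b}{c^2}\dot\psi_h$ (dots denote time derivatives). Discrete energy: $E[\psi_h](t)=\|\sqrt{\alpha_h(t)}\dot\psi_h(t)\|_{L^2}^2+\frac{b}{c^2}\int_0^t\|\sqrt{\alpha_h}\ddot\psi_h\|_{L^2}^2ds+c^2\|\nabla_h\tilde\psi_h(t)\|_{L^2}^2+\|\sqrt\chi\llbracket\tilde\psi_h(t)\rrbracket\|_{\mathcal{F}_h}^2.$ *)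

(* Defs.v *)
From HB Require Import structures.
From mathcomp Require Import all_boot all_order all_algebra.
From mathcomp Require Import all_classical all_reals all_analysis.
Set Implicit Arguments. Unset Strict Implicit. Unset Printing Implicit Defensive.
Import Order.TTheory GRing.Theory Num.Theory.
Import numFieldNormedType.Exports.
Local Open Scope classical_set_scope.
Local Open Scope ring_scope.

Section DG.
Variables (R : realType) (d : nat).
Local Notation point := 'rV[R]_d.

Definition dotp (u v : point) : R := \sum_(i < d) u ord0 i * v ord0 i.
Definition enorm (u : point) : R := Num.sqrt (dotp u u).

Definition diam (K : set point) : R :=
  sup [set r | exists x y, K x /\ K y /\ r = enorm (x - y)].

Definition csimplex (k : nat) (v : nat -> point) : set point :=
  [set x | exists l : nat -> R, (forall i, (i <= k)%N -> 0 <= l i) /\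
     \sum_(i < k.+1) l i = 1 /\ x = \sum_(i < k.+1) l i *: v i].
Definition osimplex (k : nat) (v : nat -> point) : set point :=
  [set x | exists l : nat -> R, (forall i, (i <= k)%N -> 0 < l i) /\
     \sum_(i < k.+1) l i = 1 /\ x = \sum_(i < k.+1) l i *: v i].

(* integral over the reference n-simplex {l_i >= 0, sum l_i <= r} (iterated) *)
Fixpoint refint (n : nat) (r : R) (g : (nat -> R) -> R) : R :=
  match n with
  | 0 => g (fun _ => 0)
  | n'.+1 => Rintegral lebesgue_measure [set s | 0 <= s <= r]
       (fun s => refint n' (r - s) (fun l => g (fun i => if i is j.+1 then l j else s)))
  end.

Definition sparam (k : nat) (v : nat -> point) (l : nat -> R) : point :=
  v 0%N + \sum_(i < k) l i *: (v i.+1 - v 0%N).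
Definition gram (k : nat) (v : nat -> point) : 'M[R]_k :=
  \matrix_(i < k, j < k) dotp (v i.+1 - v 0%N) (v j.+1 - v 0%N).
(* k-dimensional integral of f over the k-simplex v (surface measure when k < d) *)
Definition sint (k : nat) (v : nat -> point) (f : point -> R) : R :=
  Num.sqrt (\det (gram k v)) * refint k 1 (fun l => f (sparam k v l)).
Definition smeas (k : nat) (v : nat -> point) : R := sint k v (fun _ => 1).

Definition inradius (K : set point) : R :=
  sup [set r | 0 <= r /\ exists z, forall y, enorm (y - z) <= r -> K y].

Definition is_poly (p : nat) (f : point -> R) : Prop :=
  exists c : {ffun 'I_d -> 'I_p.+1} -> R, forall x,
    f x = \sum_(a : {ffun 'I_d -> 'I_p.+1} | (\sum_(i < d) (a i : nat) <= p)%N)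
            c a * \prod_(i < d) x ord0 i ^+ a i.

Definition grad (f : point -> R) (x : point) : point :=
  \row_(i < d) derive1 (fun t : R => f (x + t *: (delta_mx ord0 i : point))) 0.

(* polygonal mesh data: element k is the open polytope given by its
   sub-triangulation subs k (a list of d-simplices); faces are
   (d-1)-simplices fvert f, with neighbour fplus f, second neighbour
   fminus f (None for boundary faces) and unit normal fnormal f, outward
   for fplus f. *)
Record mesh := Mesh {
  nel : nat;
  subs : 'I_nel -> seq (nat -> point);
  nfc : nat;
  fvert : 'I_nfc -> nat -> point;
  fplus : 'I_nfc -> 'I_nel;
  fminus : 'I_nfc -> option 'I_nel;
  fnormal : 'I_nfc -> point }.
Arguments subs : clear implicits.
Arguments fvert : clear implicits.
Arguments fplus : clear implicits.
Arguments fminus : clear implicits.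
Arguments fnormal : clear implicits.

Variable M : mesh.

Definition subsimp (k : 'I_(nel M)) (i : nat) : nat -> point :=
  nth (fun _ => 0) (subs M k) i.
Definition cl_el (k : 'I_(nel M)) : set point :=
  \bigcup_(i in [set i | (i < size (subs M k))%N]) csimplex d (subsimp k i).
Definition el (k : 'I_(nel M)) : set point := interior (cl_el k).
Definition hel (k : 'I_(nel M)) : R := diam (el k).
Definition volel (k : 'I_(nel M)) : R :=
  \sum_(s <- subs M k) smeas d s.

Definition convex_hull (pts : seq point) : set point :=
  [set x | exists l : nat -> R, (forall i, 0 <= l i) /\
     \sum_(i < size pts) l i = 1 /\ x = \sum_(i < size pts) l i *: nth 0 pts i].
Definition convex_polytope_domain (Om : set point) : Prop :=
  (exists pts, Om = interior (convex_hull pts)) /\ Om !=set0.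

Definition fbary (f : 'I_(nfc M)) : point :=
  (d%:R)^-1 *: \sum_(i < d) fvert M f i.

Definition valid_mesh (Om : set point) : Prop :=
  (0 < nel M)%N /\
  (forall k i, (i < size (subs M k))%N -> 0 < smeas d (subsimp k i)) /\
  (forall k i j, (i < size (subs M k))%N -> (j < size (subs M k))%N -> i <> j ->
     interior (csimplex d (subsimp k i)) `&` interior (csimplex d (subsimp k j)) = set0) /\
  (forall k l, k <> l -> el k `&` el l = set0) /\
  (closure Om = \bigcup_(k in setT) cl_el k) /\
  (forall f, 0 < smeas d.-1 (fvert M f)) /\
  (forall f g, f <> g -> osimplex d.-1 (fvert M f) `&` osimplex d.-1 (fvert M g) = set0) /\
  (\bigcup_(f in setT) csimplex d.-1 (fvert M f) =
     \bigcup_(k in setT) (cl_el k `\` el k)) /\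
  (forall f, match fminus M f with
     | Some l => l <> fplus M f /\
         csimplex d.-1 (fvert M f) `<=` cl_el (fplus M f) `&` cl_el l
     | None => csimplex d.-1 (fvert M f) `<=` cl_el (fplus M f) `&` (closure Om `\` Om)
     end) /\
  (forall f, enorm (fnormal M f) = 1 /\
     (forall i, (0 < i < d)%N -> dotp (fnormal M f) (fvert M f i - fvert M f 0%N) = 0) /\
     exists eps, 0 < eps /\ forall s, 0 < s < eps ->
       el (fplus M f) (fbary f - s *: fnormal M f) /\
       (forall l, fminus M f = Some l -> el l (fbary f + s *: fnormal M f))).

Definition regular_mesh (Cr sigma : R) (m : nat) (Cq : R) : Prop :=
  (forall k, hel k ^+ d >= volel k /\ volel k >= Cr * hel k ^+ d) /\
  (forall k, (size (subs M k) <= m)%N /\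
     forall i, (i < size (subs M k))%N ->
       smeas d (subsimp k i) >= Cr * volel k /\
       diam (csimplex d (subsimp k i)) <= sigma * inradius (csimplex d (subsimp k i))) /\
  (forall k l, hel k <= Cq * hel l).

Definition Vh (p : nat) (v : 'I_(nel M) -> point -> R) : Prop :=
  forall k, is_poly p (v k).

Definition L2 (u v : 'I_(nel M) -> point -> R) : R :=
  \sum_(k < nel M) \sum_(s <- subs M k) sint d s (fun x => u k x * v k x).
Definition gradL2 (u v : 'I_(nel M) -> point -> R) : R :=
  \sum_(k < nel M) \sum_(s <- subs M k) sint d s (fun x => dotp (grad (u k) x) (grad (v k) x)).

Definition fint (f : 'I_(nfc M)) (g : point -> R) : R := sint d.-1 (fvert M f) g.

Definition jmp (f : 'I_(nfc M)) (u : 'I_(nel M) -> point -> R) (x : point) : point :=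
  match fminus M f with
  | Some l => (u (fplus M f) x - u l x) *: fnormal M f
  | None => u (fplus M f) x *: fnormal M f
  end.
Definition avg_grad (f : 'I_(nfc M)) (u : 'I_(nel M) -> point -> R) (x : point) : point :=
  match fminus M f with
  | Some l => 2^-1 *: (grad (u (fplus M f)) x + grad (u l) x)
  | None => grad (u (fplus M f)) x
  end.

Definition chi (c beta : R) (p : nat) (f : 'I_(nfc M)) : R :=
  match fminus M f with
  | Some l => c ^+ 2 * beta * Num.max (p%:R ^+ 2 / hel (fplus M f)) (p%:R ^+ 2 / hel l)
  | None => c ^+ 2 * beta * (p%:R ^+ 2 / hel (fplus M f))
  end.

Definition ah (c beta : R) (p : nat) (u v : 'I_(nel M) -> point -> R) : R :=
  c ^+ 2 * gradL2 u v
  - \sum_(f < nfc M) fint f (fun x => dotp (c ^+ 2 *: avg_grad f u x) (jmp f v x))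
  - \sum_(f < nfc M) fint f (fun x => dotp (jmp f u x) (c ^+ 2 *: avg_grad f v x))
  + \sum_(f < nfc M) fint f (fun x => chi c beta p f * dotp (jmp f u x) (jmp f v x)).

End DG.
Arguments subsimp {R d} M.
Arguments cl_el {R d} M.
Arguments el {R d} M.
Arguments hel {R d} M.
Arguments volel {R d} M.
Arguments fbary {R d} M.
Arguments valid_mesh {R d} M.
Arguments regular_mesh {R d} M.
Arguments Vh {R d} M.
Arguments L2 {R d} M.
Arguments gradL2 {R d} M.
Arguments fint {R d} M.
Arguments jmp {R d} M.
Arguments avg_grad {R d} M.
Arguments chi {R d} M.
Arguments ah {R d} M.

Definition deriv_on (R : realType) (a b : R) (f f' : R -> R) : Prop :=
  forall t, a <= t <= b ->
    (fun s => (f s - f t) / (s - t)) @ within [set s | a <= s <= b /\ s != t] (nbhs t)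
      --> f' t.

(* Main.v *)
(** With v the time derivative of tpsi = psi + (b/c^2) psid, testing gives
      d/dt [ (alpha psid, psid) + ah(tpsi, tpsi) ] + 2 (b/c^2) (alpha psidd, psidd) = (alphad psid, psid),
    whose right-hand side is at most sup |alphad/alpha| * max (alpha psid, psid); since the time integral of
    the first factor is at most gamma < 1 this is absorbed, and coercivity and boundedness of ah give the
    estimate with C = 4 / (1 - gamma). Applied to a difference of two solutions it gives uniqueness; existence
    is a linear ODE for the coefficients, since the mass matrix is invertible and continuous in time.

    Coercivity needs the inverse trace inequality h * sum_F int_F q^2 <= C int_K q^2 with C independent of the
    number of faces F of the element K. On every subsimplex s, sup q^2 <= C / |s| * int_s q^2 by equivalence of
    norms on polynomials, so it is enough that the total area of the faces of K is at most C h^(d-1). Each face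
    lies in the hyperplane of a facet of one of the at most m subsimplices; within one hyperplane the faces are
    essentially disjoint, and projecting them along a coordinate axis reduces the area bound to packing
    intervals (d = 2) or triangles (d = 3) into a box of size h.

    Linear functionals on polynomials of bounded degree are quadratures on a fixed grid, so pointwise time
    derivatives pass through all the integrals. *)

Require Import Defs.
From HB Require Import structures.
From mathcomp Require Import all_boot all_order all_algebra.
From mathcomp Require Import all_classical all_reals all_analysis.
From mathcomp Require Import measurable_realfun ring lra.
Set Implicit Arguments. Unset Strict Implicit. Unset Printing Implicit Defensive.
Import Order.TTheory GRing.Theory Num.Theory.
Import numFieldNormedType.Exports.
Local Open Scope classical_set_scope.
Local Open Scope ring_scope.

(** * Calculus on a closed interval, with one-sided limits at the endpoints *)

Section Calculus.
Variable R : realType.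
Implicit Types (a b t : R) (f g F : R -> R).

(** Integrals over simplices are iterated one-dimensional integrals, so even their additivity needs
    every slice to be integrable. For polynomials this is settled once and for all: the integral of
    a polynomial over the simplex of size [r] is a polynomial in [r] and in all parameters, hence
    slices are continuous. The same continuity shows that a nonnegative polynomial with zero
    integral vanishes, which makes Gram matrices invertible and gives norm equivalence by an
    explicit reproducing kernel.

    Convexity of the domain serves to separate boundary faces from the open elements: the domain is
    the interior of its own closure.

    The penalty threshold is [4 * C] with [C] the trace constant. It puts [ah] between one half and
    three halves of the squared DG norm; each of the two comparisons costs a factor of at most [2],
    whence the [4] in the final constant. Absorption takes place at the time where the kinetic part
    is maximal.

    The supremum of the relative rate of [alpha] may fail to be measurable in time, so its integral
    is only ever compared from below with that of a continuous function. *)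

Definition cont_on a b f := {within [set t | a <= t <= b], continuous f}.

Lemma set_cc a b : [set t | a <= t <= b] = `[a, b]%classic.
Proof. by apply/seteqP; split => t /=; rewrite in_itv. Qed.

Lemma cont_onP a b f : cont_on a b f <->
  forall t, a <= t <= b -> f @ within [set s | a <= s <= b] (nbhs t) --> f t.
Proof. exact: subspace_continuousP. Qed.

Lemma cont_on_cst a b (c : R) : cont_on a b (fun=> c).
Proof. by apply/cont_onP => t tab; exact: cvg_cst. Qed.

Lemma cont_onD a b f g : cont_on a b f -> cont_on a b g ->
  cont_on a b (fun t => f t + g t).
Proof.
by move=> /cont_onP cf /cont_onP cg; apply/cont_onP => t tab; apply: cvgD; [exact: cf|exact: cg].
Qed.

Lemma cont_onM a b f g : cont_on a b f -> cont_on a b g ->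
  cont_on a b (fun t => f t * g t).
Proof.
by move=> /cont_onP cf /cont_onP cg; apply/cont_onP => t tab; apply: cvgM; [exact: cf|exact: cg].
Qed.

Lemma cont_onV a b f : cont_on a b f -> (forall t, a <= t <= b -> f t != 0) ->
  cont_on a b (fun t => (f t)^-1).
Proof.
move=> /cont_onP cf f0; apply/cont_onP => t tab; apply: cvgV; [exact: f0|exact: cf].
Qed.

Lemma cont_on_sum a b (I : Type) (r : seq I) (P : pred I) (f : I -> R -> R) :
  (forall i, P i -> cont_on a b (f i)) ->
  cont_on a b (fun t => \sum_(i <- r | P i) f i t).
Proof.
move=> cf; elim: r => [|i r IH].
  rewrite (_ : (fun _ => _) = fun=> 0); first exact: cont_on_cst.
  by apply/funext => t; rewrite big_nil.
rewrite (_ : (fun _ => _) = fun t => (if P i then f i t else 0) + \sum_(i <- r | P i) f i t).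
  apply: cont_onD => //; case: (boolP (P i)) => Pi; [exact: cf|exact: cont_on_cst].
by apply/funext => t; rewrite big_cons; case: ifP; rewrite ?add0r.
Qed.

Lemma cont_on_prod a b (I : Type) (r : seq I) (P : pred I) (f : I -> R -> R) :
  (forall i, P i -> cont_on a b (f i)) ->
  cont_on a b (fun t => \prod_(i <- r | P i) f i t).
Proof.
move=> cf; elim: r => [|i r IH].
  rewrite (_ : (fun _ => _) = fun=> 1); first exact: cont_on_cst.
  by apply/funext => t; rewrite big_nil.
rewrite (_ : (fun _ => _) = fun t => (if P i then f i t else 1) * \prod_(i <- r | P i) f i t).
  apply: cont_onM => //; case: (boolP (P i)) => Pi; [exact: cf|exact: cont_on_cst].
by apply/funext => t; rewrite big_cons; case: ifP; rewrite ?mul1r.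
Qed.

Lemma eq_cont_on a b f g : (forall t, a <= t <= b -> f t = g t) ->
  cont_on a b f -> cont_on a b g.
Proof.
move=> fg /cont_onP cf; apply/cont_onP => t tab; rewrite -fg//.
apply: cvg_trans (cf t tab); apply: near_eq_cvg.
by rewrite near_withinE; apply: nearW => s; exact: fg.
Qed.

Lemma continuous_cont_on a b f : continuous f -> cont_on a b f.
Proof. by move=> cf; exact: continuous_subspaceT. Qed.

Lemma cont_on_sub a b a' b' f : a <= a' -> b' <= b -> cont_on a b f -> cont_on a' b' f.
Proof.
move=> aa bb; apply: continuous_subspaceW => t /= /andP[t1 t2].
by rewrite (le_trans aa)//= (le_trans t2).
Qed.

Lemma deriv_on_cont a b f f' : deriv_on a b f f' -> cont_on a b f.
Proof.
move=> df; apply/cont_onP => t tab.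
have := df t tab.
set W := within _ _ => dW.
have h : (fun s => f t + (f s - f t) / (s - t) * (s - t)) @ W --> f t.
  rewrite -[X in _ --> X]addr0 -[X in _ + X](mulr0 (f' t)).
  apply: cvgD; first exact: cvg_cst.
  apply: cvgM => //; rewrite -(subrr t).
  by apply: cvg_within_filter; apply: cvgB; [exact: cvg_id|exact: cvg_cst].
apply/cvgrPdist_lt => e e0.
have := h; move=> /cvgrPdist_lt/(_ _ e0).
rewrite !near_withinE; apply: filterS => s /= H sab.
have [->|st] := eqVneq s t; first by rewrite subrr normr0.
have := H; rewrite sab st => /(_ (conj isT isT)).
by rewrite divfK ?subr_eq0// addrCA subrr addr0.
Qed.

Lemma eq_deriv_on a b f g f' g' : (forall t, a <= t <= b -> f t = g t) ->
  (forall t, a <= t <= b -> f' t = g' t) -> deriv_on a b f f' -> deriv_on a b g g'.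
Proof.
move=> fg fg' df t tab; rewrite -fg'//.
apply: cvg_trans (df t tab); apply: near_eq_cvg.
rewrite near_withinE; apply: nearW => s /= [sab _].
by rewrite !fg.
Qed.

Lemma deriv_on_cst a b (c : R) : deriv_on a b (fun=> c) (fun=> 0).
Proof.
move=> t tab; rewrite (_ : (fun _ => _) = fun=> 0); first exact: cvg_cst.
by apply/funext => s; rewrite subrr mul0r.
Qed.

Arguments deriv_on_cst : clear implicits.

Lemma deriv_onD a b f g f' g' : deriv_on a b f f' -> deriv_on a b g g' ->
  deriv_on a b (fun t => f t + g t) (fun t => f' t + g' t).
Proof.
move=> df dg t tab; rewrite [X in X @ _](_ : _ = fun s => (f s - f t) / (s - t) + (g s - g t) / (s - t)).
  by apply: cvgD; [exact: df|exact: dg].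
by apply/funext => s; rewrite -mulrDl; congr (_ / _); ring.
Qed.

Lemma deriv_onM a b f g f' g' : deriv_on a b f f' -> deriv_on a b g g' ->
  deriv_on a b (fun t => f t * g t) (fun t => f' t * g t + f t * g' t).
Proof.
move=> df dg t tab.
rewrite [X in X @ _](_ : _ = fun s => (f s - f t) / (s - t) * g t + f s * ((g s - g t) / (s - t))).
  apply: cvgD; apply: cvgM; [exact: df|exact: cvg_cst| |exact: dg].
  have /cont_onP/(_ t tab) := deriv_on_cont df.
  by apply: cvg_trans; apply: cvg_app; apply: within_subset => s /= [].
by apply/funext => s; rewrite mulrAC mulrA -mulrDl; congr (_ / _); ring.
Qed.

Lemma deriv_onZ a b (c : R) f f' : deriv_on a b f f' ->
  deriv_on a b (fun t => c * f t) (fun t => c * f' t).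
Proof.
move=> df; apply: (eq_deriv_on _ _ (deriv_onM (deriv_on_cst a b c) df)) => // t _.
by rewrite mul0r add0r.
Qed.

Lemma deriv_on_sum a b (I : Type) (r : seq I) (P : pred I) (f f' : I -> R -> R) :
  (forall i, P i -> deriv_on a b (f i) (f' i)) ->
  deriv_on a b (fun t => \sum_(i <- r | P i) f i t) (fun t => \sum_(i <- r | P i) f' i t).
Proof.
move=> df; elim: r => [|i r IH].
  by apply: (eq_deriv_on _ _ (deriv_on_cst a b 0)) => t _; rewrite big_nil.
case: (boolP (P i)) => Pi.
  by apply: (eq_deriv_on _ _ (deriv_onD (df i Pi) IH)) => t _; rewrite big_cons Pi.
by apply: (eq_deriv_on _ _ IH) => t _; rewrite big_cons (negbTE Pi).
Qed.

Lemma deriv_on_is_derive a b f f' t : deriv_on a b f f' -> a < t < b ->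
  is_derive t 1 f (f' t).
Proof.
move=> df /andP[at_ tb].
have tab : a <= t <= b by rewrite !ltW.
have h : (fun h : R => h^-1 *: (f (h *: 1 + t) - f t)) @ 0^' --> f' t.
  apply/cvgrPdist_lt => e e0.
  move: (df t tab) => /cvgrPdist_lt/(_ _ e0).
  rewrite near_withinE => -[d /= d0 H].
  pose d' := Num.min d (Num.min (t - a) (b - t)).
  have d'0 : 0 < d' by rewrite !lt_min d0 !subr_gt0 at_ tb.
  exists d' => //= s; rewrite /ball /= sub0r normrN => sd s0.
  move: sd; rewrite !lt_min => /andP[sd /andP[sa sb]].
  have := H (s + t); rewrite /ball_ /= opprD addrCA subrr addr0 normrN => /(_ sd).
  rewrite addrK [s *: 1]mulr1 [_ *: _]mulrC; apply.
  move: sa sb; rewrite !ltr_norml => /andP[? ?] /andP[? ?].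
  by split; [lra|apply/eqP; lra].
apply: DeriveDef; first by apply/cvg_ex; exists (f' t).
exact: cvg_lim h.
Qed.

Lemma is_derive_deriv_on a b f f' : (forall t, a <= t <= b -> is_derive t 1 f (f' t)) ->
  deriv_on a b f f'.
Proof.
move=> df t tab; have [] := df t tab => /cvg_ex[l fl] fE.
have {fE} fE : l = f' t by rewrite -fE; apply/esym/cvg_lim.
apply/cvgrPdist_lt => e e0; move: fl => /cvgrPdist_lt/(_ _ e0) [d /= d0 H].
rewrite near_withinE; exists d => //= s; rewrite /ball /= => sd [_ st].
have := H (s - t); rewrite /ball /= sub0r normrN distrC => /(_ sd).
by rewrite subr_eq0 => /(_ st); rewrite [_ *: 1]mulr1 subrK [_ *: _]mulrC fE.
Qed.

(** The sign is required in the open interval only; continuity covers the endpoints. This matters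
    because the evolution equation is posed for positive times, while the estimates start at time
    [0]. *)
Lemma deriv_on_ndecr a b f f' : deriv_on a b f f' ->
  (forall t, a < t < b -> 0 <= f' t) -> forall s t, a <= s -> s <= t -> t <= b -> f s <= f t.
Proof.
move=> df f'0; apply: ger0_derive1_ndecr.
- by move=> x; rewrite in_itv/= => xab; have [] := deriv_on_is_derive df xab.
- move=> x; rewrite in_itv/= => xab; rewrite derive1E.
  by have [_ ->] := deriv_on_is_derive df xab; exact: f'0.
- by rewrite -set_cc; exact: deriv_on_cont df.
Qed.

Lemma deriv_on_le a b f f' g g' : deriv_on a b f f' -> deriv_on a b g g' ->
  (forall t, a < t < b -> f' t <= g' t) -> f a <= g a ->
  forall t, a <= t <= b -> f t <= g t.
Proof.
move=> df dg fg fga t /andP[ta tb].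
have dh : deriv_on a b (fun t => g t + (-1) * f t) (fun t => g' t + (-1) * f' t).
  by apply: deriv_onD => //; exact: deriv_onZ.
have := deriv_on_ndecr dh; move=> /(_ _ a t (lexx a) ta tb).
have h s : a < s < b -> 0 <= g' s + -1 * f' s by move=> /fg; lra.
by move=> /(_ h); lra.
Qed.

Lemma deriv_on0_cst a b f f' : deriv_on a b f f' ->
  (forall t, a <= t <= b -> f' t = 0) -> forall t, a <= t <= b -> f t = f a.
Proof.
move=> df f0 t tab; apply/eqP; rewrite eq_le; apply/andP; split.
  apply: (@deriv_on_le a b f f' (fun=> f a) (fun=> 0)) => //; first exact: deriv_on_cst.
  by move=> s /andP[s1 s2]; rewrite f0// !ltW.
apply: (@deriv_on_le a b (fun=> f a) (fun=> 0) f f') => //; first exact: deriv_on_cst.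
by move=> s /andP[s1 s2]; rewrite f0// !ltW.
Qed.

Lemma cont_on_integrable a b f : cont_on a b f ->
  (@lebesgue_measure R).-integrable [set t | a <= t <= b] (EFin \o f).
Proof.
rewrite /cont_on set_cc => cf; apply: continuous_compact_integrable => //.
exact: segment_compact.
Qed.

Lemma Rintegral_deriv a b F f t : deriv_on a b F f -> cont_on a b f -> a <= t <= b ->
  Rintegral lebesgue_measure [set s | a <= s <= t] f = F t - F a.
Proof.
move=> dF cf /andP[]; rewrite le_eqVlt => /orP[/eqP <- _|at_ tb].
  rewrite (_ : [set s | _] = [set a]) ?Rintegral_set1 ?subrr//.
  by apply/seteqP; split => s /=; [rewrite -eq_le eq_sym => /eqP|move=> ->; rewrite lexx].
rewrite /Rintegral set_cc (@continuous_FTC2 R f F a t) => //.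
- by rewrite -set_cc; exact: cont_on_sub cf.
- have cF : {within `[a, t], continuous F}.
    by rewrite -set_cc; apply: cont_on_sub (deriv_on_cont dF).
  move: cF => /(continuous_within_itvP _ at_)[_ ? ?].
  split => // x; rewrite in_itv/= => /andP[ax xt].
  have xab : a < x < b by rewrite ax (lt_le_trans xt).
  by have [] := deriv_on_is_derive dF xab.
- move=> x; rewrite in_itv/= => /andP[ax xt]; rewrite derive1E.
  have xab : a < x < b by rewrite ax (lt_le_trans xt).
  by have [_ ->] := deriv_on_is_derive dF xab.
Qed.

Lemma primitive a b f : a <= b -> continuous f ->
  exists F, F a = 0 /\ deriv_on a b F f.
Proof.
move=> ab cf.
(* Integrating from [a - 1], inside [[a - 1, b + 1]], makes every point of [[a, b]] an interior
   point, so the fundamental theorem yields a two-sided derivative at [a] and [b] too. *)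
pose G x := \int[lebesgue_measure]_(t in [set` `[a - 1, x]]) (f t).
exists (fun x => G x - G a); split; first by rewrite subrr.
apply: is_derive_deriv_on => t /andP[at_ tb].
have i : (@lebesgue_measure R).-integrable `[a - 1, b + 1] (EFin \o f).
  by rewrite -set_cc; apply: cont_on_integrable; exact: continuous_cont_on.
have tb1 : t < b + 1 by lra.
have at1 : a - 1 < t by lra.
have [dG G'] := @continuous_FTC1_closed R f (a - 1) t (b + 1) tb1 i at1 (cf t).
rewrite -[f t]subr0; apply: is_deriveB; rewrite -G' derive1E.
exact: derivableP.
Qed.

(** Composition with this retraction onto [[a, b]] extends a function continuous on the interval to
    one continuous on the line, as [primitive] demands. *)
Definition clamp a b t : R := Num.max a (Num.min b t).

Lemma clamp_in a b t : a <= b -> a <= clamp a b t <= b.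
Proof. by move=> ab; rewrite /clamp le_max lexx/= ge_max ab ge_min lexx. Qed.

Lemma clamp_id a b t : a <= t <= b -> clamp a b t = t.
Proof. by move=> /andP[at_ tb]; rewrite /clamp (min_idPr tb) (max_idPr at_). Qed.

Lemma cont_on_clamp a b f : a <= b -> cont_on a b f -> continuous (f \o clamp a b).
Proof.
move=> ab /cont_onP cf t.
have c : clamp a b @ nbhs t --> clamp a b t.
  apply: (@continuous_max _ _ (fun=> a) (Num.min b)); first exact: cvg_cst.
  by apply: (@continuous_min _ _ (fun=> b) id); [exact: cvg_cst|exact: cvg_id].
have := cf _ (clamp_in t ab).
apply: cvg_trans; apply: (@cvg_app _ _ (clamp a b @ nbhs t) _ f) => U /= HU.
have : \forall s \near t, a <= clamp a b s <= b -> U (clamp a b s) by exact: (c _ HU).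
by apply: filterS => s; apply; exact: clamp_in.
Qed.

Lemma cont_on_bounded a b f : a <= b -> cont_on a b f ->
  exists2 K, 0 < K & forall t, a <= t <= b -> `|f t| <= K.
Proof.
move=> ab cf.
have cf' : {within `[a, b], continuous (fun t => `|f t|)}.
  rewrite -set_cc; apply/cont_onP => t tab; apply: cvg_norm.
  by move/cont_onP : cf; apply.
have [c _ H] := EVT_max ab cf'.
exists (`|f c| + 1) => [|t tab]; first by rewrite ltr_wpDl.
by rewrite (le_trans (H t _)) ?in_itv//= lerDl.
Qed.

End Calculus.
Arguments deriv_on_cst {R} a b c.

(** * Linear systems of ordinary differential equations *)

Section LinearODE.
Variable R : realType.

Lemma half_pow_small (c e : R) : 0 < e -> exists N, c / 2 ^+ N < e.
Proof.
move=> e0; exists (Num.bound (c / e)).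
by rewrite ltr_pdivrMr ?exprn_gt0// mulrC -ltr_pdivrMr// upper_nthrootP.
Qed.

Lemma half_pow_le (c : R) n m : 0 <= c -> (n <= m)%N -> c / 2 ^+ m <= c / 2 ^+ n.
Proof.
move=> c0 nm; apply: ler_wpM2l => //.
by rewrite lef_pV2 ?posrE ?exprn_gt0// ler_weXn2l// ler1n.
Qed.

(** The factor [2] is the sum of the geometric tail. The induction carries the exact partial sum,
    whose subtracted term is dropped afterwards. *)
Lemma half_pow_limit (u : R^nat) (c : R) : 0 <= c ->
  (forall n, `|u n.+1 - u n| <= c / 2 ^+ n) ->
  cvgn u /\ forall n, `|limn u - u n| <= c * 2 / 2 ^+ n.
Proof.
move=> c0 H.
have step n k : `|u (n + k)%N - u n| <= c * 2 / 2 ^+ n - c * 2 / 2 ^+ (n + k).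
  elim: k => [|k IH]; first by rewrite addn0 !subrr normr0.
  rewrite addnS; apply: le_trans (ler_distD (u (n + k)%N) _ _) _.
  apply: le_trans (lerD (H _) IH) _.
  rewrite exprS.
  have := lt0r_neq0 (exprn_gt0 (n + k) (ltr0n R 2)).
  have := lt0r_neq0 (exprn_gt0 n (ltr0n R 2)) => p0 q0.
  by rewrite le_eqVlt; apply/orP; left; apply/eqP; field; rewrite p0 q0.
have step' n m : (n <= m)%N -> `|u m - u n| <= c * 2 / 2 ^+ n.
  move=> nm; rewrite -(subnKC nm); apply: le_trans (step _ _) _.
  by rewrite gerBl divr_ge0// mulr_ge0.
have cu : cvgn u.
  apply/cauchy_cvgP/cauchy_exP => e e0.
  have [N cN] := half_pow_small (c * 2) e0.
  exists (u N); exists N => // m /= Nm.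
  by rewrite /ball/= distrC (le_lt_trans (step' _ _ Nm)).
split=> // n; apply/ler_addgt0Pl => e e0.
move: (cu) => /cvgrPdist_lt/(_ _ e0) [N _ HN].
apply: le_trans (ler_distD (u (maxn N n)) _ _) _; apply: lerD.
  by apply/ltW/HN; exact: leq_maxl.
by apply: step'; exact: leq_maxr.
Qed.

(** Picard iteration on all of [[0, T]] at once: measured with the weight [expR (2 * K * t)], each
    step halves the distance between consecutive iterates, so no restriction to short times is
    needed. *)
Lemma linear_ode (I : finType) (T : R) (B : R -> I -> I -> R) (y0 : I -> R) :
  0 <= T -> (forall i j, cont_on 0 T (fun t => B t i j)) ->
  exists y : R -> I -> R, (forall i, y 0 i = y0 i) /\
    forall i, deriv_on 0 T (fun t => y t i) (fun t => \sum_j B t i j * y t j).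
Proof.
move=> T0 cB.
have in0 : (0 : R) <= 0 <= T by rewrite lexx.
(* The implication is placed under the existential so that choice gives a total operator [prim]; its
   value at a function that is not continuous is arbitrary. *)
have prim_ex f : exists F, cont_on 0 T f -> F 0 = 0 /\ deriv_on 0 T F f.
  have [cf|ncf] := pselect (cont_on 0 T f); last by exists (fun=> 0).
  have [F [F0 dF]] := primitive T0 (cont_on_clamp T0 cf).
  exists F => _; split=> //; apply: (eq_deriv_on _ _ dF) => // t tT.
  by rewrite /= clamp_id.
pose prim f := projT1 (cid (prim_ex f)).
have primP f : cont_on 0 T f -> prim f 0 = 0 /\ deriv_on 0 T (prim f) f.
  exact: projT2 (cid (prim_ex f)).
(* Integral estimates are obtained by comparing derivatives, with [g] a majorant known through its
   own derivative. *)
have prim_le f1 f2 g g' : cont_on 0 T f1 -> cont_on 0 T f2 -> deriv_on 0 T g g' ->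
    0 <= g 0 -> (forall t, 0 <= t <= T -> `|f1 t - f2 t| <= g' t) ->
    forall t, 0 <= t <= T -> `|prim f1 t - prim f2 t| <= g t.
  move=> cf1 cf2 dg g0 f12 t tT.
  have [p10 dp1] := primP _ cf1; have [p20 dp2] := primP _ cf2.
  have d12 := deriv_onD dp1 (deriv_onZ (c := -1) dp2).
  rewrite ler_norml; apply/andP; split.
    have h s : 0 < s < T -> -1 * g' s <= f1 s + -1 * f2 s.
      move=> /andP[/ltW s0 /ltW sT]; have := f12 s; rewrite s0 sT => /(_ isT).
      by rewrite ler_norml => /andP[]; lra.
    have h0 : -1 * g 0 <= prim f1 0 + -1 * prim f2 0 by rewrite p10 p20; lra.
    by have := deriv_on_le (deriv_onZ (c := -1) dg) d12 h h0 tT; lra.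
  have h s : 0 < s < T -> f1 s + -1 * f2 s <= g' s.
    move=> /andP[/ltW s0 /ltW sT]; have := f12 s; rewrite s0 sT => /(_ isT).
    by rewrite ler_norml => /andP[]; lra.
  have h0 : prim f1 0 + -1 * prim f2 0 <= g 0 by rewrite p10 p20; lra.
  by have := deriv_on_le d12 dg h h0 tT; lra.
pose rhs (y : R -> I -> R) i s := \sum_j B s i j * y s j.
have c_rhs y i : (forall j, cont_on 0 T (fun t => y t j)) -> cont_on 0 T (rhs y i).
  by move=> cy; apply: cont_on_sum => j _; exact: cont_onM.
pose step y t i : R := y0 i + prim (rhs y i) t.
have c_step y : (forall j, cont_on 0 T (fun t => y t j)) ->
    forall j, cont_on 0 T (fun t => step y t j).
  move=> cy j; apply: cont_onD; first exact: cont_on_cst.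
  exact: deriv_on_cont (proj2 (primP _ (c_rhs _ j cy))).
pose it n := iter n step (fun=> y0).
have c_it n : forall j, cont_on 0 T (fun t => it n t j).
  elim: n => [|n IH]; last exact: c_step.
  by move=> j; exact: cont_on_cst.
have [K0 K00 BK0] : exists2 K0, 0 < K0 & forall i j t, 0 <= t <= T -> `|B t i j| <= K0.
  have /choice[k kP] : forall ij : I * I, exists k, 0 < k /\
      forall t, 0 <= t <= T -> `|B t ij.1 ij.2| <= k.
    by move=> ij; have [k k0 kP] := cont_on_bounded T0 (cB ij.1 ij.2); exists k.
  exists (\sum_ij k ij + 1) => [|i j t tT].
    by rewrite ltr_wpDl// sumr_ge0// => ij _; rewrite ltW//; have [] := kP ij.
  apply: le_trans (proj2 (kP (i, j)) t tT) _.
  rewrite (bigD1 (i, j))//= -addrA lerDl addr_ge0// sumr_ge0// => ij _.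
  by rewrite ltW//; have [] := kP ij.
(* Lipschitz constant of the right-hand side for the maximum over components; the [1] keeps it
   positive when [I] is empty. *)
pose K := K0 * #|I|%:R + 1.
have K_gt0 : 0 < K by rewrite ltr_wpDl// mulr_ge0// ltW.
have rhs_le y z i t e : 0 <= t <= T -> 0 <= e -> (forall j, `|y t j - z t j| <= e) ->
    `|rhs y i t - rhs z i t| <= K * e.
  move=> tT e0 yz; rewrite /rhs -sumrB; apply: le_trans (ler_norm_sum _ _ _) _.
  apply: (@le_trans _ _ (\sum_(j : I) K0 * e)).
    by apply: ler_sum => j _; rewrite -mulrBr normrM ler_pM// BK0.
  by rewrite sumr_const -[_ *+ _]mulr_natr /K mulrDl mul1r mulrAC lerDl.
have [C0 C00 C0P] : exists2 C0, 0 < C0 & forall i t, 0 <= t <= T -> `|it 1%N t i - it 0%N t i| <= C0.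
  have /choice[k kP] : forall i, exists k, 0 < k /\
      forall t, 0 <= t <= T -> `|it 1%N t i - it 0%N t i| <= k.
    move=> i; have [|k k0 kP] := @cont_on_bounded _ 0 T (fun t => it 1%N t i + -1 * it 0%N t i) T0.
      by apply: cont_onD => //; apply: cont_onM => //; exact: cont_on_cst.
    by exists k; split=> // t /kP; rewrite mulN1r.
  exists (\sum_i k i + 1) => [|i t tT].
    by rewrite ltr_wpDl// sumr_ge0// => i _; rewrite ltW//; have [] := kP i.
  apply: le_trans (proj2 (kP i) t tT) _.
  rewrite (bigD1 i)//= -addrA lerDl addr_ge0// sumr_ge0// => j _.
  by rewrite ltW//; have [] := kP j.
(* The weight gains a factor [2 * K] by differentiation, so integrating [K] times the weight costs
   only one half. *)
have dE c : deriv_on 0 T (fun t => c * expR (2 * K * t)) (fun t => c * (2 * K) * expR (2 * K * t)).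
  apply: is_derive_deriv_on => t _; rewrite -[c * _ * _]mulrA.
  apply: is_derive_eq.
  by rewrite /GRing.scale/= mulr1 [expR _ * _]mulrC.
have dlt n : forall i t, 0 <= t <= T ->
    `|it n.+1 t i - it n t i| <= C0 / 2 ^+ n * expR (2 * K * t).
  elim: n => [|n IH] i t tT.
    rewrite expr0 divr1 (le_trans (C0P i t tT))// ler_peMr ?(ltW C00)//.
    apply: le_trans (expR_ge1Dx _); rewrite lerDl; move/andP : tT => [t0 _]; by rewrite mulr_ge0// mulr_ge0// ltW.
  rewrite /it/= /step opprD addrACA subrr add0r.
  apply: (prim_le (rhs (it n.+1) i) (rhs (it n) i) _ _ _ _ (dE (C0 / 2 ^+ n.+1))) => //.
  - exact: (c_rhs (it n.+1)).
  - exact: (c_rhs (it n)).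
  - by rewrite mulr_ge0 ?expR_ge0// divr_ge0// ltW.
  move=> s sT; apply: le_trans (rhs_le _ _ _ _ _ sT _ (fun j => IH j s sT)) _.
    by rewrite mulr_ge0 ?expR_ge0// divr_ge0// ltW.
  have := lt0r_neq0 (exprn_gt0 n (ltr0n R 2)) => p0.
  by rewrite exprS le_eqVlt; apply/orP; left; apply/eqP; field.
pose M := C0 * expR (2 * K * T).
have M0 : 0 <= M by rewrite mulr_ge0 ?expR_ge0// ltW.
have dlt' n i t : 0 <= t <= T -> `|it n.+1 t i - it n t i| <= M / 2 ^+ n.
  move=> tT; apply: le_trans (dlt n i t tT) _.
  rewrite /M mulrAC; apply: ler_wpM2r; first by rewrite invr_ge0 exprn_ge0.
  apply: ler_wpM2l; first exact: ltW.
  by rewrite ler_expR ler_pM2l ?mulr_gt0//; case/andP : tT.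
pose y t i := limn (fun n => it n t i).
have yP t i n : 0 <= t <= T -> `|y t i - it n t i| <= M * 2 / 2 ^+ n.
  by move=> tT; have [_] := half_pow_limit M0 (fun n => dlt' n i t tT); apply.
have c_y i : cont_on 0 T (fun t => y t i).
  apply/cont_onP => t tT; apply/cvgrPdist_lt => e e0.
  have e3 : 0 < e / 3 by rewrite divr_gt0.
  have [n ne] := half_pow_small (M * 2) e3.
  have := c_it n i; move/cont_onP/(_ t tT)/cvgrPdist_lt/(_ _ e3).
  rewrite !near_withinE; apply: filterS => s /= H sT; have := H sT => {}H.
  have := le_lt_trans (yP t i n tT) ne; have := le_lt_trans (yP s i n sT) ne.
  move: H; rewrite !ltr_norml => /andP[? ?] /andP[? ?] /andP[? ?].
  by apply/andP; split; lra.
have yE i t : 0 <= t <= T -> y t i = step y t i.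
  move=> tT; apply/eqP; rewrite -subr_eq0 -normr_le0; apply/ler_addgt0Pl => e e0.
  rewrite addr0.
  (* The defect of the limit splits into the distance to the next iterate, at most [M * 2 / 2 ^+ n],
     and the integrated difference of right-hand sides, at most [K * T] times that. *)
  pose c := M * 2 * (1 + K * T).
  have [n nc] := half_pow_small c e0; apply: le_trans (ltW nc).
  apply: le_trans (ler_distD (it n.+1 t i) _ _) _.
  rewrite /c mulrDr mulr1 mulrDl; apply: lerD.
    by apply: le_trans (yP t i n.+1 tT) _; apply: half_pow_le => //; rewrite mulr_ge0.
  rewrite /it/= /step opprD addrACA subrr add0r.
  have e1 : 0 <= M * 2 / 2 ^+ n by rewrite divr_ge0// mulr_ge0.
  have dl : deriv_on 0 T (fun t => K * (M * 2 / 2 ^+ n) * t) (fun=> K * (M * 2 / 2 ^+ n)).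
    apply: is_derive_deriv_on => s _; apply: is_derive_eq.
    by rewrite /GRing.scale/= !mulr1.
  apply: le_trans (prim_le _ _ _ _ (c_rhs (it n) i (c_it n)) (c_rhs y i c_y) dl _ _ t tT) _.
  - by rewrite mulr0.
  - by move=> s sT; apply: rhs_le => // j; rewrite distrC yP.
  rewrite (_ : M * 2 * (K * T) / _ = K * (M * 2 / 2 ^+ n) * T); last by ring.
  apply: ler_wpM2l; first by rewrite mulr_ge0// ltW.
  by case/andP : tT.
exists y; split=> i.
  by rewrite yE// /step (proj1 (primP _ (c_rhs y i c_y))) addr0.
have := deriv_onD (deriv_on_cst 0 T (y0 i)) (proj2 (primP _ (c_rhs y i c_y))).
apply: eq_deriv_on => t tT; last by rewrite add0r.
by rewrite yE.
Qed.

End LinearODE.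

(** * Integration of polynomials over simplices *)

Section ReferenceIntegral.
Variable R : realType.
Local Notation env := (nat -> R).

(** Same body as the environment built inside [refint], so that unfolding [refint] exposes it by
    conversion. *)
Definition scons (s : R) (l : env) : env := fun i => if i is j.+1 then l j else s.

(** Environments are infinite sequences, so integration variables and parameters can be added,
    dropped or permuted without a change of type. *)
Inductive polyf : (env -> R) -> Prop :=
| polyf_cst c : polyf (fun=> c)
| polyf_var i : polyf (fun e => e i)
| polyfD P Q : polyf P -> polyf Q -> polyf (fun e => P e + Q e)
| polyfM P Q : polyf P -> polyf Q -> polyf (fun e => P e * Q e).

Lemma polyf_subst P (h : env -> env) : polyf P -> (forall i, polyf (fun e => h e i)) ->
  polyf (fun e => P (h e)).
Proof.
move=> + hh; elim => [c|i|{}P Q _ IP _ IQ|{}P Q _ IP _ IQ].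
- exact: polyf_cst.
- exact: hh.
- exact: polyfD.
- exact: polyfM.
Qed.

Lemma polyfX P n : polyf P -> polyf (fun e => P e ^+ n).
Proof.
move=> pP; elim: n => [|n IH].
  by rewrite (_ : (fun _ => _) = fun=> 1) //; exact: polyf_cst.
rewrite (_ : (fun _ => _) = fun e => P e * P e ^+ n); first exact: polyfM.
by apply/funext => e; rewrite exprS.
Qed.

Lemma polyf_sum (I : Type) (r : seq I) (A : pred I) (P : I -> env -> R) :
  (forall i, polyf (P i)) -> polyf (fun e => \sum_(i <- r | A i) P i e).
Proof.
move=> pP; elim: r => [|i r IH].
  by rewrite (_ : (fun _ => _) = fun=> 0); [exact: polyf_cst|apply/funext => e; rewrite big_nil].
case: (boolP (A i)) => Ai.
  rewrite (_ : (fun _ => _) = fun e => P i e + \sum_(i <- r | A i) P i e); first exact: polyfD.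
  by apply/funext => e; rewrite big_cons Ai.
by under eq_fun do rewrite big_cons (negbTE Ai).
Qed.

Lemma polyf_prod (I : Type) (r : seq I) (A : pred I) (P : I -> env -> R) :
  (forall i, polyf (P i)) -> polyf (fun e => \prod_(i <- r | A i) P i e).
Proof.
move=> pP; elim: r => [|i r IH].
  by rewrite (_ : (fun _ => _) = fun=> 1); [exact: polyf_cst|apply/funext => e; rewrite big_nil].
case: (boolP (A i)) => Ai.
  rewrite (_ : (fun _ => _) = fun e => P i e * \prod_(i <- r | A i) P i e); first exact: polyfM.
  by apply/funext => e; rewrite big_cons Ai.
by under eq_fun do rewrite big_cons (negbTE Ai).
Qed.

Lemma polyf_continuous P (h : R -> env) : polyf P -> (forall i, continuous (fun s => h s i)) ->
  continuous (fun s => P (h s)).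
Proof.
move=> + ch; elim => [c|i|{}P Q _ IP _ IQ|{}P Q _ IP _ IQ] s.
- exact: cvg_cst.
- exact: ch.
- by apply: cvgD; [exact: IP|exact: IQ].
- by apply: cvgM; [exact: IP|exact: IQ].
Qed.

(* Expansion in powers of the first variable; exponents may repeat. *)
Inductive powsum : (R -> env -> R) -> Prop :=
| powsum0 : powsum (fun _ _ => 0)
| powsumS a k F : polyf a -> powsum F -> powsum (fun s e => a e * s ^+ k + F s e).

Lemma powsumD F G : powsum F -> powsum G -> powsum (fun s e => F s e + G s e).
Proof.
move=> + pG; elim => [|a k {}F pa pF IH].
  by under eq_fun do under eq_fun do rewrite add0r.
by under eq_fun do under eq_fun do rewrite -addrA; exact: powsumS.
Qed.

Lemma powsum_mono a k F : polyf a -> powsum F -> powsum (fun s e => a e * s ^+ k * F s e).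
Proof.
move=> pa; elim => [|b j {}F pb pF IH].
  by under eq_fun do under eq_fun do rewrite mulr0; exact: powsum0.
under eq_fun do under eq_fun do rewrite mulrDr mulrACA -exprD.
by apply: powsumS => //; exact: polyfM.
Qed.

Lemma powsumM F G : powsum F -> powsum G -> powsum (fun s e => F s e * G s e).
Proof.
move=> + pG; elim => [|a k {}F pa pF IH].
  by under eq_fun do under eq_fun do rewrite mul0r; exact: powsum0.
under eq_fun do under eq_fun do rewrite mulrDl.
by apply: powsumD => //; exact: powsum_mono.
Qed.

Lemma polyf_powsum P : polyf P -> powsum (fun s e => P (scons s e)).
Proof.
elim => [c|i|{}P Q _ IP _ IQ|{}P Q _ IP _ IQ].
- have := powsumS 0 (polyf_cst c) powsum0.
  by under eq_fun do under eq_fun do rewrite expr0 mulr1 addr0.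
- case: i => [|i].
    have := powsumS 1 (polyf_cst 1) powsum0.
    by under eq_fun do under eq_fun do rewrite mul1r addr0.
  have := powsumS 0 (polyf_var i) powsum0.
  by under eq_fun do under eq_fun do rewrite expr0 mulr1 addr0.
- exact: powsumD.
- exact: powsumM.
Qed.

(** Termwise integration in the first variable; the result is again polynomial in all variables
    jointly, and this keeps the iterated integrals within the class. *)
Lemma powsum_antiderivative F : powsum F -> exists Q, polyf Q /\
  forall (e : env) (s : R), is_derive s 1 (fun s => Q (scons s e)) (F s e).
Proof.
elim => [|a k {}F pa pF [Q [pQ dQ]]].
  by exists (fun=> 0); split; [exact: polyf_cst|move=> e s; exact: is_derive_cst].
exists (fun z => a (fun i => z i.+1) * (z 0%N ^+ k.+1 * k.+1%:R^-1) + Q z); split.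
  apply: polyfD => //; apply: polyfM.
    by apply: polyf_subst => // i; exact: polyf_var.
  apply: polyfM; last exact: polyf_cst.
  by apply: polyfX; exact: polyf_var.
move=> e s; apply: is_deriveD => /=.
rewrite (_ : (fun x => _) = fun x => (a e / k.+1%:R) * x ^+ k.+1); last first.
  by apply/funext => x; rewrite mulrCA mulrC.
have d1 := @is_deriveX R R id k.+1 s 1 1 (is_derive_id s 1).
have d2 := @is_deriveZ R R R _ (a e / k.+1%:R) s 1 _ d1.
rewrite exprfctE in d2; apply: (is_derive_eq d2).
rewrite /GRing.scale/= mulr1.
have k0 : k.+1%:R != 0 :> R by rewrite pnatr_eq0.
by field.
Qed.

(** The [n] integration variables followed by the parameters. *)
Definition splice (n : nat) (l e : env) : env := fun i => if (i < n)%N then l i else e (i - n)%N.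

(** Induction on the dimension: the inner integral is polynomial in its size [r - s] and in the
    parameters, among them [s]; the outer one is then a difference of values of a polynomial
    antiderivative. In [Q] the size is variable [0]. *)
Lemma refint_polyf n P : polyf P -> exists Q, polyf Q /\
  forall r e, 0 <= r -> refint n r (fun l => P (splice n l e)) = Q (scons r e).
Proof.
elim: n P => [|n IH] P pP.
  exists (fun z => P (fun i => z i.+1)); split.
    by apply: polyf_subst => // i; exact: polyf_var.
  by move=> r e _ /=; congr P; apply/funext => i; rewrite /splice/= subn0.
(* In the inner integral the outer variable is the first parameter, at position [n]; [tau] moves it
   back to position [0]. *)
pose tau (z : env) : env := fun i => if i is j.+1 then (if (j < n)%N then z j else z j.+1) else z n.
have [|Q' [pQ' Q'E]] := IH (fun z => P (tau z)).
  apply: (polyf_subst (h := tau)) => // -[|i] /=; first exact: polyf_var.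
  by case: (i < n)%N; exact: polyf_var.
(* Read with [z = (s, r, e)]: the slice at [s] is a simplex of size [r - s] with parameters [s] and
   [e]. *)
pose P2 z := Q' (scons (z 1%N - z 0%N) (scons (z 0%N) (fun i => z i.+2))).
have pP2 : polyf P2.
  apply: (polyf_subst (h := fun z => scons (z 1%N - z 0%N) (scons (z 0%N) (fun i => z i.+2)))) => // -[|[|i]] /=; [|exact: polyf_var..].
  under eq_fun do rewrite -mulN1r; apply: polyfD; first exact: polyf_var.
  by apply: polyfM; [exact: polyf_cst|exact: polyf_var].
have [Q [pQ dQ]] := powsum_antiderivative (polyf_powsum pP2).
exists (fun z => Q (scons (z 0%N) z) + -1 * Q (scons 0 z)); split.
  apply: polyfD; last (apply: polyfM; first exact: polyf_cst).
    by apply: (polyf_subst (h := fun z => scons (z 0%N) z)) => // -[|i]; exact: polyf_var.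
  by apply: (polyf_subst (h := scons 0)) => // -[|i] /=; [exact: polyf_cst|exact: polyf_var].
move=> r e r0 /=.
have dr : deriv_on 0 r (fun s => Q (scons s (scons r e))) (fun s => P2 (scons s (scons r e))).
  by apply: is_derive_deriv_on => s _; exact: dQ.
have cr : cont_on 0 r (fun s => P2 (scons s (scons r e))).
  apply: continuous_cont_on; apply: (polyf_continuous (h := fun s => scons s (scons r e))) => // -[|i] s /=; first exact: cvg_id.
  exact: cvg_cst.
rewrite mulN1r -(Rintegral_deriv dr cr); last by rewrite r0 lexx.
apply: eq_Rintegral => s; rewrite inE/= => /andP[s0 sr].
rewrite /P2/= -Q'E ?subr_ge0//; congr refint; apply/funext => l; congr P.
apply/funext => -[|i]; rewrite /splice/tau/=.
  by rewrite ltnn subnn.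
rewrite ltnS subSS; case: ltnP => // ni.
by rewrite ltnNge (leq_trans ni)//= subSn.
Qed.

Definition in_ref (n : nat) (r : R) (l : env) : Prop :=
  (forall i, 0 <= l i) /\ (forall i, (n <= i)%N -> l i = 0) /\ \sum_(i < n) l i <= r.

Lemma in_ref_cons n r s l : 0 <= s -> in_ref n (r - s) l -> in_ref n.+1 r (scons s l).
Proof.
move=> s0 [l0 [lz ls]]; split; first by case.
split; first by case.
by rewrite big_ord_recl /= -lerBrDl.
Qed.

Lemma eq_refint n r g g' : (forall l, in_ref n r l -> g l = g' l) -> 0 <= r ->
  refint n r g = refint n r g'.
Proof.
elim: n r g g' => [|n IH] r g g' gg r0 /=.
  by apply: gg; split => //; split => //; rewrite big_ord0.
apply: eq_Rintegral => s; rewrite inE/= => /andP[s0 sr].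
apply: IH; last by rewrite subr_ge0.
by move=> l Hl; apply: gg; exact: in_ref_cons.
Qed.

Lemma polyf_scons g s : polyf g -> polyf (fun l => g (scons s l)).
Proof.
by move=> pg; apply: (polyf_subst (h := scons s)) => // -[|i] /=; [exact: polyf_cst|exact: polyf_var].
Qed.

(** The slice integral agrees on [[0, r]] with a polynomial in [s]. This continuity provides the
    integrability behind additivity, homogeneity and monotonicity of [refint]. *)
Lemma refint_slice_cont n r g : polyf g ->
  cont_on 0 r (fun s => refint n (r - s) (fun l => g (scons s l))).
Proof.
move=> pg.
pose tau (z : env) : env := fun i => if i is j.+1 then (if (j < n)%N then z j else 0) else z n.
have [|Q [pQ QE]] := @refint_polyf n (fun z => g (tau z)).
  apply: (polyf_subst (h := tau)) => // -[|i] /=; first exact: polyf_var.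
  by case: (i < n)%N; [exact: polyf_var|exact: polyf_cst].
apply: (@eq_cont_on _ _ _ (fun s => Q (scons (r - s) (scons s (fun=> 0))))).
  move=> s /andP[s0 sr]; rewrite -QE ?subr_ge0//.
  apply: eq_refint; rewrite ?subr_ge0// => l [l0 [lz ls]]; congr g.
  apply/funext => -[|i]; rewrite /tau/splice/=; first by rewrite ltnn subnn.
  by case: ltnP => // /lz ->.
apply: continuous_cont_on; apply: (polyf_continuous (h := fun s => scons (r - s) (scons s (fun=> 0)))) => // -[|[|i]] s /=.
- by apply: cvgB; [exact: cvg_cst|exact: cvg_id].
- exact: cvg_id.
- exact: cvg_cst.
Qed.

Let slice_int n r g (pg : polyf g) := cont_on_integrable (@refint_slice_cont n r g pg).

Let meas_cc (r : R) : measurable [set s : R | 0 <= s <= r].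
Proof. by rewrite set_cc. Qed.

Lemma refintD n r g g' : polyf g -> polyf g' -> 0 <= r ->
  refint n r (fun l => g l + g' l) = refint n r g + refint n r g'.
Proof.
elim: n r g g' => [|n IH] r g g' pg pg' r0 //=.
rewrite -RintegralD; [|exact: meas_cc|exact: (slice_int n r pg)|exact: (slice_int n r pg')].
apply: eq_Rintegral => s; rewrite inE/= => /andP[s0 sr].
by rewrite (IH (r - s) (fun l => g (scons s l)) (fun l => g' (scons s l))) ?subr_ge0//; exact: polyf_scons.
Qed.

Lemma refintZ n r g (c : R) : polyf g -> 0 <= r ->
  refint n r (fun l => c * g l) = c * refint n r g.
Proof.
elim: n r g => [|n IH] r g pg r0 //=.
rewrite -RintegralZl; [|exact: meas_cc|exact: (slice_int n r pg)].
apply: eq_Rintegral => s; rewrite inE/= => /andP[s0 sr].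
by rewrite (IH (r - s) (fun l => g (scons s l))) ?subr_ge0//; exact: polyf_scons.
Qed.

Lemma refint_le n r g g' : polyf g -> polyf g' -> 0 <= r ->
  (forall l, in_ref n r l -> g l <= g' l) -> refint n r g <= refint n r g'.
Proof.
elim: n r g g' => [|n IH] r g g' pg pg' r0 gg /=.
  by apply: gg; split => //; split => //; rewrite big_ord0.
apply: le_Rintegral; [exact: meas_cc|exact: (slice_int n r pg)|exact: (slice_int n r pg')|] => s /= /andP[s0 sr].
apply: IH; rewrite ?subr_ge0//; [exact: polyf_scons..|] => l Hl.
by apply: gg; exact: in_ref_cons.
Qed.

Lemma refint0 n r : 0 <= r -> refint n r (fun=> 0 : R) = 0.
Proof.
move=> r0; rewrite -[RHS](mul0r (refint n r (fun=> 0))) -refintZ//; last exact: polyf_cst.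
by apply: eq_refint => // l _; rewrite mul0r.
Qed.

Lemma refint_ge0 n r g : polyf g -> 0 <= r -> (forall l, in_ref n r l -> 0 <= g l) ->
  0 <= refint n r g.
Proof.
move=> pg r0 g0; rewrite -(refint0 n r0); apply: refint_le => //; exact: polyf_cst.
Qed.

(** The slice integral [h] is continuous and nonnegative. Its primitive is monotone and vanishes at
    both ends, hence is zero, and so is its derivative [h] inside; induction then applies to the
    slice. *)
Lemma refint_eq0 n r g : polyf g -> 0 < r -> (forall l, in_ref n r l -> 0 <= g l) ->
  refint n r g = 0 ->
  forall l, (forall i, (i < n)%N -> 0 < l i) -> (forall i, (n <= i)%N -> l i = 0) ->
    \sum_(i < n) l i < r -> g l = 0.
Proof.
elim: n r g => [|n IH] r g pg r0 g0 /=.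
  by move=> gE l _ lz _; rewrite -gE; congr g; apply/funext => i; exact: lz.
move=> + l lp lz ls.
pose h s := refint n (r - s) (fun l => g (scons s l)).
have ch : cont_on 0 r h by exact: refint_slice_cont.
have h0 s : 0 <= s <= r -> 0 <= h s.
  move=> /andP[s0 sr]; apply: refint_ge0; rewrite ?subr_ge0//; first exact: polyf_scons.
  by move=> l' Hl'; apply: g0; exact: in_ref_cons.
have [F [F0 dF]] := primitive (ltW r0) (cont_on_clamp (ltW r0) ch).
have {}dF : deriv_on 0 r F h.
  by apply: (eq_deriv_on _ _ dF) => // t tr; rewrite /= clamp_id.
rewrite -/h (Rintegral_deriv dF ch) ?lexx ?ltW// F0 subr0 => Fr.
have Fz t : 0 <= t <= r -> F t = 0.
  move=> /andP[t0 tr].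
  have Fnd := deriv_on_ndecr dF (fun s (H : 0 < s < r) => h0 s ltac:(by case/andP: H => *; rewrite !ltW)).
  by apply/eqP; rewrite eq_le -{1}Fr -{1}F0 !Fnd.
have sl : l 0%N < r /\ \sum_(i < n) l i.+1 < r - l 0%N.
  move: ls; rewrite big_ord_recl /= -ltrBrDl => ls; split=> //.
  rewrite -subr_gt0; apply: le_lt_trans ls; apply: sumr_ge0 => i _.
  by rewrite ltW// lp//= ltnS.
have hz : h (l 0%N) = 0.
  have d0 : deriv_on 0 r (fun=> 0) h by apply: (eq_deriv_on _ _ dF).
  have [] := @deriv_on_is_derive _ _ _ _ _ (l 0%N) d0.
    by rewrite lp//=; case: sl.
  by move=> _ <-; exact: derive_cst.
rewrite (_ : l = scons (l 0%N) (fun i => l i.+1)); last by apply/funext => -[].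
have l00 : 0 < l 0%N by exact: lp.
apply: (IH (r - l 0%N) (fun l' => g (scons (l 0%N) l'))) => //.
- exact: polyf_scons.
- by rewrite subr_gt0; case: sl.
- by move=> l' Hl'; apply: g0; apply: in_ref_cons => //; exact: ltW.
- by move=> i ni; exact: lp.
- by move=> i ni; exact: lz.
- by case: sl.
Qed.

(** Were the integral zero, the constant [1] would vanish at the interior point with all coordinates
    [1 / (n + 1)]. *)
Lemma refint1_gt0 n : 0 < refint n 1 (fun=> 1 : R).
Proof.
rewrite lt_neqAle eq_sym refint_ge0//; last exact: polyf_cst.
rewrite andbT; apply/eqP => H.
have /(_ (fun i => if (i < n)%N then n.+1%:R^-1 else 0)) := refint_eq0 (polyf_cst 1) ltr01 (fun _ _ => ler01) H.
move=> E; suff /eqP : (1 : R) = 0 by rewrite oner_eq0.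
apply: E => [i ->|i|]; first by rewrite invr_gt0.
  by rewrite leqNgt => /negbTE ->.
under eq_bigr do rewrite ltn_ord.
by rewrite sumr_const card_ord -[_ *+ n]mulr_natl ltr_pdivrMr// mul1r ltr_nat.
Qed.

End ReferenceIntegral.

(** * Polynomials of bounded total degree *)

Section Polynomials.
Variable R : realType.

Section Algebra.
Variable d : nat.
Local Notation point := 'rV[R]_d.
Implicit Types (f g : point -> R).

Definition monom (a : 'I_d -> nat) (x : point) : R := \prod_(i < d) x ord0 i ^+ a i.

Lemma is_poly_sum p (I : Type) (r : seq I) (P : pred I) (F : I -> point -> R) :
  (forall i, P i -> is_poly p (F i)) -> is_poly p (fun x => \sum_(i <- r | P i) F i x).
Proof.
move=> pF.
have /choice[c cP] : forall i, exists c : {ffun 'I_d -> 'I_p.+1} -> R, P i -> forall x,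
    F i x = \sum_(a : {ffun 'I_d -> 'I_p.+1} | (\sum_(i < d) (a i : nat) <= p)%N)
      c a * \prod_(i < d) x ord0 i ^+ a i.
  by move=> i; case: (boolP (P i)) => [/pF [c cE]|nP]; [exists c|exists (fun=> 0)].
exists (fun a => \sum_(i <- r | P i) c i a) => x.
under eq_bigr => i Pi do rewrite cP//.
rewrite exchange_big; apply: eq_bigr => a _.
by rewrite mulr_suml.
Qed.

Lemma is_polyZ p (k : R) f : is_poly p f -> is_poly p (fun x => k * f x).
Proof.
move=> [c cE]; exists (fun a => k * c a) => x; rewrite cE mulr_sumr.
by apply: eq_bigr => a _; rewrite mulrA.
Qed.

Lemma is_polyD p f g : is_poly p f -> is_poly p g -> is_poly p (fun x => f x + g x).
Proof.
move=> [c cE] [c' c'E]; exists (fun a => c a + c' a) => x.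
by rewrite cE c'E -big_split; apply: eq_bigr => a _; rewrite mulrDl.
Qed.

Lemma is_polyB p f g : is_poly p f -> is_poly p g -> is_poly p (fun x => f x - g x).
Proof.
move=> pf pg; under eq_fun do rewrite -mulN1r.
by apply: is_polyD => //; exact: is_polyZ.
Qed.

Lemma is_poly_monom p (a : 'I_d -> nat) : (\sum_i a i <= p)%N -> is_poly p (monom a).
Proof.
move=> ap.
have aip i : (a i < p.+1)%N by rewrite ltnS (leq_trans _ ap)// (bigD1 i)//= leq_addr.
pose b : {ffun 'I_d -> 'I_p.+1} := [ffun i => inord (a i)].
have bE i : b i = a i :> nat by rewrite ffunE inordK.
exists (fun a' => (a' == b)%:R) => x.
rewrite (bigD1 b)/=; last by under eq_bigr do rewrite bE.
rewrite eqxx mul1r [X in _ + X]big1 ?addr0; last first.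
  by move=> a' /andP[_ /negbTE ->]; rewrite mul0r.
by rewrite /monom; apply: eq_bigr => i _; rewrite bE.
Qed.

Lemma is_polyE p f : is_poly p f -> exists c : {ffun 'I_d -> 'I_p.+1} -> R,
  f = fun x => \sum_(a : {ffun 'I_d -> 'I_p.+1} | (\sum_i a i <= p)%N) c a * monom (fun i => a i) x.
Proof. by move=> [c cE]; exists c; apply/funext. Qed.

Lemma is_poly_cst p (k : R) : is_poly p (fun _ : point => k).
Proof.
have : is_poly p (monom (fun=> 0%N)) by apply: is_poly_monom; rewrite big1.
move/(is_polyZ k); under eq_fun do rewrite /monom big1//.
by under eq_fun do rewrite mulr1.
Qed.

Lemma is_poly_coord p (i : 'I_d) : (0 < p)%N -> is_poly p (fun x : point => x ord0 i).
Proof.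
move=> p0; have -> : (fun x : point => x ord0 i) = monom (fun j => (j == i)).
  apply/funext => x; rewrite /monom (bigD1 i)//= eqxx expr1 big1 ?mulr1//.
  by move=> j /negbTE ->.
apply: is_poly_monom; rewrite (bigD1 i)//= eqxx big1 ?addn0//.
by move=> j /negbTE ->.
Qed.

Lemma is_poly_leq p q f : (p <= q)%N -> is_poly p f -> is_poly q f.
Proof.
move=> pq /is_polyE[c ->]; apply: is_poly_sum => a ap; apply: is_polyZ.
by apply: is_poly_monom; exact: leq_trans pq.
Qed.

Lemma is_polyM p q f g : is_poly p f -> is_poly q g -> is_poly (p + q) (fun x => f x * g x).
Proof.
move=> /is_polyE[c ->] /is_polyE[c' ->].
under eq_fun do rewrite mulr_suml.
apply: is_poly_sum => a ap; under eq_fun do rewrite mulr_sumr.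
apply: is_poly_sum => b bq; under eq_fun do rewrite mulrACA.
apply: is_polyZ; rewrite (_ : (fun x => _) = monom (fun i => a i + b i)%N).
  by apply: is_poly_monom; rewrite big_split leq_add.
by apply/funext => x; rewrite /monom -big_split; apply: eq_bigr => i _; rewrite exprD.
Qed.

Lemma is_polyX p n f : is_poly p f -> is_poly (n * p) (fun x => f x ^+ n).
Proof.
move=> pf; elim: n => [|n IH]; first exact: is_poly_cst.
by rewrite mulSn; under eq_fun do rewrite exprS; exact: is_polyM.
Qed.

Lemma is_poly_prod (I : Type) (r : seq I) (P : pred I) (k : I -> nat) (F : I -> point -> R) :
  (forall i, P i -> is_poly (k i) (F i)) ->
  is_poly (\sum_(i <- r | P i) k i) (fun x => \prod_(i <- r | P i) F i x).
Proof.
move=> pF; elim: r => [|i r IH].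
  rewrite big_nil (_ : (fun x => _) = fun=> 1); first exact: is_poly_cst.
  by apply/funext => x; rewrite big_nil.
rewrite big_cons; case: ifPn => Pi.
  rewrite (_ : (fun x : point => _) = fun x => F i x * \prod_(i <- r | P i) F i x).
    by apply: is_polyM => //; exact: pF.
  by apply/funext => x; rewrite big_cons Pi.
rewrite (_ : (fun x : point => _) = fun x => \prod_(i <- r | P i) F i x)//.
by apply/funext => x; rewrite big_cons (negbTE Pi).
Qed.

Lemma is_poly_polyf p f (h : (nat -> R) -> point) : is_poly p f ->
  (forall i, polyf (fun e => h e ord0 i)) -> polyf (fun e => f (h e)).
Proof.
move=> /is_polyE[c ->] ph; apply: polyf_sum => a.
apply: polyfM; first exact: polyf_cst.
by apply: polyf_prod => i; exact: polyfX.
Qed.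

Lemma is_poly_line_derive p f : is_poly p f -> forall i : 'I_d, exists2 g, is_poly p g &
  forall x, is_derive (0 : R) 1 (fun t : R => f (x + t *: (delta_mx ord0 i : point))) (g x).
Proof.
move=> /is_polyE[c ->] i.
(* Truncated subtraction is harmless: when [a i = 0] the factor [(a i)%:R] is zero. *)
exists (fun x => \sum_(a : {ffun 'I_d -> 'I_p.+1} | (\sum_i a i <= p)%N)
   c a * ((a i)%:R * monom (fun j => a j - (j == i))%N x)).
  apply: is_poly_sum => a ap; apply: is_polyZ; apply: is_polyZ; apply: is_poly_monom.
  by apply: leq_trans ap; apply: leq_sum => j _; exact: leq_subr.
move=> x.
have dm (a : {ffun 'I_d -> 'I_p.+1}) : is_derive (0 : R) 1
    (fun t : R => monom (fun i => a i) (x + t *: (delta_mx ord0 i : point)))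
    ((a i)%:R * monom (fun j => a j - (j == i))%N x).
  pose K := \prod_(j < d | j != i) x ord0 j ^+ a j.
  have -> : (fun t : R => monom (fun i => a i) (x + t *: (delta_mx ord0 i : point))) =
      (K \*: ((id + cst (x ord0 i)) ^+ a i)).
    apply/funext => t; rewrite /monom (bigD1 i)//= !mxE !eqxx mulr1 [RHS]mulrC.
    rewrite exprfctE [x ord0 i + t]addrC; congr (_ * _).
    apply: eq_bigr => j /negbTE ji; by rewrite !mxE ji andbF mulr0 addr0.
  have -> : (a i)%:R * monom (fun j => a j - (j == i))%N x =
      K *: (((a i)%:R * (id + cst (x ord0 i)) (0 : R) ^+ (a i).-1) *: (1 + 0)).
    rewrite /monom (bigD1 i)//= eqxx subn1 [RHS]mulrC /GRing.scale/= addr0 mulr1 -mulrA.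
    rewrite [_ 0]add0r; congr (_ * (_ * _)).
    by apply: eq_bigr => j /negbTE ->; rewrite subn0.
  by apply: is_deriveZ; apply: is_deriveX; apply: is_deriveD.
rewrite (_ : (fun t => _) = \sum_(a : {ffun 'I_d -> 'I_p.+1} | (\sum_i a i <= p)%N)
    (c a \*: (fun t : R => monom (fun i => a i) (x + t *: (delta_mx ord0 i : point))))).
  rewrite big_mkcond [X in is_derive _ _ _ X]big_mkcond/=.
  rewrite -!/(index_enum _); elim: (index_enum _) => [|a s IH].
    by rewrite !big_nil; exact: is_derive_cst.
  rewrite !big_cons; apply: is_deriveD; case: ifP => _; last exact: is_derive_cst.
  exact: is_deriveZ.
by apply/funext => t; rewrite fct_sumE.
Qed.

Lemma is_poly_gradP p f i x : is_poly p f ->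
  is_derive (0 : R) 1 (fun t : R => f (x + t *: (delta_mx ord0 i : point))) (grad f x ord0 i).
Proof.
move=> /is_poly_line_derive/(_ i)[g _ /(_ x) dg].
by rewrite mxE derive1E; have [d1 d2] := dg; rewrite d2.
Qed.

Lemma gradE p f i x k : is_poly p f ->
  is_derive (0 : R) 1 (fun t : R => f (x + t *: (delta_mx ord0 i : point))) k ->
  grad f x ord0 i = k.
Proof. by move=> pf [d1 d2]; rewrite mxE derive1E. Qed.

Lemma is_poly_grad p f i : is_poly p f -> is_poly p (fun x => grad f x ord0 i).
Proof.
move=> pf; have [g pg dg] := is_poly_line_derive pf i.
rewrite (_ : (fun x => _) = g)//; apply/funext => x.
exact: (gradE pf (dg x)).
Qed.

Lemma gradD p f g x : is_poly p f -> is_poly p g ->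
  grad (fun y => f y + g y) x = grad f x + grad g x.
Proof.
move=> pf pg; apply/rowP => i; rewrite [RHS]mxE; apply: (gradE (is_polyD pf pg)).
by apply: is_deriveD; [exact: is_poly_gradP pf|exact: is_poly_gradP pg].
Qed.

Lemma gradZ p f (k : R) x : is_poly p f -> grad (fun y => k * f y) x = k *: grad f x.
Proof.
move=> pf; apply/rowP => i; rewrite [RHS]mxE; apply: (gradE (is_polyZ k pf)).
by apply: is_deriveZ; exact: is_poly_gradP pf.
Qed.

End Algebra.

Lemma is_poly_comp n d p (f : 'rV[R]_d -> R) (h : 'rV[R]_n -> 'rV[R]_d) : is_poly p f ->
  (forall i, is_poly 1 (fun y => h y ord0 i)) -> is_poly p (fun y => f (h y)).
Proof.
move=> /is_polyE[c ->] ph; apply: is_poly_sum => a ap; apply: is_polyZ.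
apply: (is_poly_leq ap); apply: is_poly_prod => i _.
by rewrite -[X in is_poly X]muln1; exact: is_polyX.
Qed.

(** * Interpolation on an integer grid *)

Section Interpolation.
Variables d p : nat.
Local Notation point := 'rV[R]_d.
Local Notation grid := {ffun 'I_d -> 'I_p.+1}.

Definition gridpt (x : grid) : point := \row_i (x i)%:R.

Let V : 'M[R]_p.+1 := Vandermonde p.+1 (\row_(j < p.+1) (j : nat)%:R).
Let W := invmx V.

Let V_unit : V \in unitmx.
Proof.
rewrite unitmxE det_Vandermonde unitfE.
apply/prodf_neq0 => i _; apply/prodf_neq0 => j ij.
rewrite !mxE subr_eq0 eqr_nat; apply/eqP => ji.
by move: ij; rewrite ji ltnn.
Qed.

Let VW (b a : 'I_p.+1) : \sum_(j < p.+1) (j : nat)%:R ^+ b * W j a = (b == a)%:R.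
Proof.
have := mulmxV V_unit => /matrixP/(_ b a); rewrite !mxE => <-.
by apply: eq_bigr => j _; rewrite !mxE.
Qed.

(* Tensor-product Lagrange basis on the grid {0..p}^d: inverts the Vandermonde matrix in each variable. *)
Definition lagw (x a : grid) : R := \prod_i W (x i) (a i).
Definition tlagrange (x : grid) (y : point) : R := \sum_(a : grid) lagw x a * monom (fun i => a i) y.

Lemma lagw_dual (a b : grid) : \sum_x monom (fun i => b i) (gridpt x) * lagw x a = (b == a)%:R.
Proof.
transitivity (\sum_(x : grid) \prod_i ((x i)%:R ^+ b i * W (x i) (a i))).
  apply: eq_bigr => x _; rewrite big_split/=; congr (_ * _).
  by apply: eq_bigr => i _; rewrite mxE.
rewrite -(bigA_distr_bigA (fun i (j : 'I_p.+1) => (j : nat)%:R ^+ b i * W j (a i))).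
under eq_bigr do rewrite VW.
have [->|ba] := eqVneq b a; first by rewrite big1// => i _; rewrite eqxx.
have [i bai] : exists i, b i != a i.
  by apply/existsP; rewrite -negb_forall; apply: contra ba => /forallP H; apply/eqP/ffunP => i; apply/eqP.
by rewrite (bigD1 i)//= (negbTE bai) mul0r.
Qed.

(** The grid values determine the coefficients, and give [0] for multi-indices of too large total
    degree. Both the interpolation formula and the uniqueness of coefficients follow. *)
Lemma coef_interp (c : grid -> R) (f : point -> R) :
  (forall x, f x = \sum_(a : grid | (\sum_i a i <= p)%N) c a * monom (fun i => a i) x) ->
  forall a, \sum_x f (gridpt x) * lagw x a = if (\sum_i a i <= p)%N then c a else 0.
Proof.
move=> /funext -> a; under [LHS]eq_bigr do rewrite mulr_suml.
rewrite exchange_big/=; under [LHS]eq_bigr => b _.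
  under eq_bigr do rewrite -mulrA.
  rewrite -mulr_sumr lagw_dual; over.
case: ifPn => ap.
  rewrite (bigD1 a)//= eqxx mulr1 big1 ?addr0// => b /andP[_ /negbTE ->].
  by rewrite mulr0.
rewrite big1// => b bp; case: eqVneq => [ba|]; last by rewrite mulr0.
by move: bp; rewrite ba (negbTE ap).
Qed.

Lemma interp (f : point -> R) y : is_poly p f -> f y = \sum_x f (gridpt x) * tlagrange x y.
Proof.
move=> [c cE]; rewrite /tlagrange; under eq_bigr do rewrite mulr_sumr.
rewrite exchange_big/= cE big_mkcond/=; apply: eq_bigr => a _.
under [RHS]eq_bigr do rewrite mulrA.
by rewrite -mulr_suml (coef_interp cE); case: ifP; rewrite ?mul0r.
Qed.

Lemma is_poly_tlagrange x : is_poly (d * p) (tlagrange x).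
Proof.
apply: is_poly_sum => a _; apply: is_polyZ; apply: is_poly_monom.
apply: (@leq_trans (\sum_(i < d) p)%N); last by rewrite sum_nat_const card_ord.
by apply: leq_sum => i _; rewrite -ltnS.
Qed.

End Interpolation.

Lemma is_poly0_coef d p (c : {ffun 'I_d -> 'I_p.+1} -> R) :
  (forall x : 'rV[R]_d, \sum_(a : {ffun 'I_d -> 'I_p.+1} | (\sum_i a i <= p)%N)
    c a * monom (fun i => a i) x = 0) ->
  forall a : {ffun 'I_d -> 'I_p.+1}, (\sum_i a i <= p)%N -> c a = 0.
Proof.
move=> c0 a ap; have := @coef_interp d p c (fun=> 0) (fun x => esym (c0 x)) a.
by rewrite ap => <-; rewrite big1// => x _; rewrite mul0r.
Qed.

(** A dilation and translation carries the whole grid into the open reference simplex; the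
    transported polynomial vanishes on the grid, hence everywhere. *)
Lemma is_poly0_ref d p (f : 'rV[R]_d -> R) : is_poly p f ->
  (forall l : nat -> R, (forall i, (i < d)%N -> 0 < l i) -> (forall i, (d <= i)%N -> l i = 0) ->
    \sum_(i < d) l i < 1 -> f (\row_i l i) = 0) ->
  forall x, f x = 0.
Proof.
move=> pf f0.
(* Images of grid points have coordinates between [e] and [e * p.+1], so their sum is at most
   [e * (d * p.+1) < 1]. *)
pose e : R := (d * p.+1).+1%:R^-1.
have e0 : 0 < e by rewrite invr_gt0.
have en : e != 0 by rewrite gt_eqF.
pose h (y : 'rV[R]_d) : 'rV[R]_d := \row_i (e * (y ord0 i + 1)).
have ph : is_poly p (fun y => f (h y)).
  apply: is_poly_comp => // i; under eq_fun do rewrite mxE.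
  by apply: is_polyZ; apply: is_polyD; [exact: is_poly_coord|exact: is_poly_cst].
have h0 y : f (h y) = 0.
  rewrite (interp _ ph) big1// => x _.
  pose l (i : nat) : R := if insub i is Some j then e * ((x j)%:R + 1) else 0.
  have lE (j : 'I_d) : l j = e * ((x j)%:R + 1) by rewrite /l valK.
  have -> : h (gridpt x) = \row_i l i by apply/rowP => i; rewrite !mxE lE.
  rewrite f0 ?mul0r//.
  - by move=> i id; rewrite (lE (Ordinal id)) mulr_gt0// ltr_wpDl.
  - by move=> i di; rewrite /l insubF// ltnNge di.
  - apply: (@le_lt_trans _ _ (\sum_(i < d) e * p.+1%:R)).
      apply: ler_sum => i _; rewrite lE ler_pM2l// -natr1 lerD2r ler_nat.
      by rewrite -ltnS.
    rewrite sumr_const card_ord -[_ *+ d]mulr_natr -mulrA -natrM /e mulrC.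
    by rewrite ltr_pdivrMr// mul1r ltr_nat ltnS mulnC.
move=> x; have := h0 (\row_i (x ord0 i / e - 1)); congr (f _ = 0).
by apply/rowP => i; rewrite !mxE subrK mulrC divfK.
Qed.

End Polynomials.

Section DefiniteForms.
Variable R : fieldType.

Lemma definite_unitmx N (G : 'M[R]_N) :
  (forall u : 'rV[R]_N, u *m G *m u^T = 0 -> u = 0) -> G \in unitmx.
Proof.
move=> G0; rewrite -row_free_unit; apply: inj_row_free => v vG.
by apply: G0; rewrite vG mul0mx.
Qed.

End DefiniteForms.

(** * Linearity, monotonicity and definiteness of the integral over a simplex *)

Section SimplexIntegral.
Variables (R : realType) (d : nat).
Local Notation point := 'rV[R]_d.
Implicit Types (f g : point -> R) (v : nat -> point).

(** The degree is forgotten wherever a polynomial integrand only has to make the integrals linear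
    and monotone. *)
Definition is_pol f := exists p, is_poly p f.

Lemma is_pol_poly p f : is_poly p f -> is_pol f. Proof. by exists p. Qed.

Lemma is_polD f g : is_pol f -> is_pol g -> is_pol (fun x => f x + g x).
Proof.
move=> [p pf] [q pg]; exists (maxn p q); apply: is_polyD.
  by apply: is_poly_leq pf; exact: leq_maxl.
by apply: is_poly_leq pg; exact: leq_maxr.
Qed.

Lemma is_polM f g : is_pol f -> is_pol g -> is_pol (fun x => f x * g x).
Proof. by move=> [p pf] [q pg]; exists (p + q)%N; exact: is_polyM. Qed.

Lemma is_pol_cst (k : R) : is_pol (fun _ : point => k).
Proof. by exists 0%N; exact: is_poly_cst. Qed.

Lemma is_polZ (k : R) f : is_pol f -> is_pol (fun x => k * f x).
Proof. by move=> [p pf]; exists p; exact: is_polyZ. Qed.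

Lemma is_polB f g : is_pol f -> is_pol g -> is_pol (fun x => f x - g x).
Proof.
by move=> pf pg; under eq_fun do rewrite -mulN1r; apply: is_polD => //; exact: is_polZ.
Qed.

Lemma is_pol_sum (I : Type) (r : seq I) (P : pred I) (F : I -> point -> R) :
  (forall i, P i -> is_pol (F i)) -> is_pol (fun x => \sum_(i <- r | P i) F i x).
Proof.
move=> pF; elim: r => [|i r IH].
  by rewrite (_ : (fun x => _) = fun=> 0); [exact: is_pol_cst|apply/funext => x; rewrite big_nil].
case: (boolP (P i)) => Pi.
  rewrite (_ : (fun x : point => _) = fun x => F i x + \sum_(i <- r | P i) F i x).
    by apply: is_polD => //; exact: pF.
  by apply/funext => x; rewrite big_cons Pi.
rewrite (_ : (fun x : point => _) = fun x => \sum_(i <- r | P i) F i x)//.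
by apply/funext => x; rewrite big_cons (negbTE Pi).
Qed.

Lemma sparam_polyf k v f : is_pol f -> polyf (fun l => f (sparam k v l)).
Proof.
move=> [p pf]; apply: is_poly_polyf pf _ => i.
rewrite (_ : (fun e => _) = fun e : nat -> R => v 0%N ord0 i + \sum_(j < k) e j * (v j.+1 - v 0%N) ord0 i).
  apply: polyfD; first exact: polyf_cst.
  by apply: polyf_sum => j; apply: polyfM; [exact: polyf_var|exact: polyf_cst].
by apply/funext => e; rewrite /sparam mxE summxE; under eq_bigr do rewrite mxE.
Qed.

Lemma sparam_csimplex k v l : in_ref k 1 l -> csimplex k v (sparam k v l).
Proof.
move=> [l0 [lz ls]].
exists (fun i => if i is j.+1 then l j else 1 - \sum_(i < k) l i); split.
  by case=> [|i] _ //; rewrite subr_ge0.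
split; first by rewrite big_ord_recl/= subrK.
rewrite big_ord_recl/= scalerBl scale1r -addrA; congr (_ + _).
rewrite addrC scaler_suml -sumrB; apply: eq_bigr => i _.
by rewrite scalerBr.
Qed.

Lemma csimplex_sparam k v x : csimplex k v x -> exists2 l, in_ref k 1 l & x = sparam k v l.
Proof.
move=> [l [l0 [ls ->]]].
exists (fun i => if (i < k)%N then l i.+1 else 0).
  split; first by move=> i; case: ltnP => // ik; exact: l0.
  split; first by move=> i; rewrite leqNgt => /negbTE ->.
  under eq_bigr do rewrite ltn_ord.
  by rewrite -ls big_ord_recl lerDr l0.
rewrite /sparam big_ord_recl/=; under [in RHS]eq_bigr do rewrite ltn_ord scalerBr.
rewrite sumrB -scaler_suml.
have -> : l 0%N = 1 - \sum_(i < k) l i.+1 by rewrite -ls big_ord_recl addrK.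
by rewrite scalerBl scale1r -addrA [- _ + _]addrC.
Qed.

Lemma sintD k v f g : is_pol f -> is_pol g ->
  sint k v (fun x => f x + g x) = sint k v f + sint k v g.
Proof.
by move=> pf pg; rewrite /sint refintD//; [rewrite mulrDr|exact: sparam_polyf..].
Qed.

Lemma sintZ k v (c : R) f : is_pol f -> sint k v (fun x => c * f x) = c * sint k v f.
Proof. by move=> pf; rewrite /sint refintZ//; [rewrite mulrCA|exact: sparam_polyf]. Qed.

Lemma sint_le k v f g : is_pol f -> is_pol g ->
  (forall x, csimplex k v x -> f x <= g x) -> sint k v f <= sint k v g.
Proof.
move=> pf pg fg; rewrite /sint ler_wpM2l ?sqrtr_ge0//.
apply: refint_le => //; [exact: sparam_polyf..|] => l Hl.
by apply: fg; exact: sparam_csimplex.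
Qed.

Lemma sint0 k v : sint k v (fun=> 0) = 0.
Proof. by rewrite /sint refint0// mulr0. Qed.

Lemma sint_ge0 k v f : is_pol f -> (forall x, csimplex k v x -> 0 <= f x) -> 0 <= sint k v f.
Proof.
by move=> pf f0; rewrite -(sint0 k v); apply: sint_le => //; exact: is_pol_cst.
Qed.

Lemma sint_sum k v (I : Type) (r : seq I) (P : pred I) (F : I -> point -> R) :
  (forall i, P i -> is_pol (F i)) ->
  sint k v (fun x => \sum_(i <- r | P i) F i x) = \sum_(i <- r | P i) sint k v (F i).
Proof.
move=> pF; elim: r => [|i r IH].
  by rewrite big_nil (_ : (fun x => _) = fun=> 0) ?sint0//; apply/funext => x; rewrite big_nil.
rewrite big_cons; case: ifPn => Pi.
  rewrite (_ : (fun x : point => _) = fun x => F i x + \sum_(i <- r | P i) F i x).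
    by rewrite sintD ?IH//; [exact: pF|exact: is_pol_sum].
  by apply/funext => x; rewrite big_cons Pi.
rewrite -IH (_ : (fun x : point => _) = fun x => \sum_(i <- r | P i) F i x)//.
by apply/funext => x; rewrite big_cons (negbTE Pi).
Qed.

Lemma smeasE k v : smeas k v = Num.sqrt (\det (gram k v)) * refint k 1 (fun=> 1).
Proof. by []. Qed.

Definition edges v : 'M[R]_d := \matrix_(i < d) (v i.+1 - v 0%N).

Lemma gram_edges v : gram d v = edges v *m (edges v)^T.
Proof.
apply/matrixP => i j; rewrite !mxE; apply: eq_bigr => k _.
by rewrite !mxE.
Qed.

(** The Gram determinant is the square of the determinant of [edges v], and a zero determinant would
    make the measure vanish. *)
Lemma edges_unit v : 0 < smeas d v -> edges v \in unitmx.
Proof.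
rewrite smeasE gram_edges det_mulmx det_tr unitmxE unitfE => v0.
by apply/eqP => E; move: v0; rewrite E mul0r sqrtr0 mul0r ltxx.
Qed.

Lemma sparam_edges v l : sparam d v l = v 0%N + (\row_i l i) *m edges v.
Proof.
rewrite /sparam mulmx_sum_row; congr (_ + _); apply: eq_bigr => i _.
by rewrite mxE rowK.
Qed.

Lemma is_poly_edges p v f : is_poly p f -> is_poly p (fun y => f (v 0%N + y *m edges v)).
Proof.
move=> pf; apply: is_poly_comp => // i.
rewrite (_ : (fun y => _) = fun y : point => v 0%N ord0 i + \sum_(j < d) edges v j i * y ord0 j).
  apply: is_polyD; first exact: is_poly_cst.
  by apply: is_poly_sum => j _; apply: is_polyZ; exact: is_poly_coord.
by apply/funext => y; rewrite !mxE; congr (_ + _); apply: eq_bigr => j _; rewrite mulrC.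
Qed.

(** Pulled back to the reference simplex, [f] vanishes in its interior and hence identically;
    nondegenerate edges turn this into vanishing on the whole space. *)
Lemma sint_definite p v f : 0 < smeas d v -> is_poly p f ->
  sint d v (fun x => f x * f x) = 0 -> forall x, f x = 0.
Proof.
move=> v0 pf H x.
have s0 : Num.sqrt (\det (gram d v)) != 0.
  by apply/eqP => E; move: v0; rewrite smeasE E mul0r ltxx.
have pp := is_pol_poly pf.
move: H; rewrite /sint => /eqP; rewrite mulf_eq0 (negbTE s0)/= => /eqP H.
have f0 := is_poly0_ref (is_poly_edges v pf).
have -> : x = v 0%N + ((x - v 0%N) *m invmx (edges v)) *m edges v.
  by rewrite mulmxKV ?edges_unit// addrC subrK.
apply: f0 => l l0 lz ls.
have := refint_eq0 (sparam_polyf d v (is_polM pp pp)) ltr01 _ H l0 lz ls.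
rewrite -sparam_edges => h; apply/eqP; rewrite -sqrf_eq0 expr2 h// => l' _.
exact: sqr_ge0.
Qed.

End SimplexIntegral.

(** * Pointwise bounds of polynomials by their mean square *)

Section NormEquivalence.
Variables (R : realType) (d p : nat).
Local Notation point := 'rV[R]_d.
Local Notation rowl l := (\row_(i < d) l (nat_of_ord i) : point).

(** The Gram matrix [G] of the monomials is invertible by definiteness, so evaluation at a point is
    the inner product with a kernel polynomial. Cauchy-Schwarz then gives the bound, and the kernel
    is bounded uniformly over the reference simplex. *)
Lemma refint_point_bound : exists2 C : R, 0 < C & forall f : point -> R, is_poly p f ->
  forall l, in_ref d 1 l -> f (rowl l) ^+ 2 <= C * refint d 1 (fun l => f (rowl l) ^+ 2).
Proof.
pose A : finType := {a : {ffun 'I_d -> 'I_p.+1} | (\sum_i a i <= p)%N}.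
pose N := #|A|.
pose m (i : 'I_N) : point -> R := monom (fun j => val (enum_val i) j : nat).
have pm i : is_poly p (m i) by apply: is_poly_monom; exact: (valP (enum_val i)).
have prow (f : point -> R) q : is_poly q f -> polyf (fun l => f (rowl l)).
  by move=> pf; apply: is_poly_polyf pf _ => i; under eq_fun do rewrite mxE; exact: polyf_var.
have pmm i j : polyf (fun l => m i (rowl l) * m j (rowl l)).
  by apply: polyfM; apply: prow; exact: pm.
pose comb (u : 'rV[R]_N) : point -> R := fun x => \sum_i u ord0 i * m i x.
have pcomb u : is_poly p (comb u) by apply: is_poly_sum => i _; exact: is_polyZ.
pose B (f g : point -> R) := refint d 1 (fun l => f (rowl l) * g (rowl l)).
pose G : 'M[R]_N := \matrix_(i, j) B (m i) (m j).
have polyint_sum (I : finType) (F : I -> (nat -> R) -> R) : (forall i, polyf (F i)) ->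
    refint d 1 (fun l => \sum_i F i l) = \sum_i refint d 1 (F i).
  move=> pF; elim: (index_enum I) => [|i r IH].
    by under eq_fun do rewrite big_nil; rewrite big_nil refint0.
  under eq_fun do rewrite big_cons; rewrite big_cons refintD ?IH//.
  exact: (polyf_sum r xpredT pF).
have BG u w : B (comb u) (comb w) = (u *m G *m w^T) ord0 ord0.
  rewrite /B -mulmxA mxE; under eq_fun do rewrite /comb mulr_suml.
  rewrite polyint_sum; last first.
    move=> i; apply: polyfM; last exact: prow (pcomb w).
    by apply: (prow (fun x => u ord0 i * m i x) p); apply: is_polyZ; exact: pm.
  apply: eq_bigr => i _; under eq_fun do rewrite -mulrA mulr_sumr.
  rewrite refintZ//; last first.
    apply: polyf_sum => j; rewrite (_ : (fun e => _) = fun e => w ord0 j * (m i (rowl e) * m j (rowl e))).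
      by apply: polyfM; [exact: polyf_cst|exact: pmm].
    by apply/funext => e; rewrite mulrCA.
  congr (_ * _); rewrite mxE polyint_sum; last first.
    move=> j; rewrite (_ : (fun e => _) = fun e => w ord0 j * (m i (rowl e) * m j (rowl e))).
      by apply: polyfM; [exact: polyf_cst|exact: pmm].
    by apply/funext => e; rewrite mulrCA.
  apply: eq_bigr => j _; rewrite !mxE mulrC -refintZ//; congr refint.
  by apply/funext => e; rewrite mulrCA.
have sumP (F : {ffun 'I_d -> 'I_p.+1} -> R) :
    \sum_(a : {ffun 'I_d -> 'I_p.+1} | (\sum_i a i <= p)%N) F a = \sum_(i < N) F (val (enum_val i)).
  rewrite (reindex_omap (val : A -> _) insub)/=; last by move=> a ap; rewrite insubT.
  rewrite (eq_bigl xpredT) => [|a]; last by rewrite valK eqxx andbT; exact: (valP a).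
  rewrite (reindex (fun i : 'I_N => enum_val i))//.
  by exists enum_rank => a _; rewrite ?enum_valK ?enum_rankK.
have comb_all f : is_poly p f -> exists u, f = comb u.
  move=> /is_polyE[c ->]; exists (\row_i c (val (enum_val i))); apply/funext => x.
  by rewrite sumP /comb; under [RHS]eq_bigr do rewrite mxE.
have comb0 u : (forall x, comb u x = 0) -> u = 0.
  move=> u0; apply/rowP => i; rewrite mxE.
  pose c (a : {ffun 'I_d -> 'I_p.+1}) := if insub a is Some a' then u ord0 (enum_rank (a' : A)) else 0.
  have := @is_poly0_coef R d p c _ (val (enum_val i)) (valP (enum_val i)).
  rewrite /c valK enum_valK; apply => x; rewrite -[RHS](u0 x) /comb sumP.
  by apply: eq_bigr => j _; rewrite valK enum_valK.
have Gu : G \in unitmx.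
  apply: definite_unitmx => u uG; apply: comb0.
  have Bu : B (comb u) (comb u) = 0 by rewrite BG uG mxE.
  apply: is_poly0_ref (pcomb u) _ => l l0 lz ls.
  have pc := prow _ _ (pcomb u).
  have := refint_eq0 (polyfM pc pc) ltr01 (fun l _ => sqr_ge0 (comb u (rowl l))) Bu l0 lz ls.
  by move=> /eqP; rewrite mulf_eq0 orbb => /eqP.
pose H := invmx G.
(* On the reference simplex every monomial is at most [1] in absolute value, so the inverse Gram
   entries alone bound the kernel on the diagonal; the [1] makes [S] positive. *)
pose S := \sum_i \sum_j `|H i j| + 1.
have S0 : 0 < S.
  by rewrite ltr_wpDl// sumr_ge0// => i _; rewrite sumr_ge0.
exists S => // f /comb_all[u ->] l Hl.
set y := rowl l.
have m1 i : `|m i y| <= 1.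
  rewrite /m /monom normr_prod; apply: prodr_ile1 => j _; rewrite normrX.
  case: Hl => l0 [_ ls].
  rewrite exprn_ge0//= exprn_ile1//= mxE ger0_norm ?l0//.
  by apply: le_trans ls; rewrite (bigD1 j)//= lerDl sumr_ge0.
pose w : 'rV[R]_N := (\row_i m i y) *m H^T.
(* comb w is the reproducing kernel at y *)
have rep v : B (comb v) (comb w) = comb v y.
  rewrite BG trmx_mul trmxK mulmxA mulmxK// mxE.
  by apply: eq_bigr => i _; rewrite !mxE.
have KS : B (comb w) (comb w) <= S.
  rewrite rep /comb; apply: le_trans (ler_norm _) _.
  apply: le_trans (ler_norm_sum _ _ _) _.
  rewrite /S -[X in X <= _]addr0; apply: lerD => //.
  apply: ler_sum => i _; rewrite normrM; apply: le_trans (ler_piMr _ (m1 i)) _ => //.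
  rewrite mxE; apply: le_trans (ler_norm_sum _ _ _) _.
  apply: ler_sum => j _; rewrite !mxE normrM; exact: ler_piMl.
set k := comb u y.
set c := comb u; set cw := comb w.
(* Cauchy-Schwarz by hand: this [t] minimises [Q + 2 * t * k + t ^+ 2 * S], an upper bound of the
   integral of a square. *)
pose t := - (k / S).
have pc := prow _ _ (pcomb u); have pw := prow _ _ (pcomb w).
have : 0 <= refint d 1 (fun l => (c (rowl l) + t * cw (rowl l)) ^+ 2).
  apply: refint_ge0 => // [|l' _]; last exact: sqr_ge0.
  by apply: polyfX; apply: polyfD => //; apply: polyfM => //; exact: polyf_cst.
have -> : refint d 1 (fun l => (c (rowl l) + t * cw (rowl l)) ^+ 2) =
    refint d 1 (fun l => c (rowl l) ^+ 2) + (2 * t * k + t ^+ 2 * B cw cw).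
  rewrite /k -rep /B -/c -/cw.
  rewrite -!refintZ//; [|exact: polyfM..].
  rewrite -!refintD//; [|by do ?[exact: polyfX|apply: polyfD|apply: polyfM|exact: polyf_cst]..].
  by congr refint; apply/funext => e; ring.
set Q := refint _ _ _ => h.
have : 0 <= Q - k ^+ 2 / S.
  apply: le_trans h _; rewrite lerD2l.
  apply: (@le_trans _ _ (2 * t * k + t ^+ 2 * S)).
    by rewrite lerD2l ler_wpM2l// sqr_ge0.
  rewrite le_eqVlt; apply/orP; left; apply/eqP; rewrite /t; field.
  by rewrite gt_eqF.
by rewrite subr_ge0 ler_pdivrMr// mulrC.
Qed.

End NormEquivalence.

Section SimplexBounds.
Variables (R : realType) (d : nat).
Local Notation point := 'rV[R]_d.

(** The affine pullback keeps the degree, and the Jacobian factor is common to the measure and the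
    integral; the constant therefore does not see the shape of the simplex. *)
Lemma sint_point_bound p : exists2 C : R, 0 < C & forall (f : point -> R) v x,
  is_poly p f -> csimplex d v x -> f x ^+ 2 * smeas d v <= C * sint d v (fun y => f y * f y).
Proof.
have [C C0 CP] := refint_point_bound R d p.
exists (C * refint d 1 (fun=> 1)) => [|f v x pf /csimplex_sparam[l Hl ->]].
  by rewrite mulr_gt0// refint1_gt0.
rewrite smeasE /sint.
have := CP _ (is_poly_edges v pf) l Hl; rewrite -sparam_edges.
have -> : refint d 1 (fun l => f (v 0%N + (\row_i l i) *m edges v) ^+ 2) =
    refint d 1 (fun l => f (sparam d v l) * f (sparam d v l)).
  by congr refint; apply/funext => l'; rewrite -sparam_edges expr2.
set Q := refint _ _ _; set s := Num.sqrt _; set rho := refint _ _ _ => h.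
have -> : f (sparam d v l) ^+ 2 * (s * rho) = s * rho * f (sparam d v l) ^+ 2 by rewrite mulrC.
have -> : C * rho * (s * Q) = s * rho * (C * Q) by ring.
by apply: ler_wpM2l => //; rewrite mulr_ge0 ?sqrtr_ge0// ltW// refint1_gt0.
Qed.

Lemma sint_quadrature p k v (f : point -> R) : is_poly p f ->
  sint k v f = \sum_(x : {ffun 'I_d -> 'I_p.+1}) f (gridpt R x) * sint k v (tlagrange x).
Proof.
move=> pf; have pl (x : {ffun 'I_d -> 'I_p.+1}) := is_pol_poly (is_poly_tlagrange R x).
transitivity (sint k v (fun y => \sum_(x : {ffun 'I_d -> 'I_p.+1}) f (gridpt R x) * tlagrange x y)).
  by congr sint; apply/funext => y; rewrite -(interp y pf).
rewrite sint_sum; last by move=> x _; exact: is_polZ.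
by apply: eq_bigr => x _; rewrite sintZ.
Qed.

Lemma grad_quadrature p (f : point -> R) y i : is_poly p f ->
  grad f y ord0 i = \sum_(x : {ffun 'I_d -> 'I_p.+1}) f (gridpt R x) * grad (tlagrange x) y ord0 i.
Proof.
move=> pf; pose c (x : {ffun 'I_d -> 'I_p.+1}) := f (gridpt R x).
have fE : f = fun y => \sum_x c x * tlagrange x y.
  by apply/funext => z; rewrite (interp z pf).
rewrite [in LHS]fE -/(c _); under [RHS]eq_bigr => x _ do rewrite -/(c x).
elim: (index_enum _) => [|x r IH].
  rewrite big_nil (_ : (fun y => _) = fun=> 0); last by apply/funext => z; rewrite big_nil.
  by rewrite mxE derive1_cst.
rewrite big_cons -IH (_ : (fun y : point => _) =
    fun y => c x * tlagrange x y + \sum_(x <- r) c x * tlagrange x y); last first.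
  by apply/funext => z; rewrite big_cons.
have pl (z : {ffun 'I_d -> 'I_p.+1}) := is_poly_tlagrange R z.
rewrite (gradD _ (p := (d * p)%N)) ?(gradZ _ _ (p := (d * p)%N))//.
- by rewrite !mxE.
- exact: is_polyZ.
- by apply: is_poly_sum => z _; exact: is_polyZ.
Qed.

Variable T : R.

Lemma sint_deriv_on p k v (F F' : R -> point -> R) :
  (forall t, 0 <= t <= T -> is_poly p (F t) /\ is_poly p (F' t)) ->
  (forall x, deriv_on 0 T (fun t => F t x) (fun t => F' t x)) ->
  deriv_on 0 T (fun t => sint k v (F t)) (fun t => sint k v (F' t)).
Proof.
move=> pF dF.
have := @deriv_on_sum R 0 T _ (index_enum _) xpredT
  (fun (x : {ffun 'I_d -> 'I_p.+1}) t => sint k v (tlagrange x) * F t (gridpt R x))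
  (fun x t => sint k v (tlagrange x) * F' t (gridpt R x)) (fun x _ => deriv_onZ (dF (gridpt R x))).
apply: eq_deriv_on => t tT; have [pFt pF't] := pF t tT; rewrite (sint_quadrature _ _ (p := p))//.
  by apply: eq_bigr => x _; rewrite mulrC.
by apply: eq_bigr => x _; rewrite mulrC.
Qed.

Lemma sint_cont_on p k v (F : R -> point -> R) :
  (forall t, 0 <= t <= T -> is_poly p (F t)) ->
  (forall x, cont_on 0 T (fun t => F t x)) -> cont_on 0 T (fun t => sint k v (F t)).
Proof.
move=> pF cF.
apply: (@eq_cont_on _ _ _ (fun t => \sum_(x : {ffun 'I_d -> 'I_p.+1}) F t (gridpt R x) * sint k v (tlagrange x))).
  by move=> t tT; rewrite -sint_quadrature//; exact: pF.
by apply: cont_on_sum => x _; apply: cont_onM => //; exact: cont_on_cst.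
Qed.

Lemma grad_deriv_on p i (F F' : R -> point -> R) y :
  (forall t, 0 <= t <= T -> is_poly p (F t) /\ is_poly p (F' t)) ->
  (forall x, deriv_on 0 T (fun t => F t x) (fun t => F' t x)) ->
  deriv_on 0 T (fun t => grad (F t) y ord0 i) (fun t => grad (F' t) y ord0 i).
Proof.
move=> pF dF.
have := @deriv_on_sum R 0 T _ (index_enum _) xpredT
  (fun (x : {ffun 'I_d -> 'I_p.+1}) t => grad (tlagrange x) y ord0 i * F t (gridpt R x))
  (fun x t => grad (tlagrange x) y ord0 i * F' t (gridpt R x)) (fun x _ => deriv_onZ (dF (gridpt R x))).
apply: eq_deriv_on => t tT; have [pFt pF't] := pF t tT; rewrite (grad_quadrature _ _ (p := p))//.
  by apply: eq_bigr => x _; rewrite mulrC.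
by apply: eq_bigr => x _; rewrite mulrC.
Qed.

End SimplexBounds.

(** * Packing of intervals and triangles *)

Section Packing.
Variable R : realType.

Lemma itv_length (b0 b1 : bool) (a b : R) : a <= b ->
  lebesgue_measure [set` Interval (BSide b0 a) (BSide b1 b)] = (b - a)%:E.
Proof.
rewrite lebesgue_measure_itv/= lte_fin le_eqVlt => /predU1P[->|->] //.
by rewrite ltxx subrr.
Qed.

(** The left side is the integral over [[A, B]] of the total weight of the intervals containing [y],
    and that weight is at most [W]. *)
Lemma weighted_packing (I : finType) (P : pred I) (lo hi w : I -> R) (A B W : R) :
  A <= B ->
  (forall i, P i -> [/\ 0 <= w i, A <= lo i, lo i <= hi i & hi i <= B]) ->
  (forall y, \sum_(i | P i && (lo i < y < hi i)) w i <= W) ->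
  \sum_(i | P i) w i * (hi i - lo i) <= W * (B - A).
Proof.
move=> AB Pi cover.
pose mu := @lebesgue_measure R.
pose D : set (measurableTypeR R) := `[A, B]%classic.
have mD : measurable D by exact: measurable_itv.
rewrite -lee_fin -sumEFin.
pose J i : set (measurableTypeR R) := `]lo i, hi i[%classic.
have mJ i : measurable (J i) by exact: measurable_itv.
have mf i : measurable_fun D (fun y : measurableTypeR R => w i * \1_(J i) y : measurableTypeR R).
  by apply: measurable_funM => //; exact: measurable_indic.
have E i : P i -> ((w i * (hi i - lo i))%:E = \int[mu]_(y in D) (w i * \1_(J i) y)%:E)%E.
  move=> /Pi[wi Ai lh hB].
  under eq_integral do rewrite EFinM.
  rewrite ge0_integralZl//; last by apply/measurable_EFinP; exact: measurable_indic.
  rewrite integral_indic// (_ : J i `&` D = J i); last first.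
    apply/setIidPl => y; rewrite /J/D/= !in_itv/= => /andP[ly yh].
    by rewrite (le_trans Ai)/= ?ltW// (lt_le_trans yh).
  by rewrite EFinM; congr (_ * _)%E; exact: esym (itv_length false true lh).
under eq_bigr => i iP do rewrite (E i iP).
rewrite big_mkcond/= [leLHS](_ : _ = \sum_(i : I) \int[mu]_(y in D) (if P i then w i * \1_(J i) y else 0)%:E)%E; last first.
  by apply: eq_bigr => i _; case: ifP => // _; rewrite integral0.
have mf' i : measurable_fun D (fun y : measurableTypeR R => (if P i then w i * \1_(J i) y else 0) : measurableTypeR R).
  by case: (P i) => //; exact: mf.
have f0 i y : (0 <= (if P i then w i * \1_(J i) y else 0)%:E)%E.
  by rewrite lee_fin; case: ifP => // /Pi[w0 _ _ _]; rewrite mulr_ge0.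
rewrite -ge0_integral_sum//; last by move=> i; apply/measurable_EFinP; exact: mf'.
apply: (@le_trans _ _ (\int[mu]_(y in D) W%:E)%E).
  have W0 : 0 <= W by apply: le_trans (cover A); apply: sumr_ge0 => i /andP[/Pi[]].
  apply: ge0_le_integral => //.
  - by move=> y _; apply: sume_ge0 => i _.
  - by apply: emeasurable_sum => i; apply/measurable_EFinP; exact: mf'.
  move=> y _; rewrite sumEFin lee_fin; apply: le_trans (cover y).
  rewrite -big_mkcond/= [leRHS]big_mkcondr/=; apply: ler_sum => i iP; have [w0 _ _ _] := Pi i iP.
  rewrite indicE; case: ifPn => [_|]; first by rewrite ler_piMr//; case: (y \in J i).
  move=> ny; rewrite memNset ?mulr0// /J/= in_itv/=; exact/negP.
by rewrite integral_cst// EFinM -(itv_length true false AB).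
Qed.

Lemma subitv_bounds (u w A B : R) : 0 < w -> (forall x, u < x < u + w -> A <= x <= B) ->
  A <= u /\ u + w <= B.
Proof.
move=> w0 H; split; rewrite leNgt; apply/negP => lt.
  have [x /andP[x1 x2]] : exists x, u < x < Num.min A (u + w).
    by exists ((u + Num.min A (u + w)) / 2); rewrite !midf_lt// lt_min lt ltrDl.
  by move: x2; rewrite lt_min => /andP[x2 x3]; have /andP[] := H x ltac:(by rewrite x1 x3); lra.
have [x /andP[x1 x2]] : exists x, Num.max B u < x < u + w.
  by exists ((Num.max B u + (u + w)) / 2); rewrite !midf_lt// gt_max lt ltrDl.
by move: x1; rewrite gt_max => /andP[x3 x1]; have /andP[] := H x ltac:(by rewrite x1 x2); lra.
Qed.

Definition otri (a b c z : R * R) : Prop := exists l0 l1 l2,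
  [/\ 0 < l0, 0 < l1, 0 < l2, l0 + l1 + l2 = 1 &
   z = (l0 * a.1 + l1 * b.1 + l2 * c.1, l0 * a.2 + l1 * b.2 + l2 * c.2)].

(** Twice the signed area of the triangle. *)
Definition tdet (a b c : R * R) : R := (b.1 - a.1) * (c.2 - a.2) - (b.2 - a.2) * (c.1 - a.1).

(* Above the middle vertex b, the horizontal slices of a triangle up to half height are at least
   half as long as the slice through b. *)
Lemma tri_slice_upper (a b c : R * R) : a.2 <= b.2 -> b.2 <= c.2 ->
  2 * (b.2 - a.2) <= c.2 - a.2 -> tdet a b c != 0 ->
  exists lo hi w, [/\ a.2 <= lo, hi <= c.2, lo <= hi, 0 < w & `|tdet a b c| / 8 <= w * (hi - lo)] /\
    forall y, lo < y < hi -> exists u, forall x, u < x < u + w -> otri a b c (x, y).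
Proof.
case: a b c => a1 a2 [b1 b2] [c1 c2] /= ab bc half; rewrite /tdet/= => det0.
have H0 : 0 < c2 - a2.
  rewrite lt_neqAle; apply/andP; split; last lra.
  apply: contra det0 => /eqP H; apply/eqP.
  have -> : b2 = a2 by lra.
  by rewrite -H; ring.
set H := c2 - a2 in half det0 H0 *.
pose th := (b2 - a2) / H.
have thH : th * H = b2 - a2 by rewrite /th divfK// gt_eqF.
have th0 : 0 <= th by rewrite divr_ge0//; lra.
have th1 : th <= 1 / 2 by rewrite ler_pdivrMr//; lra.
(* [th] is the relative height of [b] along the edge from [a] to [c], and [de] the signed length of
   the horizontal slice through [b]; the determinant is [H * de]. *)
pose de := (b1 - a1) - th * (c1 - a1).
have detE : (b1 - a1) * H - (b2 - a2) * (c1 - a1) = H * de by rewrite -thH /de; ring.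
rewrite detE in det0 *.
have de0 : de != 0 by apply: contra det0 => /eqP ->; rewrite mulr0.
have ade0 : 0 < `|de| by rewrite normr_gt0.
have cb : c2 - b2 = (1 - th) * H by rewrite mulrBl thH /H; ring.
have cb0 : 0 < c2 - b2 by rewrite cb mulr_gt0//; lra.
(* The heights used amount to [(1 - th) * H / 2], at least [H / 4] because [th <= 1 / 2]; together
   with the width [|de| / 2] this produces the divisor [8]. *)
exists b2, ((b2 + c2) / 2), (`|de| / 2); split.
  split; [lra|lra|lra|lra|].
  rewrite normrM (gtr0_norm H0).
  have -> : (b2 + c2) / 2 - b2 = (1 - th) * H / 2 by rewrite -cb; field.
  have : 0 <= `|de| * H * (1 / 2 - th) by apply: mulr_ge0; [apply: mulr_ge0; exact: ltW|lra].
  lra.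
move=> y /andP[y1 y2].
pose ta := (y - b2) / (c2 - b2).
have taE : ta * (c2 - b2) = y - b2 by rewrite /ta divfK// gt_eqF.
have ta0 : 0 < ta by rewrite divr_gt0//; lra.
have ta1 : ta < 1 / 2 by rewrite ltr_pdivrMr//; lra.
pose XQ := (1 - ta) * b1 + ta * c1.
pose k := (1 - ta) * de.
have k0 : k != 0 by rewrite mulf_neq0//; apply/eqP; lra.
have main x et : 0 < et < 1 -> et * k = XQ - x -> otri (a1, a2) (b1, b2) (c1, c2) (x, y).
  move=> /andP[et0 et1] ek.
  exists ((1 - ta) * et * (1 - th)), ((1 - ta) * (1 - et)), ((1 - ta) * et * th + ta); split.
  - by apply: mulr_gt0; [apply: mulr_gt0; lra|lra].
  - by apply: mulr_gt0; lra.
  - by apply: ltr_wpDl => //; apply: mulr_ge0 => //; apply: mulr_ge0; lra.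
  - by ring.
  congr pair => /=.
    have -> : x = XQ - et * k by rewrite ek; ring.
    by rewrite /XQ /k /de; ring.
  have -> : y = b2 + ta * (c2 - b2) by rewrite taE; ring.
  have -> : c2 = a2 + H by rewrite /H; ring.
  have -> : b2 = a2 + th * H by rewrite thH; ring.
  ring.
case: (ltrP 0 de) => [de_gt|de_le].
  exists (XQ - de / 2) => x /andP[x1 x2]; move: x2; rewrite gtr0_norm// => x2.
  have kk : 0 < k by rewrite mulr_gt0//; lra.
  have kd : de / 2 < k by rewrite /k mulrC ltr_pM2r//; lra.
  apply: (main x ((XQ - x) / k)); last by rewrite divfK.
  by rewrite divr_gt0/= ?ltr_pdivrMr//; lra.
have de_lt : de < 0 by rewrite lt_neqAle de0.
exists XQ => x /andP[x1 x2]; move: x2; rewrite ltr0_norm// => x2.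
have kk : k < 0 by rewrite nmulr_llt0//; lra.
have kd : k < de / 2.
  have : 0 < (1 / 2 - ta) * (- de) by rewrite mulr_gt0//; lra.
  by rewrite /k; lra.
apply: (main x ((XQ - x) / k)); last by rewrite divfK.
by rewrite ltr_ndivrMr// ltr_ndivlMr//; apply/andP; split; lra.
Qed.

Lemma otri_perm1 a b c z : otri a b c z -> otri b a c z.
Proof.
by move=> [l0 [l1 [l2 [? ? ? h ->]]]]; exists l1, l0, l2; split=> //; [rewrite -h|congr pair]; ring.
Qed.

Lemma otri_perm2 a b c z : otri a b c z -> otri a c b z.
Proof.
by move=> [l0 [l1 [l2 [? ? ? h ->]]]]; exists l0, l2, l1; split=> //; [rewrite -h|congr pair]; ring.
Qed.

(** The range of heights is expressed by common lower and upper bounds of the three vertices, which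
    keeps the property symmetric under permutations. *)
Definition has_slices (a b c : R * R) := tdet a b c != 0 -> exists lo hi w,
  [/\ forall m, m <= a.2 -> m <= b.2 -> m <= c.2 -> m <= lo,
      forall m, a.2 <= m -> b.2 <= m -> c.2 <= m -> hi <= m,
      lo <= hi, 0 < w & `|tdet a b c| / 8 <= w * (hi - lo)] /\
    forall y, lo < y < hi -> exists u, forall x, u < x < u + w -> otri a b c (x, y).

Lemma has_slices_perm1 a b c : has_slices a b c -> has_slices b a c.
Proof.
have E : tdet b a c = - tdet a b c by rewrite /tdet; ring.
rewrite /has_slices E oppr_eq0 normrN => H /H[lo [hi [w [[h1 h2 h3 h4 h5] h6]]]].
exists lo, hi, w; split; first by split=> // m ? ? ?; [exact: h1|exact: h2].
by move=> y /h6[u hu]; exists u => x /hu /otri_perm1.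
Qed.

Lemma has_slices_perm2 a b c : has_slices a b c -> has_slices a c b.
Proof.
have E : tdet a c b = - tdet a b c by rewrite /tdet; ring.
rewrite /has_slices E oppr_eq0 normrN => H /H[lo [hi [w [[h1 h2 h3 h4 h5] h6]]]].
exists lo, hi, w; split; first by split=> // m ? ? ?; [exact: h1|exact: h2].
by move=> y /h6[u hu]; exists u => x /hu /otri_perm2.
Qed.

(** If the middle vertex lies above half height, the reflection [r] turns the triangle upside down;
    reversing the vertices at the same time preserves [tdet]. *)
Lemma has_slices_sorted a b c : a.2 <= b.2 -> b.2 <= c.2 -> has_slices a b c.
Proof.
move=> ab bc det0; case: (lerP (2 * (b.2 - a.2)) (c.2 - a.2)) => half.
  have [lo [hi [w [[h1 h2 h3 h4 h5] h6]]]] := tri_slice_upper ab bc half det0.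
  exists lo, hi, w; split=> //; split=> // m m1 m2 m3; [exact: le_trans h1|exact: le_trans h2 _].
pose r (z : R * R) := (z.1, - z.2).
have E : tdet (r c) (r b) (r a) = tdet a b c by rewrite /tdet/r/=; ring.
have [||||lo [hi [w [[h1 h2 h3 h4 h5] h6]]]] := @tri_slice_upper (r c) (r b) (r a).
- by rewrite /=; lra.
- by rewrite /=; lra.
- by rewrite /=; lra.
- by rewrite E.
move: h1 h2 h5; rewrite E /= => h1 h2 h5.
exists (- hi), (- lo), w; split.
  split=> //; [by move=> m m1 m2 m3; lra|by move=> m m1 m2 m3; lra|lra|lra].
move=> y /andP[y1 y2]; have [|u hu] := h6 (- y); first by apply/andP; split; lra.
exists u => x /hu [l0 [l1 [l2 [? ? ? s [-> yE]]]]].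
exists l2, l1, l0; split=> //; first by rewrite -s; ring.
by congr pair; [ring|rewrite -[y]opprK yE/=; ring].
Qed.

Lemma has_slicesP a b c : has_slices a b c.
Proof.
case: (lerP a.2 b.2) => [ab|/ltW ba]; case: (lerP b.2 c.2) => [bc|/ltW cb];
  case: (lerP a.2 c.2) => [ac|/ltW ca].
- exact: has_slices_sorted.
- exact: has_slices_sorted.
- by apply: has_slices_perm2; exact: has_slices_sorted.
- by apply: has_slices_perm2; apply: has_slices_perm1; exact: has_slices_sorted.
- by apply: has_slices_perm1; exact: has_slices_sorted.
- by apply: has_slices_perm1; apply: has_slices_perm2; exact: has_slices_sorted.
- apply: has_slices_perm1; apply: has_slices_perm2; apply: has_slices_perm1.
  exact: has_slices_sorted.
- apply: has_slices_perm1; apply: has_slices_perm2; apply: has_slices_perm1.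
  exact: has_slices_sorted.
Qed.

Lemma sum1_disjoint (I : finType) (P : pred I) :
  (forall i j, P i -> P j -> i = j) -> \sum_(i | P i) (1 : R) <= 1.
Proof.
move=> Pij; case: (pickP P) => [i Pi|P0]; last by rewrite big_pred0// ler01.
by rewrite (bigD1 i)//= big1 ?addr0// => j /andP[Pj /eqP]; have := Pij _ _ Pj Pi.
Qed.

Lemma segment_packing (I : finType) (P : pred I) (a b : I -> R) (A h : R) : 0 <= h ->
  (forall i, P i -> A <= a i <= A + h /\ A <= b i <= A + h) ->
  (forall i j x, P i -> P j -> Num.min (a i) (b i) < x < Num.max (a i) (b i) ->
     Num.min (a j) (b j) < x < Num.max (a j) (b j) -> i = j) ->
  \sum_(i | P i) `|b i - a i| <= h.
Proof.
move=> h0 box disj.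
have -> : h = 1 * (A + h - A) by ring.
apply: le_trans (@weighted_packing I P (fun i => Num.min (a i) (b i))
  (fun i => Num.max (a i) (b i)) (fun=> 1) A (A + h) 1 _ _ _).
- apply: ler_sum => i Pi; rewrite mul1r.
  by case: (lerP (a i) (b i)) => ab; lra.
- by lra.
- move=> i /box[/andP[? ?] /andP[? ?]].
  by split=> //; case: (lerP (a i) (b i)) => ab; lra.
- move=> y; apply: sum1_disjoint => i j /andP[Pi yi] /andP[Pj yj]; exact: disj yi yj.
Qed.

(** Interval packing is used twice. At a fixed height the slices of disjoint triangles are disjoint
    intervals of total width at most [h]; this serves as the weight bound for the packing of the
    height ranges. The slices capture at least one eighth of [tdet], hence the [8]. *)
Lemma triangle_packing (I : finType) (P : pred I) (a b c : I -> R * R) (A B h : R) : 0 <= h ->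
  (forall i, P i -> [/\ A <= (a i).1 <= A + h, A <= (b i).1 <= A + h & A <= (c i).1 <= A + h]) ->
  (forall i, P i -> [/\ B <= (a i).2 <= B + h, B <= (b i).2 <= B + h & B <= (c i).2 <= B + h]) ->
  (forall i j z, P i -> P j -> otri (a i) (b i) (c i) z -> otri (a j) (b j) (c j) z -> i = j) ->
  \sum_(i | P i) `|tdet (a i) (b i) (c i)| <= 8 * h ^+ 2.
Proof.
move=> h0 boxA boxB disj.
pose Q i := P i && (tdet (a i) (b i) (c i) != 0).
have -> : \sum_(i | P i) `|tdet (a i) (b i) (c i)| = \sum_(i | Q i) `|tdet (a i) (b i) (c i)|.
  rewrite /Q big_mkcondr/=; apply: eq_bigr => i _; case: eqVneq => //= ->.
  by rewrite normr0.
have /choice[s sP] : forall i, exists s : R * R * R, Q i ->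
  [/\ forall m, m <= (a i).2 -> m <= (b i).2 -> m <= (c i).2 -> m <= s.1.1,
      forall m, (a i).2 <= m -> (b i).2 <= m -> (c i).2 <= m -> s.1.2 <= m,
      s.1.1 <= s.1.2, 0 < s.2 & `|tdet (a i) (b i) (c i)| / 8 <= s.2 * (s.1.2 - s.1.1)] /\
    forall y, s.1.1 < y < s.1.2 -> exists u, forall x, u < x < u + s.2 -> otri (a i) (b i) (c i) (x, y).
  move=> i; case: (boolP (Q i)) => [/andP[_ /has_slicesP[lo [hi [w H]]]]|_].
    by exists (lo, hi, w).
  by exists (0, 0, 0).
have step : \sum_(i | Q i) (s i).2 * ((s i).1.2 - (s i).1.1) <= h * (B + h - B).
  apply: weighted_packing; first lra.
    move=> i Qi; have [[s1 s2 s3 s4 s5] _] := sP i Qi.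
    have /andP[Pi _] := Qi; have [/andP[? ?] /andP[? ?] /andP[? ?]] := boxB i Pi.
    by split; [exact: ltW|exact: s1|by []|exact: s2].
  move=> y.
  have /choice[u uP] : forall i, exists u, Q i && ((s i).1.1 < y < (s i).1.2) ->
      forall x, u < x < u + (s i).2 -> otri (a i) (b i) (c i) (x, y).
    move=> i; case: (boolP (_ && _)) => [/andP[Qi yi]|_]; last by exists 0.
    by have [_ /(_ y yi)[u hu]] := sP i Qi; exists u.
  have -> : h = 1 * (A + h - A) by ring.
  apply: le_trans (@weighted_packing I (fun i => Q i && ((s i).1.1 < y < (s i).1.2)) u
    (fun i => u i + (s i).2) (fun=> 1) A (A + h) 1 _ _ _).
  - by apply: ler_sum => i _; rewrite mul1r addrAC subrr add0r.
  - by lra.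
  - move=> i Hi; have /andP[Qi yi] := Hi; have [[_ _ _ s4 _] _] := sP i Qi.
    have /andP[Pi _] := Qi; have [/andP[? ?] /andP[? ?] /andP[? ?]] := boxA i Pi.
    have [||? ?] := @subitv_bounds (u i) (s i).2 A (A + h) => //.
      move=> x /(uP i Hi) [l0 [l1 [l2 [l00 l10 l20 ls [-> _]]]]].
      have -> : A = (l0 + l1 + l2) * A by rewrite ls mul1r.
      have -> : (l0 + l1 + l2) * A + h = (l0 + l1 + l2) * (A + h) by rewrite ls; ring.
      rewrite !mulrDl; apply/andP; split; rewrite !lerD// ler_pM2l//.
    by split=> //; lra.
  - move=> x; apply: sum1_disjoint => i j /andP[Hi xi] /andP[Hj xj].
    have /andP[/andP[Pi _] _] := Hi; have /andP[/andP[Pj _] _] := Hj.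
    exact: (disj i j (x, y) Pi Pj (uP i Hi x xi) (uP j Hj x xj)).
have -> : 8 * h ^+ 2 = 8 * (h * (B + h - B)) by ring.
apply: le_trans (_ : _ <= 8 * \sum_(i | Q i) (s i).2 * ((s i).1.2 - (s i).1.1)) _.
  rewrite mulr_sumr; apply: ler_sum => i Qi; have [[_ _ _ _ s5] _] := sP i Qi; lra.
by rewrite ler_pM2l.
Qed.

End Packing.

(** * Geometry of the mesh and the trace inequality *)

Section Barycentric.
Variables (R : realType) (d : nat).
Local Notation point := 'rV[R]_d.
Implicit Types (s : nat -> point) (x y : point).

Lemma is_poly_continuous p (f : point -> R) : is_poly p f -> continuous f.
Proof.
move=> /is_polyE[c ->].
pose m r (a : 'I_d -> nat) (x : point) := \prod_(i <- r) x ord0 i ^+ a i.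
have cm r a : continuous (m r a).
  elim: r => [|i r IH] x.
    rewrite (_ : m [::] a = fun=> 1); first exact: cst_continuous.
    by apply/funext => y; rewrite /m big_nil.
  rewrite (_ : m (i :: r) a = fun y => y ord0 i ^+ a i * m r a y); last first.
    by apply/funext => y; rewrite /m big_cons.
  apply: (cvgM (F := nbhs x)); last exact: IH.
  elim: (a i) => [|n IHn].
    rewrite expr0 [X in X @ _](_ : _ = fun=> 1); first exact: (@cst_continuous _ _ (1 : R) x).
    by apply/funext => y; rewrite expr0.
  rewrite exprS [X in X @ _](_ : _ = fun y : point => y ord0 i * y ord0 i ^+ n).
    by apply: (cvgM (F := nbhs x)) => //; exact: coord_continuous.
  by apply/funext => y; rewrite exprS.
pose S (r : seq {ffun 'I_d -> 'I_p.+1}) (x : point) := \sum_(a <- r | (\sum_i a i <= p)%N)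
  c a * monom (fun i => a i) x.
suff cS r : continuous (S r) by exact: (cS (index_enum _)).
elim: r => [|a r IH] x.
  rewrite (_ : S [::] = fun=> 0); first exact: cst_continuous.
  by apply/funext => y; rewrite /S big_nil.
rewrite (_ : S (a :: r) = fun y => (if (\sum_i a i <= p)%N then c a else 0) * m (index_enum _) (fun i => a i) y + S r y); last first.
  by apply/funext => y; rewrite /S big_cons; case: ifP => _; rewrite ?mul0r ?add0r.
apply: (cvgD (F := nbhs x)); last exact: IH.
by apply: (cvgM (F := nbhs x)); [exact: cvg_cst|exact: cm].
Qed.

(** Applied to the row [l] of affine coordinates, the column picks [l_i] or minus the sum of all
    entries; [bcst] adds the [1] of the coordinate at [s 0]. *)
Definition bcol (e : 'I_d.+1) : 'cV[R]_d :=
  if unlift ord0 e is Some i then delta_mx i ord0 else const_mx (-1).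
Definition bcst (e : 'I_d.+1) : R := if unlift ord0 e is Some i then 0 else 1.
(* The coordinate at vertex s 0 has index ord0, the one at s i.+1 has index lift ord0 i. *)
Definition bary s (e : 'I_d.+1) x : R :=
  ((x - s 0%N) *m (invmx (edges s) *m bcol e)) ord0 ord0 + bcst e.

Lemma bcol_neq0 e : (0 < d)%N -> bcol e != 0.
Proof.
move=> d0; rewrite /bcol; case: unliftP => [i _|_]; apply/eqP => /matrixP H.
  by have := H i ord0; rewrite !mxE !eqxx => /eqP; rewrite oner_eq0.
by have := H (Ordinal d0) ord0; rewrite !mxE => /eqP; rewrite oppr_eq0 oner_eq0.
Qed.

Lemma bary_affine s e x y (t : R) :
  bary s e (x + t *: (y - x)) = (1 - t) * bary s e x + t * bary s e y.
Proof.
rewrite /bary; have -> : x + t *: (y - x) - s 0%N = (1 - t) *: (x - s 0%N) + t *: (y - s 0%N).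
  by apply/rowP => i; rewrite !mxE; ring.
rewrite mulmxDl -!scalemxAl.
set A := (x - _) *m _; set B := (y - _) *m _; clearbody A B.
by rewrite !mxE; ring.
Qed.

Lemma bary_sum s e k (v : nat -> point) (w : nat -> R) : \sum_(i < k) w i = 1 ->
  bary s e (\sum_(i < k) w i *: v i) = \sum_(i < k) w i * bary s e (v i).
Proof.
move=> w1; rewrite /bary; have -> : \sum_(i < k) w i *: v i - s 0%N = \sum_(i < k) w i *: (v i - s 0%N).
  under [RHS]eq_bigr do rewrite scalerBr; rewrite sumrB -scaler_suml w1 scale1r//.
rewrite mulmx_suml summxE -[X in _ + X = _]mul1r -[X in _ + X * _ = _]w1 mulr_suml -big_split/=.
by apply: eq_bigr => i _; rewrite -scalemxAl mxE mulrDr.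
Qed.

Lemma bary_sparam s e (l : nat -> R) : edges s \in unitmx ->
  bary s e (sparam d s l) = if unlift ord0 e is Some i then l i else 1 - \sum_(i < d) l i.
Proof.
move=> Eu; rewrite /bary sparam_edges [_ + _ - s 0%N]addrAC subrr add0r mulmxA mulmxK// /bcol /bcst mxE.
case: unliftP => [i _|_].
  rewrite addr0 (bigD1 i)//= !mxE !eqxx mulr1 big1 ?addr0// => j ji.
  by rewrite !mxE (negbTE ji) mulr0.
by rewrite addrC -sumrN; congr (_ + _); apply: eq_bigr => i _; rewrite !mxE mulrN1.
Qed.

Lemma sparamK s x : edges s \in unitmx -> exists2 l : nat -> R, x = sparam d s l &
  forall i, (d <= i)%N -> l i = 0.
Proof.
move=> Eu; pose r := (x - s 0%N) *m invmx (edges s).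
exists (fun i => if insub i is Some j then r ord0 j else 0).
  rewrite sparam_edges (_ : \row_i _ = r) ?mulmxKV//; first by rewrite addrC subrK.
  by apply/rowP => i; rewrite mxE valK.
by move=> i di; rewrite insubF// ltnNge di.
Qed.

Lemma csimplexP s x : edges s \in unitmx -> csimplex d s x <-> forall e, 0 <= bary s e x.
Proof.
move=> Eu; split=> [/csimplex_sparam[l [l0 [lz ls]] ->] e|H].
  by rewrite bary_sparam//; case: unliftP => [i _|_]; rewrite ?subr_ge0.
have [l xE lz] := sparamK x Eu; rewrite xE; apply: sparam_csimplex.
split=> [i|].
  case: (ltnP i d) => [id|/lz ->]//.
  by have := H (lift ord0 (Ordinal id)); rewrite xE bary_sparam// liftK.
by split=> //; have := H ord0; rewrite xE bary_sparam// unlift_none subr_ge0.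
Qed.

Lemma bary_continuous s e : continuous (bary s e).
Proof.
apply: (@is_poly_continuous 1); apply: is_polyD; last exact: is_poly_cst.
rewrite (_ : (fun x => _) = fun x : point => \sum_i (invmx (edges s) *m bcol e) i ord0 * (x ord0 i - s 0%N ord0 i)).
  apply: is_poly_sum => i _; apply: is_polyZ; apply: is_polyB; last exact: is_poly_cst.
  exact: is_poly_coord.
by apply/funext => x; rewrite mxE; apply: eq_bigr => i _; rewrite mxE mulrC !mxE.
Qed.

Lemma bary_pos_interior s x : edges s \in unitmx -> (forall e, 0 < bary s e x) ->
  interior (csimplex d s) x.
Proof.
move=> Eu H.
have : \forall y \near x, forall e, 0 < bary s e y.
  apply: (filter_forall (F := nbhs x)) => e.
  have h : nbhs (bary s e x) [set r | 0 < r].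
    by apply: open_nbhs_nbhs; split; [exact: open_gt|exact: H].
  exact: (@bary_continuous s e x _ h).
apply: filterS => y Hy; apply/(csimplexP _ Eu) => e; exact: ltW.
Qed.

Lemma bary_pos_ex s : edges s \in unitmx -> exists y, forall e, 0 < bary s e y.
Proof.
move=> Eu; exists (sparam d s (fun i => if (i < d)%N then d.+1%:R^-1 else 0)) => e.
rewrite bary_sparam//; case: unliftP => [i _|_]; first by rewrite ltn_ord invr_gt0.
under eq_bigr do rewrite ltn_ord.
rewrite subr_gt0 sumr_const card_ord -[_ *+ d]mulr_natl ltr_pdivrMr// mul1r ltr_nat//.
Qed.

(** A small move towards a point with positive barycentric coordinates makes all coordinates
    positive, by affinity. *)
Lemma csimplex_closure s x : edges s \in unitmx -> csimplex d s x ->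
  closure (interior (csimplex d s)) x.
Proof.
move=> Eu xs B Bx.
have [y yp] := bary_pos_ex Eu.
have cp : (fun t : R => x + t *: (y - x)) @ nbhs (0 : R) --> x + (0 : R) *: (y - x).
  by apply: cvgD; [exact: cvg_cst|apply: cvgZr_tmp; exact: cvg_id].
rewrite scale0r addr0 in cp.
have : \forall t \near (0 : R), B (x + t *: (y - x)) by exact: (cp B Bx).
move=> [e /= e0 He].
pose t := Num.min (e / 2) 1.
have t0 : 0 < t by rewrite lt_min divr_gt0//=.
have t1 : t <= 1 by rewrite ge_min lexx orbT.
exists (x + t *: (y - x)); split.
  apply: bary_pos_interior => // i; rewrite bary_affine.
  by rewrite ltr_wpDl ?mulr_gt0// mulr_ge0 ?subr_ge0//; exact: (csimplexP x Eu).1.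
apply: He; rewrite /ball_/= sub0r normrN gtr0_norm// gt_min; apply/orP; left.
by rewrite ltr_pdivrMr// ltr_pMr// ltr1n.
Qed.

Lemma csimplex_bounded k s : exists K, forall x i, csimplex k s x -> `|x ord0 i| <= K.
Proof.
exists (\sum_(j < k.+1) \sum_i `|s j ord0 i|) => x i [l [l0 [l1 ->]]].
rewrite summxE; apply: le_trans (ler_norm_sum _ _ _) _; apply: ler_sum => j _.
have lj0 : 0 <= l j by apply: l0; rewrite -ltnS.
have lj1 : l j <= 1.
  rewrite -l1 (bigD1 j)//= lerDl sumr_ge0// => j' _; apply: l0.
  by rewrite -ltnS.
rewrite mxE normrM (ger0_norm lj0); apply: (@le_trans _ _ `|s j ord0 i|).
  by rewrite ler_piMl.
by rewrite (bigD1 i)//= lerDl sumr_ge0.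
Qed.

End Barycentric.

(** * Closed elements, open elements and their diameters *)

Section MeshTopology.
Variables (R : realType) (d : nat) (M : mesh R d) (Om : set 'rV[R]_d).
Local Notation point := 'rV[R]_d.
Implicit Types (x y : point).

Lemma enorm_ge0 x : 0 <= enorm x. Proof. exact: sqrtr_ge0. Qed.

Lemma coord_le_enorm x i : `|x ord0 i| <= enorm x.
Proof.
rewrite -sqrtr_sqr /enorm ler_wsqrtr// /dotp (bigD1 i)//= expr2 lerDl sumr_ge0// => j _.
exact: sqr_ge0.
Qed.

Lemma cl_el_bounded k : exists2 K, 0 <= K & forall x i, cl_el M k x -> `|x ord0 i| <= K.
Proof.
have /choice[K KP] : forall j, exists K, forall x i, csimplex d (subsimp M k j) x -> `|x ord0 i| <= K.
  by move=> j; exact: csimplex_bounded.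
exists (\sum_(j < size (subs k)) `|K j|) => [|x i [j /= js xj]]; first by rewrite sumr_ge0.
apply: le_trans (KP j x i xj) _; apply: le_trans (ler_norm _) _.
by rewrite (bigD1 (Ordinal js))//= lerDl sumr_ge0.
Qed.

Lemma el_cl_el k : el M k `<=` cl_el M k.
Proof. exact: interior_subset. Qed.

Lemma enorm_sub_bounded k : exists K, forall x y, cl_el M k x -> cl_el M k y -> enorm (x - y) <= K.
Proof.
have [K K0 KP] := cl_el_bounded k.
exists (Num.sqrt (\sum_(i < d) (2 * K) ^+ 2)) => x y xk yk.
rewrite /enorm ler_wsqrtr// /dotp; apply: ler_sum => i _.
rewrite -expr2 -[leLHS]real_normK ?num_real// lerXn2r ?nnegrE ?mulr_ge0//.
rewrite !mxE; apply: le_trans (ler_normB _ _) _.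
by rewrite mulr2n mulrDl mul1r lerD// KP.
Qed.

Lemma el_diam k x y : el M k x -> el M k y -> enorm (x - y) <= hel M k.
Proof.
move=> xk yk; apply: sup_ubound; last by exists x, y.
have [K KP] := enorm_sub_bounded k.
by exists K => r [x' [y' [x'k [y'k ->]]]]; apply: KP; exact: el_cl_el.
Qed.

Lemma hel_ge0 k : 0 <= hel M k.
Proof.
have [[x xk]|H] := pselect (exists x, el M k x).
  by apply: le_trans (el_diam xk xk); exact: enorm_ge0.
rewrite /hel /diam (_ : [set r | _] = set0) ?sup0//.
by apply/seteqP; split => r //= [x [y [xk _]]]; apply: H; exists x.
Qed.

Lemma closed_coord_le i (z : point) (h : R) : closed [set x : point | `|x ord0 i - z ord0 i| <= h].
Proof.
apply: (@closed_comp _ _ (fun x : point => `|x ord0 i - z ord0 i|) [set r | r <= h]); last exact: closed_le.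
move=> x _; apply: (cvg_norm (F := nbhs x)); apply: (cvgB (F := nbhs x)); last exact: cvg_cst.
exact: coord_continuous.
Qed.

Lemma closure_sub_closed (T : topologicalType) (A B : set T) : closed B -> A `<=` B ->
  closure A `<=` B.
Proof. by move=> cB AB; rewrite [X in _ `<=` X](closure_id B).1//; exact: closureS. Qed.

Lemma closure_el_coord k x y i : closure (el M k) x -> closure (el M k) y ->
  `|x ord0 i - y ord0 i| <= hel M k.
Proof.
have step x' y' : closure (el M k) x' -> el M k y' -> `|x' ord0 i - y' ord0 i| <= hel M k.
  move=> cx ey; suff : closure (el M k) `<=` [set z : point | `|z ord0 i - y' ord0 i| <= hel M k] by exact.
  apply: closure_sub_closed; first exact: closed_coord_le.
  move=> z zk /=.
  by apply: le_trans (el_diam zk ey); have := coord_le_enorm (z - y') i; rewrite !mxE.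
move=> cx cy; rewrite distrC.
suff : closure (el M k) `<=` [set z : point | `|z ord0 i - x ord0 i| <= hel M k] by exact.
apply: closure_sub_closed; first exact: closed_coord_le.
move=> z zk /=.
by rewrite distrC; exact: step.
Qed.

Hypothesis valid : valid_mesh M Om.

Lemma sub_edges_unit k i : (i < size (subs k))%N -> edges (subsimp M k i) \in unitmx.
Proof. by move=> ik; apply: edges_unit; case: valid => _ [+ _]; apply. Qed.

(** Each subsimplex lies in the closure of its own interior. In this way [hel], the diameter of the
    open element, also controls the closed one. *)
Lemma cl_el_closure k : cl_el M k `<=` closure (el M k).
Proof.
move=> x [i /= ik xi].
have := csimplex_closure (sub_edges_unit ik) xi; apply: closureS.
by apply: interiorS => y yi; exists i.
Qed.

Lemma cl_el_coord k x y i : cl_el M k x -> cl_el M k y -> `|x ord0 i - y ord0 i| <= hel M k.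
Proof. by move=> /cl_el_closure xk /cl_el_closure yk; exact: closure_el_coord. Qed.

(** A point of the closed element [l] is a limit of points of [el M l], so an open set containing it
    meets [el M l]. *)
Lemma el_disjoint_cl_el k l x : k <> l -> el M k x -> ~ cl_el M l x.
Proof.
move=> kl xk /cl_el_closure /(_ (el M k)) [|z [zl zk]].
  by apply: open_nbhs_nbhs; split => //; exact: open_interior.
case: valid => _ [_ [_ [/(_ k l kl) + _]]].
by move=> E; have : (el M k `&` el M l) z by []; rewrite E.
Qed.

Variables (Cr sigma Cq : R) (m : nat).
Hypotheses (Cr0 : 0 < Cr) (d0 : (0 < d)%N) (Om0 : Om !=set0).
Hypothesis reg : regular_mesh M Cr sigma m Cq.

Lemma volel_gt0 k : subs k <> [::] -> 0 < volel M k.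
Proof.
move=> k0; rewrite /volel (big_nth (fun=> 0)) big_mkord.
case E : (size (subs k)) => [|n]; first by move/size0nil : E.
have p (i : 'I_n.+1) : 0 < smeas d (nth (fun=> 0) (subs k) i).
  by case: valid => _ [/(_ k i) + _]; rewrite E => /(_ (ltn_ord i)).
by rewrite big_ord_recl ltr_wpDr// ?p// sumr_ge0// => i _; exact/ltW/(p (lift ord0 i)).
Qed.

Lemma hel_gt0_sub k : subs k <> [::] -> 0 < hel M k.
Proof.
move=> k0; rewrite lt_neqAle hel_ge0 andbT eq_sym; apply/eqP => h0.
have [/(_ k)[+ _] _] := reg; rewrite h0 expr0n eqn0Ngt d0/=.
by rewrite leNgt volel_gt0.
Qed.

(** An element without subsimplices would have diameter [0], and quasi-uniformity would then force
    the same on an element meeting the nonempty domain, whose volume is positive. *)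
Lemma subs_neq0 (k : 'I_(nel M)) : subs k <> [::].
Proof.
have [l l0] : exists l : 'I_(nel M), subs l <> [::].
  case: valid => _ [_ [_ [_ [cO _]]]]; case: Om0 => x /subset_closure.
  rewrite cO => -[l _ [i /= il _]]; exists l => E.
  by rewrite E in il.
move=> k0; have [_ [_ /(_ l k)]] := reg.
rewrite [X in Cq * X](_ : hel M k = 0) ?mulr0 ?leNgt ?hel_gt0_sub//.
rewrite /hel /diam (_ : [set r | _] = set0) ?sup0//.
apply/seteqP; split => r //= [x [y [/interior_subset + _]]].
by case => i /=; rewrite k0.
Qed.

Lemma hel_gt0 k : 0 < hel M k. Proof. exact/hel_gt0_sub/subs_neq0. Qed.

End MeshTopology.

(** * Faces lie in hyperplanes of subsimplex facets *)

Section Faces.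
Variables (R : realType) (d : nat) (Om : set 'rV[R]_d).
Local Notation point := 'rV[R]_d.
Implicit Types (x y : point).

Lemma comb_continuous n (v : nat -> point) :
  continuous (fun l : 'rV[R]_n => \sum_(i < n) l ord0 i *: v i).
Proof.
elim: (index_enum _) => [|i r IH] l.
  rewrite (_ : (fun l : 'rV[R]_n => _) = fun=> 0); first exact: cst_continuous.
  by apply/funext => y; rewrite big_nil.
rewrite (_ : (fun l : 'rV[R]_n => _) = fun l : 'rV[R]_n => l ord0 i *: v i + \sum_(i <- r) l ord0 i *: v i).
  apply: (cvgD (F := nbhs l)); last exact: IH.
  by apply: (cvgZr_tmp (F := nbhs l)); exact: coord_continuous.
by apply/funext => y; rewrite big_cons.
Qed.

Lemma convex_hull_closed (pts : seq point) : closed (convex_hull pts).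
Proof.
pose n := size pts.
pose A := [set l : 'rV[R]_n | forall i, `[(0 : R), 1]%classic (l ord0 i)].
pose B := [set l : 'rV[R]_n | \sum_i l ord0 i * 1 = 1].
pose f (l : 'rV[R]_n) := \sum_(i < n) l ord0 i *: nth 0 pts i.
have cA : compact A by apply: (@rV_compact R n (fun=> `[(0 : R), 1]%classic)) => i; exact: segment_compact.
have cB : closed B.
  have -> : B = (fun l : 'rV[R]_n => \sum_i l ord0 i * 1) @^-1` [set 1] by [].
  apply: closed_comp; last exact: closed_eq.
  move=> x _; apply: (@is_poly_continuous R n 1); apply: is_poly_sum => i _.
  under eq_fun do rewrite mulr1; exact: is_poly_coord.
have -> : convex_hull pts = f @` (A `&` B).
  apply/seteqP; split => x /=.
    move=> [l [l0 [l1 ->]]]; exists (\row_i l i).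
      split => /=.
        move=> i; rewrite /= in_itv/= mxE l0/= -l1 (bigD1 i)//= lerDl sumr_ge0//.
      by rewrite /B/= -[RHS]l1; apply: eq_bigr => i _; rewrite mxE mulr1.
    by apply: eq_bigr => i _; rewrite mxE.
  move=> [l [lA lB] <-]; exists (fun i => if insub i is Some j then l ord0 j else 0); split.
    move=> i; case: insubP => [j _ _|//]; have := lA j.
    by rewrite /= in_itv/= => /andP[].
  split; first by rewrite -[RHS]lB; apply: eq_bigr => i _; rewrite valK mulr1.
  by apply: eq_bigr => i _; rewrite valK.
apply: compact_closed; first exact: norm_hausdorff.
apply: continuous_compact; last exact: compact_closedI.
by apply: continuous_subspaceT; exact: comb_continuous.
Qed.

(** The closure stays inside the closed convex hull, whose interior is the domain. Consequently open
    elements, which lie in the interior of the closure, are contained in the domain. *)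
Lemma polytope_interior_closure : convex_polytope_domain Om -> interior (closure Om) `<=` Om.
Proof.
move=> [[pts OmE] _]; rewrite [X in _ `<=` X]OmE; apply: interiorS.
rewrite OmE; apply: closure_sub_closed; first exact: convex_hull_closed.
exact: interior_subset.
Qed.

Variable M : mesh R d.
Hypotheses (valid : valid_mesh M Om) (poly : convex_polytope_domain Om).

Definition touches (k : 'I_(nel M)) (f : 'I_(nfc M)) : bool :=
  (fplus f == k) || (fminus f == Some k).

(** An interior face lies in the closed element on the other side, which the open element avoids; a
    boundary face lies outside the domain, which contains the open element. *)
Lemma face_boundary k f : touches k f ->
  csimplex d.-1 (fvert f) `<=` cl_el M k `\` el M k.
Proof.
have [_ [_ [_ [_ [clO [_ [_ [_ [nb _]]]]]]]]] := valid.
have elOm k' x : el M k' x -> Om x.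
  move=> xk; apply: (polytope_interior_closure poly).
  suff : interior (cl_el M k') `<=` interior (closure Om) by exact.
  by apply: interiorS => y yk; rewrite clO; exists k'.
move=> /orP tk x xf; have := nb f.
case E : (fminus f) => [l|].
  move=> [lf /(_ x xf) [x1 x2]].
  case: tk => [/eqP <-|]; last rewrite E => /eqP[<-].
    by split=> // xe; exact: (el_disjoint_cl_el valid (nesym lf) xe x2).
  by split=> // xe; exact: (el_disjoint_cl_el valid lf xe x1).
move=> /(_ x xf) [x1 [_ x2]].
case: tk => [/eqP <-|]; last by rewrite E.
by split=> // xe; apply: x2; exact: elOm xe.
Qed.

Lemma boundary_bary0 k x : (cl_el M k `\` el M k) x ->
  exists ie : 'I_(size (subs k)) * 'I_d.+1, bary (subsimp M k ie.1) ie.2 x = 0.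
Proof.
move=> [[i /= ik xi] nxe]; have Eu := sub_edges_unit valid ik.
have [[e e0]|ne] := pselect (exists e, bary (subsimp M k i) e x = 0).
  by exists (Ordinal ik, e).
exfalso; apply: nxe; suff : interior (csimplex d (subsimp M k i)) `<=` el M k.
  apply; apply: bary_pos_interior => // e.
  rewrite lt_neqAle ((csimplexP x Eu).1 xi) andbT eq_sym; apply/eqP => e0.
  by apply: ne; exists e.
by apply: interiorS => y yi; exists i.
Qed.

(* Along the curve sum_a t^a v_a / sum_a t^a the barycentric coordinates are polynomials in t up to a
   common factor; their product vanishes for all t > 0, so one of them vanishes identically. *)
Lemma boundary_simplex_hyperplane k n (v : nat -> point) :
  csimplex n v `<=` cl_el M k `\` el M k ->
  exists ie : 'I_(size (subs k)) * 'I_d.+1,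
    forall a, (a <= n)%N -> bary (subsimp M k ie.1) ie.2 (v a) = 0.
Proof.
move=> vb.
pose P (ie : 'I_(size (subs k)) * 'I_d.+1) : {poly R} :=
  \poly_(a < n.+1) bary (subsimp M k ie.1) ie.2 (v a).
have PE (t : R) : 0 < t -> exists x, csimplex n v x /\
    forall ie, (P ie).[t] = 0 <-> bary (subsimp M k ie.1) ie.2 x = 0.
  move=> t0; pose W := \sum_(a < n.+1) t ^+ a.
  have W0 : 0 < W by rewrite /W big_ord_recl expr0 ltr_pwDl// sumr_ge0// => a _; rewrite exprn_ge0// ltW.
  pose w (a : nat) := t ^+ a / W.
  have w1 : \sum_(a < n.+1) w a = 1 by rewrite -mulr_suml divff// gt_eqF.
  exists (\sum_(a < n.+1) w a *: v a); split.
    by exists w; split=> // a _; rewrite divr_ge0 ?ltW// exprn_gt0.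
  move=> ie'; rewrite bary_sum// horner_poly.
  have -> : \sum_(i < n.+1) w i * bary (subsimp M k ie'.1) ie'.2 (v i) =
      (\sum_(i < n.+1) bary (subsimp M k ie'.1) ie'.2 (v i) * t ^+ i) / W.
    by rewrite mulr_suml; apply: eq_bigr => a _; rewrite /w; ring.
  split=> [->|/eqP]; first by rewrite mul0r.
  by rewrite mulf_eq0 invr_eq0 (gt_eqF W0) orbF => /eqP.
pose Q := \prod_ie P ie.
have Q0 : Q = 0.
  apply/eqP; apply: contraT => Qn0.
  (* [size Q] distinct positive roots, one more than the degree of a nonzero [Q] permits. *)
  pose rs := [seq (i.+1%:R : R) | i <- iota 0 (size Q)].
  have := @max_poly_roots _ Q rs Qn0; rewrite size_map size_iota ltnn; apply.
    apply/allP => _ /mapP[i _ ->]; rewrite /root.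
    have [x [xv xP]] := PE i.+1%:R (ltr0Sn _ i).
    have [ie ie0'] := boundary_bary0 (vb x xv).
    rewrite /Q horner_prod; apply/prodf_eq0; exists ie => //.
    by apply/eqP/xP.
  rewrite map_inj_uniq ?iota_uniq// => i j /eqP.
  by rewrite eqr_nat => /eqP[].
move/eqP: Q0 => /prodf_eq0[ie _ /eqP Pie]; exists ie => a an.
by have := coef_poly n.+1 (fun a => bary (subsimp M k ie.1) ie.2 (v a)) a; rewrite -/(P ie) Pie coef0 ltnS an.
Qed.

End Faces.

(** * Area of a simplex through its coordinate projections *)

Section Minors.
Variable R : realType.

Let i1 n : 'I_n.+2 := lift ord0 ord0.
Let i2 n : 'I_n.+3 := lift ord0 (i1 n).

Lemma det_mx22 (A : 'M[R]_2) : \det A = A ord0 ord0 * A (i1 0) (i1 0) - A ord0 (i1 0) * A (i1 0) ord0.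
Proof.
rewrite (expand_det_row _ ord0) !big_ord_recl big_ord0 /cofactor !det_mx11 !mxE /= /bump /=.
rewrite addr0 expr0 expr1 mul1r mulN1r mulrN; congr (_ * A _ _ - _ * A _ _); exact/val_inj.
Qed.

(** Up to sign and a factorial, the volume of the projection of the simplex along the coordinate
    axis [j]. *)
Definition minor n (j : 'I_n.+1) (v : nat -> 'rV[R]_n.+1) : R :=
  \det (\matrix_(a < n, b < n) (v a.+1 - v 0%N) ord0 (lift j b)).

Let lift10 n : lift (i1 n) ord0 = ord0. Proof. exact/val_inj. Qed.
Let lift11 n : lift (i1 n.+1) (i1 n) = i2 n. Proof. exact/val_inj. Qed.
Let lift20 n : lift (i2 n) ord0 = ord0. Proof. exact/val_inj. Qed.
Let lift21 n : lift (i2 n) (i1 n) = i1 n.+1. Proof. exact/val_inj. Qed.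

Lemma minor1E j (v : nat -> 'rV[R]_2) : minor j v = v 1%N ord0 (lift j ord0) - v 0%N ord0 (lift j ord0).
Proof. by rewrite /minor det_mx11 !mxE. Qed.

Lemma minor2E j (v : nat -> 'rV[R]_3) :
  minor j v = tdet (v 0%N ord0 (lift j ord0), v 0%N ord0 (lift j (i1 0)))
    (v 1%N ord0 (lift j ord0), v 1%N ord0 (lift j (i1 0)))
    (v 2%N ord0 (lift j ord0), v 2%N ord0 (lift j (i1 0))).
Proof. by rewrite /minor det_mx22 /tdet !mxE /=; ring. Qed.

(** The Cauchy-Binet formula, checked by expansion in the two dimensions that occur. *)
Lemma gram_minor n (v : nat -> 'rV[R]_n.+1) : (n = 1%N) \/ (n = 2%N) ->
  \det (gram n v) = \sum_j minor j v ^+ 2.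
Proof.
case=> nE; subst n.
  rewrite det_mx11 mxE /dotp !big_ord_recl !big_ord0 !minor1E -/(i1 0) lift10 !mxE; ring.
rewrite det_mx22 /gram !mxE /dotp !big_ord_recl !big_ord0 !minor2E /tdet -/(i1 0) -/(i1 1) -/(i2 0).
rewrite lift10 lift11 lift20 lift21 !mxE /=; ring.
Qed.

Lemma smeas_minor n (v : nat -> 'rV[R]_n.+1) : (n = 1%N) \/ (n = 2%N) ->
  smeas n v <= refint n 1 (fun=> 1) * \sum_j `|minor j v|.
Proof.
move=> n12; rewrite smeasE mulrC ler_wpM2l//; first exact/ltW/refint1_gt0.
rewrite gram_minor// -[leRHS]ger0_norm ?sumr_ge0// -sqrtr_sqr ler_wsqrtr//.
under eq_bigr do rewrite -real_normK ?num_real//.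
suff : \sum_j `|minor j v| ^+ 2 <= (\sum_j `|minor j v|) ^+ 2 /\ 0 <= \sum_j `|minor j v| by case.
elim: (index_enum _) => [|j r [IH1 IH2]]; first by rewrite !big_nil expr0n.
rewrite !big_cons; split; last by rewrite addr_ge0.
rewrite sqrrD -addrA lerD2l; apply: le_trans IH1 _; rewrite lerDr.
by rewrite mulrn_wge0// mulr_ge0.
Qed.

Lemma osimplex_hyperplane n k (v : nat -> 'rV[R]_n) (nu : 'cV[R]_n) c (x : 'rV[R]_n) :
  (forall a, (a <= k)%N -> (v a *m nu) ord0 ord0 = c) -> osimplex k v x -> (x *m nu) ord0 ord0 = c.
Proof.
move=> vc [l [_ [l1 ->]]]; rewrite mulmx_suml summxE -[RHS]mul1r -l1 mulr_suml.
by apply: eq_bigr => a _; rewrite -scalemxAl mxE vc// -ltnS.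
Qed.

(* A hyperplane containing a simplex with nondegenerate projection along e_j is transversal to e_j. *)
Lemma hyperplane_proj_inj n (j : 'I_n.+1) (v : nat -> 'rV[R]_n.+1) (nu : 'cV[R]_n.+1) c (x x' : 'rV[R]_n.+1) :
  nu != 0 -> minor j v != 0 -> (forall a, (a <= n)%N -> (v a *m nu) ord0 ord0 = c) ->
  (x *m nu) ord0 ord0 = c -> (x' *m nu) ord0 ord0 = c ->
  (forall b, x ord0 (lift j b) = x' ord0 (lift j b)) -> x = x'.
Proof.
move=> nu0 mv vc xc x'c xx'.
have dot (y : 'rV[R]_n.+1) : (y *m nu) ord0 ord0 =
    y ord0 j * nu j ord0 + \sum_(b < n) y ord0 (lift j b) * nu (lift j b) ord0.
  by rewrite mxE (bigD1_ord j).
have nuj : nu j ord0 != 0.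
  apply: contra nu0 => /eqP nuj.
  pose nu' : 'cV[R]_n := \col_(b < n) nu (lift j b) ord0.
  set A := (\matrix_(a < n, b < n) (v a.+1 - v 0%N) ord0 (lift j b)).
  have Anu : A *m nu' = 0.
    apply/matrixP => a i; rewrite ord1 !mxE.
    have : ((v a.+1 - v 0%N) *m nu) ord0 ord0 = 0 :> R.
      by rewrite mulmxBl [LHS]mxE [X in _ + X]mxE !vc ?subrr//; exact: ltn_ord.
    by rewrite dot nuj mulr0 add0r => {2}<-; apply: eq_bigr => b _; rewrite !mxE.
  have Au : A \in unitmx by rewrite unitmxE unitfE.
  have nu'0 : nu' = 0 by rewrite -[nu'](mulKmx Au) Anu mulmx0.
  apply/eqP/matrixP => k i; rewrite ord1 mxE; case: (unliftP j k) => [b ->|-> //].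
  by have /matrixP/(_ b ord0) := nu'0; rewrite !mxE.
apply/rowP => k; case: (unliftP j k) => [b ->|->]; first exact: xx'.
move: xc; rewrite -x'c !dot => /eqP.
under eq_bigr do rewrite xx'.
by rewrite (inj_eq (addIr _)) => /eqP/(mulIf nuj).
Qed.

Lemma hyperplane_area n (I : finType) (P : pred I) (v : I -> nat -> 'rV[R]_n.+1) (j : 'I_n.+1)
    (nu : 'cV[R]_n.+1) c h :
  (n = 1%N) \/ (n = 2%N) -> 0 <= h -> nu != 0 ->
  (forall i a, P i -> (a <= n)%N -> (v i a *m nu) ord0 ord0 = c) ->
  (forall i i', i <> i' -> osimplex n (v i) `&` osimplex n (v i') = set0) ->
  (forall i i' a a' k, P i -> P i' -> (a <= n)%N -> (a' <= n)%N ->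
     `|v i a ord0 k - v i' a' ord0 k| <= h) ->
  \sum_(i | P i) `|minor j (v i)| <= 8 * (2 * h) ^+ n.
Proof.
move=> n12 h0 nu0 vc disj box.
pose Q i := P i && (minor j (v i) != 0).
have -> : \sum_(i | P i) `|minor j (v i)| = \sum_(i | Q i) `|minor j (v i)|.
  rewrite /Q big_mkcondr/=; apply: eq_bigr => i _; case: eqVneq => //= ->.
  by rewrite normr0.
have hn : 0 <= (2 * h) ^+ n by rewrite exprn_ge0// mulr_ge0.
case: (pickP Q) => [i0 /andP[Pi0 _]|Q0]; last by rewrite big_pred0// mulr_ge0.
(* Vertices of two simplices differ by at most [h] in every coordinate, so a box of side [2 * h]
   centred at one vertex contains them all. *)
pose A k := v i0 0%N ord0 k - h.
have inbox i a k : Q i -> (a <= n)%N -> A k <= v i a ord0 k <= A k + 2 * h.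
  move=> /andP[Pi _] an; have := box i i0 a 0%N k Pi Pi0 an (leq0n _).
  by rewrite ler_norml /A => /andP[? ?]; apply/andP; split; lra.
(* Disjointness survives projection: two points of the common hyperplane with equal projections
   coincide, so the two open simplices would meet. *)
have key i i' x x' : Q i -> Q i' -> osimplex n (v i) x -> osimplex n (v i') x' ->
    (forall b, x ord0 (lift j b) = x' ord0 (lift j b)) -> i = i'.
  move=> /andP[Pi mi] /andP[Pi' _] xi x'i xx'; apply/eqP; apply: contraT => /eqP ii'.
  have vi a := vc i a Pi; have vi' a := vc i' a Pi'.
  have E := hyperplane_proj_inj nu0 mi vi (osimplex_hyperplane vi xi) (osimplex_hyperplane vi' x'i) xx'.
  have xx : (osimplex n (v i) `&` osimplex n (v i')) x by split=> //; rewrite E.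
  by rewrite disj in xx.
have h2 : 0 <= 2 * h by rewrite mulr_ge0.
case: n12 => nE; subst n.
  rewrite expr1; apply: (@le_trans _ _ (2 * h)); last by rewrite ler_peMl// ler1n.
  under eq_bigr do rewrite minor1E.
  pose k := lift j ord0; rewrite -/k.
  have seg i x : Q i -> Num.min (v i 0%N ord0 k) (v i 1%N ord0 k) < x <
      Num.max (v i 0%N ord0 k) (v i 1%N ord0 k) ->
      exists2 y, osimplex 1 (v i) y & y ord0 k = x.
    move=> Qi xi; set a := v i 0%N ord0 k in xi *; set b := v i 1%N ord0 k in xi *.
    have ba : b - a != 0 by rewrite subr_eq0; apply: contraTneq xi => ->; rewrite minxx maxxx; case: ltgtP.
    pose t := (x - a) / (b - a).
    have tE : t * (b - a) = x - a by rewrite /t divfK.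
    have /andP[t0 t1] : 0 < t < 1.
      move: xi; rewrite /t; case: (lerP a b) => ab /andP[x1 x2].
        have ab' : 0 < b - a by rewrite lt_neqAle eq_sym ba subr_ge0.
        apply/andP; split; first by apply: divr_gt0; lra.
        by rewrite ltr_pdivrMr//; lra.
      have ab' : b - a < 0 by rewrite subr_lt0.
      by rewrite ltr_ndivrMr// ltr_ndivlMr//; apply/andP; split; lra.
    exists ((1 - t) *: v i 0%N + t *: v i 1%N).
      exists (fun i => if i is 0%N then 1 - t else t); split.
        by case=> [|i'] _ //; rewrite subr_gt0.
      by rewrite !big_ord_recl !big_ord0 /= !addr0 subrK.
    rewrite !mxE -/a -/b; have -> : (1 - t) * a + t * b = a + t * (b - a) by ring.
    by rewrite tE addrC subrK.
  apply: (@segment_packing R I Q (fun i => v i 0%N ord0 k) (fun i => v i 1%N ord0 k) (A k)) => //.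
    by move=> i Qi; split; exact: inbox.
  move=> i i' x Qi Qi' xi xi'.
  have [y yi yx] := seg i x Qi xi; have [y' yi' yx'] := seg i' x Qi' xi'.
  by apply: (key i i' y y') => // b; rewrite (_ : b = ord0) -/k ?yx ?yx'//; exact: ord1.
under eq_bigr do rewrite minor2E.
set k1 := lift j ord0; set k2 := lift j (i1 0).
apply: (@triangle_packing R I Q _ _ _ (A k1) (A k2)) => //=.
- by move=> i Qi; split; exact: inbox.
- by move=> i Qi; split; exact: inbox.
have tri i z : otri (v i 0%N ord0 k1, v i 0%N ord0 k2) (v i 1%N ord0 k1, v i 1%N ord0 k2)
    (v i 2%N ord0 k1, v i 2%N ord0 k2) z ->
    exists2 y, osimplex 2 (v i) y & (y ord0 k1, y ord0 k2) = z.
  move=> [l0 [l1 [l2 [l00 l10 l20 ls ->]]]] /=.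
  exists (l0 *: v i 0%N + l1 *: v i 1%N + l2 *: v i 2%N); last by rewrite !mxE.
  exists (fun i => if i is i'.+1 then (if i' is 0%N then l1 else l2) else l0); split.
    by case=> [|[|i']].
  by rewrite !big_ord_recl !big_ord0 /= !addr0 !addrA.
move=> i i' z Qi Qi' /tri[y yi yz] /tri[y' yi' yz'].
apply: (key i i' y y') => // b; move: yz; rewrite -yz' => -[e1 e2].
case: (unliftP ord0 b) => [b' ->|-> //]; rewrite (_ : b' = ord0) //; exact: ord1.
Qed.

End Minors.

(** * Total face area and the inverse trace inequality *)

Section TraceInequality.
Variables (R : realType) (n : nat) (Om : set 'rV[R]_n.+1).
Local Notation d := n.+1.
Local Notation point := 'rV[R]_d.
Variables (Cr sigma Cq : R) (m : nat).
Hypotheses (n12 : (n = 1%N) \/ (n = 2%N)) (Cr0 : 0 < Cr) (poly : convex_polytope_domain Om).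

(** Its factors are the reference volume, the [d] projection directions, the at most [m * d.+1]
    facet hyperplanes, and the packing constant for boxes of side [2 * h]. *)
Definition area_const : R := refint n 1 (fun=> 1) * (d%:R * ((m * d.+1)%:R * (8 * 2 ^+ n))).

Lemma area_const_ge0 : 0 <= area_const.
Proof. by rewrite mulr_ge0// ltW// refint1_gt0. Qed.

(** Faces are grouped by the facet hyperplane that contains them. Only the number of groups enters,
    whatever the number of faces in each. *)
Lemma face_area (M : mesh R d) k : valid_mesh M Om -> regular_mesh M Cr sigma m Cq ->
  \sum_(f | touches k f) smeas n (fvert f) <= area_const * hel M k ^+ n.
Proof.
move=> valid reg.
pose T : finType := ('I_(size (subs k)) * 'I_d.+1)%type.
(* [None] is the label of faces that do not touch [k]; its group contributes nothing to the sum. *)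
have /choice[ie ieP] : forall f, exists ie : option T, touches k f -> exists2 ie', ie = Some ie' &
    forall a, (a <= n)%N -> bary (subsimp M k ie'.1) ie'.2 (fvert f a) = 0.
  move=> f; case: (boolP (touches k f)) => [tf|_]; last by exists None.
  have [ie' H] := boundary_simplex_hyperplane valid (face_boundary valid poly tf).
  by exists (Some ie') => _; exists ie'.
have h0 := hel_ge0 k.
have vert f a : touches k f -> (a <= n)%N -> cl_el M k (fvert f a).
  move=> tf an; have [] // : (cl_el M k `\` el M k) (fvert f a).
  apply: (face_boundary valid poly tf) => /=.
  exists (fun i => (i == a)%:R); split; first by move=> j _; rewrite ler0n.
  rewrite (bigD1 (Ordinal (an : (a < n.+1)%N)))//= eqxx big1; last first.
    by move=> i; rewrite -val_eqE/= => /negbTE ->.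
  rewrite addr0; split=> //.
  rewrite (bigD1 (Ordinal (an : (a < n.+1)%N)))//= eqxx big1 ?addr0 ?scale1r// => i.
  by rewrite -val_eqE/= => /negbTE ->; rewrite scale0r.
apply: (@le_trans _ _ (\sum_(f | touches k f) refint n 1 (fun=> 1) * \sum_j `|minor j (fvert f)|)).
  by apply: ler_sum => f _; exact: smeas_minor.
rewrite -mulr_sumr /area_const -mulrA; apply: ler_wpM2l; first exact/ltW/refint1_gt0.
rewrite exchange_big/= -mulrA.
have -> : d%:R * ((m * d.+1)%:R * (8 * 2 ^+ n) * hel M k ^+ n) =
    \sum_(j < d) ((m * d.+1)%:R * (8 * 2 ^+ n) * hel M k ^+ n) :> R.
  by rewrite sumr_const card_ord -[RHS]mulr_natl.
apply: ler_sum => j _.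
rewrite (partition_big ie predT)//=.
apply: (@le_trans _ _ (\sum_(o : option T) if o is Some _ then 8 * (2 * hel M k) ^+ n else 0)).
  apply: ler_sum => -[ie'|] _; last first.
    by rewrite big1// => f /andP[/ieP[ie' -> _]].
  have Eu := sub_edges_unit valid (ltn_ord ie'.1).
  pose s := subsimp M k ie'.1.
  pose nu := invmx (edges s) *m bcol R ie'.2.
  apply: (hyperplane_area j (nu := nu) (c := (s 0%N *m nu) ord0 ord0 - bcst R ie'.2)) => //.
  - apply/eqP => /(congr1 (mulmx (edges s))); rewrite mulKVmx// mulmx0 => /eqP.
    by rewrite (negbTE (bcol_neq0 R ie'.2 (ltn0Sn n))).
  - move=> f a /andP[tf /eqP ief] an; have [ie'' + /(_ a an)] := ieP f tf.
    rewrite ief => -[<-]; rewrite /bary -/s -/nu mulmxBl => /eqP.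
    by rewrite [X in X + _ == _]mxE [X in _ + X + _ == _]mxE -addrA addr_eq0 opprD opprK => /eqP.
  - by move=> f g fg; case: valid => _ [_ [_ [_ [_ [_ [+ _]]]]]]; apply.
  - move=> f g a a' i /andP[tf _] /andP[tg _] an a'n.
    by apply: (cl_el_coord valid); exact: vert.
rewrite (bigD1 None)//= add0r.
apply: (@le_trans _ _ (\sum_(i : T) 8 * (2 * hel M k) ^+ n)).
  rewrite (reindex_omap Some id) => [|[]]//=; rewrite le_eqVlt; apply/orP; left; apply/eqP.
  by apply: eq_bigl => i; rewrite eqxx.
rewrite sumr_const card_prod !card_ord -[_ *+ _]mulr_natl exprMn !mulrA.
apply: ler_wpM2r; first by rewrite exprn_ge0.
rewrite -!mulrA; apply: ler_wpM2r; first by rewrite mulr_ge0// exprn_ge0.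
rewrite ler_nat leq_mul2r; apply/orP; right.
by case: reg => _ [/(_ k)[]].
Qed.

(** The powers of [h] cancel: the supremum of [q ^+ 2] costs [h ^- d], the face area gives [h ^+ n]
    with [n = d - 1], and one more [h] stands in front. *)
Lemma polynomial_trace p : exists2 C : R, 0 < C &
  forall (M : mesh R d) k (q : point -> R), valid_mesh M Om -> regular_mesh M Cr sigma m Cq ->
  is_poly p q ->
  hel M k * \sum_(f | touches k f) fint M f (fun x => q x * q x) <=
  C * \sum_(s <- subs k) sint d s (fun x => q x * q x).
Proof.
have [C0 C00 C0P] := sint_point_bound R d p.
(* A subsimplex has at least [Cr] times the volume of its element, itself at least [Cr * h ^+ d],
   hence the square. Adding [1] to the nonnegative [area_const] makes the constant positive. *)
exists ((area_const + 1) * (C0 / Cr ^+ 2)) => [|M k q valid reg pq].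
  by rewrite mulr_gt0 ?divr_gt0 ?exprn_gt0// ltr_wpDl// area_const_ge0.
have h0 : 0 < hel M k by apply: (hel_gt0 valid _ _ reg) => //; case: poly.
have pq2 : is_pol (fun x => q x * q x) by apply: is_polM; exact: is_pol_poly pq.
set Q := \sum_(s <- subs k) _.
have Q_ge s : 0 <= sint d s (fun x => q x * q x).
  by apply: sint_ge0 => // x _; exact: sqr_ge0.
have Q0 : 0 <= Q by apply: sumr_ge0.
have bound x : cl_el M k x -> q x ^+ 2 <= C0 / Cr ^+ 2 * Q / hel M k ^+ d.
  move=> [i /= ik xi].
  have sQ : sint d (subsimp M k i) (fun x => q x * q x) <= Q.
    by rewrite /Q (big_nth (fun=> 0)) big_mkord (bigD1 (Ordinal ik))//= lerDl sumr_ge0.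
  have sm : Cr ^+ 2 * hel M k ^+ d <= smeas d (subsimp M k i).
    have [/(_ k)[_ v1] [/(_ k)[_ /(_ i ik)[v2 _]] _]] := reg.
    by apply: le_trans v2; rewrite expr2 -mulrA ler_pM2l.
  have H : q x ^+ 2 * (Cr ^+ 2 * hel M k ^+ d) <= C0 * Q.
    apply: le_trans (ler_wpM2l (sqr_ge0 _) sm) _; apply: le_trans (C0P q _ _ pq xi) _.
    by apply: ler_wpM2l; [exact: ltW|exact: sQ].
  have -> : C0 / Cr ^+ 2 * Q / hel M k ^+ d = C0 * Q / (Cr ^+ 2 * hel M k ^+ d).
    by field; rewrite !gt_eqF// exprn_gt0.
  by rewrite ler_pdivlMr// mulr_gt0// exprn_gt0.
have fb f : touches k f -> fint M f (fun x => q x * q x) <=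
    smeas n (fvert f) * (C0 / Cr ^+ 2 * Q / hel M k ^+ d).
  move=> tf; rewrite mulrC /smeas -sintZ; last exact: is_pol_cst.
  apply: sint_le => //; first by apply: is_polZ; exact: is_pol_cst.
  move=> x xf; rewrite mulr1 -expr2; apply: bound.
  by have [] := face_boundary valid poly tf xf.
apply: (@le_trans _ _ (hel M k * ((area_const * hel M k ^+ n) * (C0 / Cr ^+ 2 * Q / hel M k ^+ d)))).
  rewrite ler_pM2l//.
  apply: (@le_trans _ _ (\sum_(f | touches k f) smeas n (fvert f) * (C0 / Cr ^+ 2 * Q / hel M k ^+ d))).
    exact: ler_sum.
  rewrite -mulr_suml; apply: ler_wpM2r; last exact: face_area.
  apply: divr_ge0; last exact/exprn_ge0/ltW.
  by apply: mulr_ge0 => //; apply: divr_ge0; [exact: ltW|exact/exprn_ge0/ltW].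
have -> : hel M k * (area_const * hel M k ^+ n * (C0 / Cr ^+ 2 * Q / hel M k ^+ d)) =
    area_const * (C0 / Cr ^+ 2) * Q.
  rewrite [hel M k ^+ d]exprS; field.
  by rewrite !gt_eqF// exprn_gt0.
apply: ler_wpM2r => //; apply: ler_wpM2r; last by rewrite lerDl.
by apply: divr_ge0; [exact: ltW|exact/exprn_ge0/ltW].
Qed.

End TraceInequality.

(** * The discontinuous Galerkin form *)

Section DotProduct.
Variables (R : realType) (d : nat).
Local Notation point := 'rV[R]_d.
Implicit Types (x y z : point).

Lemma dotpC x y : dotp x y = dotp y x.
Proof. by apply: eq_bigr => i _; rewrite mulrC. Qed.

Lemma dotpDl x y z : dotp (x + y) z = dotp x z + dotp y z.
Proof. by rewrite -big_split/=; apply: eq_bigr => i _; rewrite mxE mulrDl. Qed.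

Lemma dotpZl (k : R) x y : dotp (k *: x) y = k * dotp x y.
Proof. by rewrite /dotp mulr_sumr; apply: eq_bigr => i _; rewrite mxE mulrA. Qed.

Lemma dotpDr x y z : dotp z (x + y) = dotp z x + dotp z y.
Proof. by rewrite dotpC dotpDl !(dotpC z). Qed.

Lemma dotpZr (k : R) x y : dotp y (k *: x) = k * dotp y x.
Proof. by rewrite dotpC dotpZl dotpC. Qed.

Lemma dotp_ge0 x : 0 <= dotp x x.
Proof. by apply: sumr_ge0 => i _; exact: sqr_ge0. Qed.

Lemma dotp_young (k : R) x y : 0 < k -> 2 * dotp x y <= k * dotp x x + k^-1 * dotp y y.
Proof.
move=> k0; have := dotp_ge0 (k *: x - y).
rewrite -scaleN1r !(dotpDl, dotpDr, dotpZl, dotpZr) (dotpC y x) => H.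
rewrite -(ler_pM2l k0); apply: (@le_trans _ _ (k * (k * dotp x x) + dotp y y)); first by lra.
by rewrite mulrDr mulVKf ?gt_eqF.
Qed.

Lemma dotp_half_sum x y : dotp (2^-1 *: (x + y)) (2^-1 *: (x + y)) <= (dotp x x + dotp y y) / 2.
Proof.
have := dotp_ge0 (x - y).
rewrite -scaleN1r !(dotpDl, dotpDr, dotpZl, dotpZr) (dotpC y x); lra.
Qed.

Definition is_polv (h : point -> point) := forall i, is_pol (fun x => h x ord0 i).

Lemma is_pol_dotp (g h : point -> point) : is_polv g -> is_polv h -> is_pol (fun x => dotp (g x) (h x)).
Proof. by move=> pg ph; apply: is_pol_sum => i _; exact: is_polM. Qed.

Lemma is_polvZ (k : R) (h : point -> point) : is_polv h -> is_polv (fun x => k *: h x).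
Proof. by move=> ph i; under eq_fun do rewrite mxE; exact: is_polZ. Qed.

Lemma is_polvD (g h : point -> point) : is_polv g -> is_polv h -> is_polv (fun x => g x + h x).
Proof. by move=> pg ph i; under eq_fun do rewrite mxE; exact: is_polD. Qed.

Lemma is_polv_grad (f : point -> R) : is_pol f -> is_polv (grad f).
Proof. by move=> [p pf] i; exists p; exact: is_poly_grad. Qed.

Lemma grad_polD (f g : point -> R) x : is_pol f -> is_pol g ->
  grad (fun y => f y + g y) x = grad f x + grad g x.
Proof.
move=> [p pf] [q pg]; apply: (gradD (p := maxn p q)).
  by apply: is_poly_leq pf; exact: leq_maxl.
by apply: is_poly_leq pg; exact: leq_maxr.
Qed.

Lemma grad_polZ (f : point -> R) (k : R) x : is_pol f -> grad (fun y => k * f y) x = k *: grad f x.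
Proof. by move=> [p pf]; exact: gradZ pf. Qed.

End DotProduct.

Section Forms.
Variables (R : realType) (d : nat) (M : mesh R d).
Local Notation point := 'rV[R]_d.
Local Notation field := ('I_(nel M) -> point -> R).
Implicit Types (u v w : field).

Definition Vpol v := forall k, is_pol (v k).

Lemma Vh_Vpol p v : Vh M p v -> Vpol v.
Proof. by move=> H k; exists p. Qed.

Lemma VpolD u v : Vpol u -> Vpol v -> Vpol (fun k x => u k x + v k x).
Proof. by move=> pu pv k; exact: is_polD. Qed.

Lemma VpolZ (a : R) u : Vpol u -> Vpol (fun k x => a * u k x).
Proof. by move=> pu k; exact: is_polZ. Qed.

Lemma VpolM u v : Vpol u -> Vpol v -> Vpol (fun k x => u k x * v k x).
Proof. by move=> pu pv k; exact: is_polM. Qed.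

Lemma jmpD f u v x : jmp M f (fun k x => u k x + v k x) x = jmp M f u x + jmp M f v x.
Proof. by rewrite /jmp; case: (fminus f) => [l|]; rewrite -scalerDl; congr (_ *: _); ring. Qed.

Lemma jmpZ f (a : R) u x : jmp M f (fun k x => a * u k x) x = a *: jmp M f u x.
Proof. by rewrite /jmp; case: (fminus f) => [l|]; rewrite scalerA; congr (_ *: _); ring. Qed.

Lemma avg_gradD f u v x : Vpol u -> Vpol v ->
  avg_grad M f (fun k x => u k x + v k x) x = avg_grad M f u x + avg_grad M f v x.
Proof.
move=> pu pv; rewrite /avg_grad; case: (fminus f) => [l|]; last by rewrite grad_polD.
by rewrite (grad_polD _ (pu _) (pv _)) (grad_polD _ (pu l) (pv l)) -scalerDr addrACA.
Qed.

Lemma avg_gradZ f (a : R) u x : Vpol u ->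
  avg_grad M f (fun k x => a * u k x) x = a *: avg_grad M f u x.
Proof.
move=> pu; rewrite /avg_grad; case: (fminus f) => [l|]; rewrite !grad_polZ//.
by rewrite -scalerDr !scalerA mulrC.
Qed.

Lemma is_polv_jmp f u : Vpol u -> is_polv (jmp M f u).
Proof.
move=> pu i; rewrite /jmp; case: (fminus f) => [l|]; under eq_fun do rewrite mxE mulrC.
  by apply: is_polZ; exact: is_polB.
exact: is_polZ.
Qed.

Lemma is_polv_avg f u : Vpol u -> is_polv (avg_grad M f u).
Proof.
move=> pu; rewrite /avg_grad; case: (fminus f) => [l|]; last exact: is_polv_grad.
by apply: is_polvZ; apply: is_polvD; exact: is_polv_grad.
Qed.

Lemma L2C u v : L2 M u v = L2 M v u.
Proof. by apply: eq_bigr => k _; apply: eq_bigr => s _; congr sint; apply/funext => x; rewrite mulrC. Qed.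

Lemma L2Dr u v w : Vpol u -> Vpol v -> Vpol w ->
  L2 M u (fun k x => v k x + w k x) = L2 M u v + L2 M u w.
Proof.
move=> pu pv pw; rewrite /L2 -big_split/=; apply: eq_bigr => k _; rewrite -big_split/=.
apply: eq_bigr => s _; rewrite -sintD; [|exact: is_polM..].
by congr sint; apply/funext => x; rewrite mulrDr.
Qed.

Lemma L2Zr (a : R) u v : Vpol u -> Vpol v -> L2 M u (fun k x => a * v k x) = a * L2 M u v.
Proof.
move=> pu pv; rewrite /L2 mulr_sumr; apply: eq_bigr => k _; rewrite mulr_sumr.
apply: eq_bigr => s _; rewrite -sintZ; last exact: is_polM.
by congr sint; apply/funext => x; rewrite mulrCA.
Qed.

Lemma L2_ge0 u v : Vpol u -> Vpol v -> (forall k x, cl_el M k x -> 0 <= u k x * v k x) -> 0 <= L2 M u v.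
Proof.
move=> pu pv uv; apply: sumr_ge0 => k _; rewrite (big_nth (fun=> 0)) big_mkord.
apply: sumr_ge0 => i _; apply: sint_ge0; first exact: is_polM.
by move=> x xi; apply: uv; exists (i : nat); first exact: ltn_ord.
Qed.

Lemma L2_le u v u' v' : Vpol u -> Vpol v -> Vpol u' -> Vpol v' ->
  (forall k x, cl_el M k x -> u k x * v k x <= u' k x * v' k x) -> L2 M u v <= L2 M u' v'.
Proof.
move=> pu pv pu' pv' uv; apply: ler_sum => k _; rewrite !(big_nth (fun=> 0)) !big_mkord.
apply: ler_sum => i _; apply: sint_le; [exact: is_polM..|].
by move=> x xi; apply: uv; exists (i : nat); first exact: ltn_ord.
Qed.

(** One subsimplex of positive measure in each element suffices, since a polynomial vanishing there
    vanishes everywhere. *)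
Lemma L2_definite Om p u : valid_mesh M Om -> (forall k : 'I_(nel M), subs k <> [::]) -> Vh M p u ->
  L2 M u u = 0 -> forall k x, u k x = 0.
Proof.
move=> valid sub0 pu H k x.
have ge0 k' (s : nat -> point) : 0 <= sint d s (fun x => u k' x * u k' x).
  by apply: sint_ge0 => [|y _]; [apply: is_polM; exact: is_pol_poly (pu k')|exact: sqr_ge0].
have /eqP := H; rewrite /L2 psumr_eq0; last by move=> k' _; apply: sumr_ge0 => s _.
move=> /allP/(_ k (mem_index_enum k))/= /eqP; rewrite (big_nth (fun=> 0)) big_mkord.
case E : (size (subs k)) => [|m]; first by have := sub0 k; move/size0nil : E.
have k0 : (0 < size (subs k))%N by rewrite E.
rewrite big_ord_recl => Hs.
have s0 : sint d (subsimp M k 0) (fun x => u k x * u k x) = 0.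
  apply/eqP; rewrite eq_le ge0 andbT -Hs lerDl; apply: sumr_ge0 => i _; exact: ge0.
apply: (sint_definite _ (pu k) s0).
by case: valid => _ [+ _]; apply.
Qed.

Lemma gradL2C u v : gradL2 M u v = gradL2 M v u.
Proof. by apply: eq_bigr => k _; apply: eq_bigr => s _; congr sint; apply/funext => x; rewrite dotpC. Qed.

Lemma gradL2Dr u v w : Vpol u -> Vpol v -> Vpol w ->
  gradL2 M u (fun k x => v k x + w k x) = gradL2 M u v + gradL2 M u w.
Proof.
move=> pu pv pw; rewrite /gradL2 -big_split/=; apply: eq_bigr => k _; rewrite -big_split/=.
apply: eq_bigr => s _; rewrite -sintD; [|by apply: is_pol_dotp; exact: is_polv_grad..].
by congr sint; apply/funext => x; rewrite grad_polD// dotpDr.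
Qed.

Lemma gradL2Zr (a : R) u v : Vpol u -> Vpol v -> gradL2 M u (fun k x => a * v k x) = a * gradL2 M u v.
Proof.
move=> pu pv; rewrite /gradL2 mulr_sumr; apply: eq_bigr => k _; rewrite mulr_sumr.
apply: eq_bigr => s _; rewrite -sintZ; last by apply: is_pol_dotp; exact: is_polv_grad.
by congr sint; apply/funext => x; rewrite grad_polZ// dotpZr.
Qed.

Variables (c beta : R) (p : nat).

Lemma ahC u v : ah M c beta p u v = ah M c beta p v u.
Proof.
have alg (g x y j x' y' j' : R) : x = y' -> y = x' -> j = j' -> g - x - y + j = g - x' - y' + j'.
  by move=> -> -> ->; rewrite [g - _ - _]addrAC.
by rewrite /ah gradL2C; apply: alg; apply: eq_bigr => f _; congr fint; apply/funext => x; rewrite dotpC.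
Qed.

Lemma ahDr u v w : Vpol u -> Vpol v -> Vpol w ->
  ah M c beta p u (fun k x => v k x + w k x) = ah M c beta p u v + ah M c beta p u w.
Proof.
move=> pu pv pw; rewrite /ah gradL2Dr//.
have E1 : \sum_(f < nfc M) fint M f (fun x => dotp (c ^+ 2 *: avg_grad M f u x)
      (jmp M f (fun k x => v k x + w k x) x)) =
    \sum_(f < nfc M) fint M f (fun x => dotp (c ^+ 2 *: avg_grad M f u x) (jmp M f v x)) +
    \sum_(f < nfc M) fint M f (fun x => dotp (c ^+ 2 *: avg_grad M f u x) (jmp M f w x)).
  rewrite -big_split/=; apply: eq_bigr => f _; rewrite /fint -sintD; last 2 first.
  - by apply: is_pol_dotp; [apply: is_polvZ; exact: is_polv_avg|exact: is_polv_jmp].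
  - by apply: is_pol_dotp; [apply: is_polvZ; exact: is_polv_avg|exact: is_polv_jmp].
  by congr sint; apply/funext => x; rewrite jmpD dotpDr.
have E2 : \sum_(f < nfc M) fint M f (fun x => dotp (jmp M f u x)
      (c ^+ 2 *: avg_grad M f (fun k x => v k x + w k x) x)) =
    \sum_(f < nfc M) fint M f (fun x => dotp (jmp M f u x) (c ^+ 2 *: avg_grad M f v x)) +
    \sum_(f < nfc M) fint M f (fun x => dotp (jmp M f u x) (c ^+ 2 *: avg_grad M f w x)).
  rewrite -big_split/=; apply: eq_bigr => f _; rewrite /fint -sintD; last 2 first.
  - by apply: is_pol_dotp; [exact: is_polv_jmp|apply: is_polvZ; exact: is_polv_avg].
  - by apply: is_pol_dotp; [exact: is_polv_jmp|apply: is_polvZ; exact: is_polv_avg].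
  by congr sint; apply/funext => x; rewrite avg_gradD// scalerDr dotpDr.
have E3 : \sum_(f < nfc M) fint M f (fun x => chi M c beta p f * dotp (jmp M f u x)
      (jmp M f (fun k x => v k x + w k x) x)) =
    \sum_(f < nfc M) fint M f (fun x => chi M c beta p f * dotp (jmp M f u x) (jmp M f v x)) +
    \sum_(f < nfc M) fint M f (fun x => chi M c beta p f * dotp (jmp M f u x) (jmp M f w x)).
  rewrite -big_split/=; apply: eq_bigr => f _; rewrite /fint -sintD; last 2 first.
  - by apply: is_polZ; apply: is_pol_dotp; exact: is_polv_jmp.
  - by apply: is_polZ; apply: is_pol_dotp; exact: is_polv_jmp.
  by congr sint; apply/funext => x; rewrite jmpD dotpDr mulrDr.
have alg (g g' x x' y y' z z' : R) :
  g + g' - (x + x') - (y + y') + (z + z') = g - x - y + z + (g' - x' - y' + z') by ring.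
by rewrite E1 E2 E3 mulrDr alg.
Qed.

Lemma ahZr (a : R) u v : Vpol u -> Vpol v ->
  ah M c beta p u (fun k x => a * v k x) = a * ah M c beta p u v.
Proof.
move=> pu pv; rewrite /ah gradL2Zr//.
have E1 : \sum_(f < nfc M) fint M f (fun x => dotp (c ^+ 2 *: avg_grad M f u x)
      (jmp M f (fun k x => a * v k x) x)) =
    a * \sum_(f < nfc M) fint M f (fun x => dotp (c ^+ 2 *: avg_grad M f u x) (jmp M f v x)).
  rewrite mulr_sumr; apply: eq_bigr => f _; rewrite /fint -sintZ; last first.
    by apply: is_pol_dotp; [apply: is_polvZ; exact: is_polv_avg|exact: is_polv_jmp].
  by congr sint; apply/funext => x; rewrite jmpZ dotpZr.
have E2 : \sum_(f < nfc M) fint M f (fun x => dotp (jmp M f u x)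
      (c ^+ 2 *: avg_grad M f (fun k x => a * v k x) x)) =
    a * \sum_(f < nfc M) fint M f (fun x => dotp (jmp M f u x) (c ^+ 2 *: avg_grad M f v x)).
  rewrite mulr_sumr; apply: eq_bigr => f _; rewrite /fint -sintZ; last first.
    by apply: is_pol_dotp; [exact: is_polv_jmp|apply: is_polvZ; exact: is_polv_avg].
  by congr sint; apply/funext => x; rewrite avg_gradZ// !dotpZr mulrCA.
have E3 : \sum_(f < nfc M) fint M f (fun x => chi M c beta p f * dotp (jmp M f u x)
      (jmp M f (fun k x => a * v k x) x)) =
    a * \sum_(f < nfc M) fint M f (fun x => chi M c beta p f * dotp (jmp M f u x) (jmp M f v x)).
  rewrite mulr_sumr; apply: eq_bigr => f _; rewrite /fint -sintZ; last first.
    by apply: is_polZ; apply: is_pol_dotp; exact: is_polv_jmp.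
  by congr sint; apply/funext => x; rewrite jmpZ dotpZr mulrCA.
by rewrite E1 E2 E3 mulrCA !(mulrDr, mulrN).
Qed.

Lemma Vpol_sum (I : Type) (r : seq I) (a : I -> R) (u : I -> field) : (forall i, Vpol (u i)) ->
  Vpol (fun k x => \sum_(i <- r) a i * u i k x).
Proof. by move=> pu k; apply: is_pol_sum => i _; apply: is_polZ; exact: pu. Qed.

Lemma ah_sumr (I : Type) (r : seq I) (a : I -> R) (u : I -> field) v : (forall i, Vpol (u i)) -> Vpol v ->
  ah M c beta p v (fun k x => \sum_(i <- r) a i * u i k x) = \sum_(i <- r) a i * ah M c beta p v (u i).
Proof.
move=> pu pv; elim: r => [|i r IH].
  rewrite big_nil (_ : (fun k => _) = fun k x => 0 * v k x); first by rewrite ahZr// mul0r.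
  by apply/funext => k; apply/funext => x; rewrite big_nil mul0r.
rewrite big_cons -IH -ahZr// -ahDr//; [|exact: VpolZ|exact: Vpol_sum].
by congr ah; apply/funext => k; apply/funext => x; rewrite big_cons.
Qed.

Lemma L2_sumr (I : Type) (r : seq I) (a : I -> R) (u : I -> field) v : (forall i, Vpol (u i)) -> Vpol v ->
  L2 M v (fun k x => \sum_(i <- r) a i * u i k x) = \sum_(i <- r) a i * L2 M v (u i).
Proof.
move=> pu pv; elim: r => [|i r IH].
  rewrite big_nil (_ : (fun k => _) = fun k x => 0 * v k x); first by rewrite L2Zr// mul0r.
  by apply/funext => k; apply/funext => x; rewrite big_nil mul0r.
rewrite big_cons -IH -L2Zr// -L2Dr//; [|exact: VpolZ|exact: Vpol_sum].
by congr L2; apply/funext => k; apply/funext => x; rewrite big_cons.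
Qed.

(** The squared DG norm, that is, the last two terms of the discrete energy. *)
Definition dg_norm v : R :=
  c ^+ 2 * gradL2 M v v +
  \sum_(f < nfc M) fint M f (fun x => chi M c beta p f * dotp (jmp M f v x) (jmp M f v x)).

End Forms.

(** * Coercivity and boundedness of the bilinear form *)

Section Coercivity.
Variables (R : realType) (n : nat) (Om : set 'rV[R]_n.+1).
Local Notation d := n.+1.
Local Notation point := 'rV[R]_d.
Variables (Cr sigma Cq : R) (m : nat).
Hypotheses (n12 : (n = 1%N) \/ (n = 2%N)) (Cr0 : 0 < Cr) (poly : convex_polytope_domain Om).

Lemma gradient_trace p : exists2 C : R, 0 < C &
  forall (M : mesh R d) k (v : point -> R), valid_mesh M Om -> regular_mesh M Cr sigma m Cq ->
  is_poly p v ->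
  hel M k * \sum_(f | touches k f) fint M f (fun x => dotp (grad v x) (grad v x)) <=
  C * \sum_(s <- subs k) sint d s (fun x => dotp (grad v x) (grad v x)).
Proof.
have [C C0 CP] := polynomial_trace sigma Cq m n12 Cr0 poly p.
exists C => // M k v valid reg pv.
have pg i : is_pol (fun x => grad v x ord0 i * grad v x ord0 i).
  by apply: is_polM; apply: is_pol_poly; exact: is_poly_grad pv.
under eq_bigr => f _ do rewrite /fint /dotp sint_sum//.
under [X in _ <= C * X]eq_bigr => s _ do rewrite /dotp sint_sum//.
rewrite exchange_big/= [X in _ <= C * X]exchange_big/= !mulr_sumr.
apply: ler_sum => i _; apply: CP => //; exact: is_poly_grad.
Qed.

(** The maximum in [chi] makes the bound hold for both neighbours of a face; [p >= 1] lets the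
    factor [p ^ 2] be dropped. *)
Lemma chi_touches (M : mesh R d) (c beta : R) p k f : 0 < beta -> (1 <= p)%N -> 0 < c ->
  0 < hel M k -> touches k f -> c ^+ 2 * beta / hel M k <= chi M c beta p f.
Proof.
move=> b0 p1 c0 h0 tf.
have b1 : 0 <= c ^+ 2 * beta by apply: mulr_ge0; [exact/exprn_ge0/ltW|exact: ltW].
have pk : (hel M k)^-1 <= p%:R ^+ 2 / hel M k.
  by apply: ler_peMl; [rewrite invr_ge0 ltW|rewrite exprn_ege1// ler1n].
rewrite /chi; case E : (fminus f) => [l|].
  apply: ler_wpM2l => //; rewrite le_max; move/orP : tf => [/eqP ->|]; first by rewrite pk.
  by rewrite E => /eqP[->]; rewrite pk orbT.
apply: ler_wpM2l => //; move/orP : tf => [/eqP ->|]; first exact: pk.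
by rewrite E.
Qed.

(** The two consistency terms coincide on the diagonal. By Young's inequality their sum is bounded
    by half of the penalty term plus a multiple of the averaged gradients on the faces, which the
    trace inequality bounds by half of the gradient term. *)
Lemma ah_coercive p : (1 <= p)%N -> exists2 beta0 : R, 0 < beta0 &
  forall beta (M : mesh R d) c (v : 'I_(nel M) -> point -> R), beta0 <= beta ->
  valid_mesh M Om -> regular_mesh M Cr sigma m Cq -> 0 < c -> Vh M p v ->
  0 <= dg_norm c beta p v /\
  dg_norm c beta p v <= 2 * ah M c beta p v v /\ ah M c beta p v v <= 2 * dg_norm c beta p v.
Proof.
move=> p1; have [C C0 CP] := gradient_trace p.
(* The averaged gradients contribute at most [2 * c ^+ 2 * C / beta] times the squared gradient
   norm, and this is [c ^+ 2 / 2] when [beta = 4 * C]. *)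
exists (4 * C) => [|beta M c v bC valid reg c0 pv]; first by rewrite mulr_gt0.
have b0 : 0 < beta by apply: lt_le_trans bC; rewrite mulr_gt0.
have hk k : 0 < hel M k by apply: (hel_gt0 valid _ _ reg) => //; case: poly.
have Vv := Vh_Vpol pv.
have pj f := is_polv_jmp f Vv; have pa f := is_polv_avg f Vv.
have pgv k : is_polv (grad (v k)) by exact: is_polv_grad.
have c2 : 0 < c ^+ 2 by rewrite exprn_gt0.
pose J f := fint M f (fun x => chi M c beta p f * dotp (jmp M f v x) (jmp M f v x)).
pose X f := fint M f (fun x => dotp (c ^+ 2 *: avg_grad M f v x) (jmp M f v x)).
pose A f := fint M f (fun x => dotp (avg_grad M f v x) (avg_grad M f v x)).
pose G k f := fint M f (fun x => dotp (grad (v k) x) (grad (v k) x)).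
have chi0 f : 0 < chi M c beta p f.
  apply: lt_le_trans (chi_touches b0 p1 c0 (hk (fplus f)) _); last by rewrite /touches eqxx.
  by rewrite divr_gt0// mulr_gt0.
have J0 f : 0 <= J f.
  apply: sint_ge0 => [|x _]; first by apply: is_polZ; exact: is_pol_dotp.
  by rewrite mulr_ge0 ?dotp_ge0// ltW.
have G0 k f : 0 <= G k f.
  by apply: sint_ge0 => [|x _]; [exact: is_pol_dotp|exact: dotp_ge0].
(* The sign [e] is [1] for the lower and [-1] for the upper bound on [ah]. *)
have young f e : e ^+ 2 = 1 -> 2 * (e * X f) <= J f / 2 + 2 * c ^+ 4 / chi M c beta p f * A f.
  move=> e1; rewrite /X /fint -[e * _]sintZ; last by apply: is_pol_dotp => //; exact: is_polvZ.
  rewrite -sintZ; last by apply: is_polZ; apply: is_pol_dotp => //; exact: is_polvZ.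
  rewrite /J /A /fint [X in X + _]mulrC -!sintZ; [|exact: is_pol_dotp|by apply: is_polZ; exact: is_pol_dotp].
  rewrite -sintD; last 2 first.
  - by apply: is_polZ; apply: is_polZ; exact: is_pol_dotp.
  - by apply: is_polZ; exact: is_pol_dotp.
  apply: sint_le => [||x _].
  - by apply: is_polZ; apply: is_polZ; apply: is_pol_dotp => //; exact: is_polvZ.
  - by apply: is_polD; do ?apply: is_polZ; exact: is_pol_dotp.
  have k0 : 0 < 2 / chi M c beta p f by rewrite divr_gt0.
  have := dotp_young (e *: (c ^+ 2 *: avg_grad M f v x)) (jmp M f v x) k0.
  rewrite !dotpZl !dotpZr invf_div.
  set a := dotp _ (jmp _ _ _ _); set q := dotp (avg_grad _ _ _ _) _; set j := dotp (jmp _ _ _ _) _.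
  move=> H; apply: le_trans H _; rewrite le_eqVlt; apply/orP; left; apply/eqP.
  have -> : 2 / chi M c beta p f * (e * (c ^+ 2 * (e * (c ^+ 2 * q)))) =
     2 / chi M c beta p f * (e ^+ 2 * (c ^+ 4 * q)) by ring.
  by rewrite e1; field; rewrite gt_eqF.
have avgG f : 2 * c ^+ 4 / chi M c beta p f * A f <=
    2 * c ^+ 2 / beta * \sum_(k | touches k f) hel M k * G k f.
  have ck k : touches k f -> c ^+ 4 / chi M c beta p f <= c ^+ 2 / beta * hel M k.
    move=> tk; have := chi_touches b0 p1 c0 (hk k) tk.
    rewrite ler_pdivrMr// => H; rewrite ler_pdivrMr//.
    have -> : c ^+ 4 = c ^+ 2 / beta * (c ^+ 2 * beta) by field; rewrite gt_eqF.
    by rewrite -[leRHS]mulrA; apply: ler_wpM2l; [apply: divr_ge0; exact: ltW|rewrite [leRHS]mulrC].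
  have ckG k : touches k f -> c ^+ 4 / chi M c beta p f * G k f <= c ^+ 2 / beta * (hel M k * G k f).
    by move=> tk; have := ler_wpM2r (G0 k f) (ck k tk); rewrite -[leRHS]mulrA.
  have h0 k : 0 <= hel M k * G k f by rewrite mulr_ge0// ltW.
  have cb : 0 <= c ^+ 2 / beta by apply: divr_ge0; exact: ltW.
  case E : (fminus f) => [l|].
    have lf : l != fplus f.
      by case: valid => _ [_ [_ [_ [_ [_ [_ [_ [/(_ f) + _]]]]]]]]; rewrite E => -[/eqP].
    have A_le : A f <= (G (fplus f) f + G l f) / 2.
      rewrite /A /G /fint mulrC -sintD; [|exact: is_pol_dotp..].
      rewrite -sintZ; last by apply: is_polD; exact: is_pol_dotp.
      apply: sint_le => [||x _]; first exact: is_pol_dotp.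
        by apply: is_polZ; apply: is_polD; exact: is_pol_dotp.
      by rewrite /avg_grad E [2^-1 * _]mulrC; exact: dotp_half_sum.
    have t1 : touches (fplus f) f by rewrite /touches eqxx.
    have t2 : touches l f by rewrite /touches E eqxx orbT.
    have := ckG _ t1; have := ckG _ t2.
    rewrite (bigD1 (fplus f))//= (bigD1 l)//=; last by rewrite t2.
    set S := \sum_(_ | _) _ => ? ?.
    have S0 : 0 <= S by apply: sumr_ge0.
    have := mulr_ge0 cb S0; have := mulr_ge0 cb (h0 (fplus f)); have := mulr_ge0 cb (h0 l).
    have : c ^+ 4 / chi M c beta p f * A f <= c ^+ 4 / chi M c beta p f * ((G (fplus f) f + G l f) / 2).
      by apply: ler_wpM2l => //; apply: divr_ge0; [exact/exprn_ge0/ltW|exact: ltW].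
    have -> : 2 * c ^+ 4 / chi M c beta p f = 2 * (c ^+ 4 / chi M c beta p f) by rewrite mulrA.
    have -> : 2 * c ^+ 2 / beta = 2 * (c ^+ 2 / beta) by rewrite mulrA.
    lra.
  have t1 : touches (fplus f) f by rewrite /touches eqxx.
  have := ckG _ t1; rewrite (bigD1 (fplus f))//=.
  set S := \sum_(_ | _) _ => ?.
  have S0 : 0 <= S by apply: sumr_ge0.
  have := mulr_ge0 cb S0.
  have -> : A f = G (fplus f) f by rewrite /A /G /avg_grad E.
  have -> : 2 * c ^+ 4 / chi M c beta p f = 2 * (c ^+ 4 / chi M c beta p f) by rewrite mulrA.
  have -> : 2 * c ^+ 2 / beta = 2 * (c ^+ 2 / beta) by rewrite mulrA.
  lra.
(* Exchanging the sums collects, for each element, all its faces at once, so that the trace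
   inequality applies with a constant independent of their number. *)
have total : \sum_f \sum_(k | touches k f) hel M k * G k f <= C * gradL2 M v v.
  rewrite (exchange_big_dep predT)//= /gradL2 mulr_sumr.
  apply: ler_sum => k _; rewrite -mulr_sumr; exact: CP.
have gL0 : 0 <= gradL2 M v v.
  apply: sumr_ge0 => k _; apply: sumr_ge0 => s _.
  by apply: sint_ge0 => [|x _]; [exact: is_pol_dotp|exact: dotp_ge0].
have cross e : e ^+ 2 = 1 -> 2 * (e * \sum_f X f) <= (\sum_f J f) / 2 + c ^+ 2 / 2 * gradL2 M v v.
  move=> e1; rewrite [e * _]mulr_sumr [2 * _]mulr_sumr [_ / 2 in X in X + _]mulr_suml.
  apply: (@le_trans _ _ (\sum_f (J f / 2 + 2 * c ^+ 2 / beta * \sum_(k | touches k f) hel M k * G k f))).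
    by apply: ler_sum => f _; apply: le_trans (young f e e1) _; rewrite lerD2l.
  rewrite big_split/= lerD2l -mulr_sumr.
  apply: (@le_trans _ _ (2 * c ^+ 2 / beta * (C * gradL2 M v v))).
    by apply: ler_wpM2l => //; apply: divr_ge0; [apply: mulr_ge0 => //; exact: ltW|exact: ltW].
  rewrite [leLHS]mulrA; apply: ler_wpM2r => //.
  have -> : 2 * c ^+ 2 / beta * C = c ^+ 2 / 2 * (4 * C / beta) by field; rewrite gt_eqF.
  by apply: ler_piMr; [apply: divr_ge0 => //; exact: ltW|rewrite ler_pdivrMr// mul1r].
have SJ : 0 <= \sum_f J f by apply: sumr_ge0.
have cg : 0 <= c ^+ 2 * gradL2 M v v by rewrite mulr_ge0// ltW.
have ahE : ah M c beta p v v = c ^+ 2 * gradL2 M v v - 2 * \sum_f X f + \sum_f J f.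
  rewrite /ah -/(J _); have -> : \sum_(f < nfc M) fint M f (fun x => dotp (jmp M f v x) (c ^+ 2 *: avg_grad M f v x)) = \sum_f X f.
    by apply: eq_bigr => f _; congr fint; apply/funext => x; rewrite dotpC.
  by rewrite -/(X _) mulr2n mulrDl mul1r opprD addrA.
have := cross 1 (expr1n _ _); have := cross (-1) ltac:(by rewrite sqrrN expr1n).
rewrite /dg_norm ahE -/(J _) => H1 H2; split; last split; lra.
Qed.

End Coercivity.

(** * The energy method in time *)

Section LowerIntegral.
Variable R : realType.

(* log_rate below is not known to be measurable, so ge0_le_integral does not apply to it. *)
Lemma integral_monotone (D : set R) (f g : R -> R) :
  (forall t, D t -> 0 <= f t) -> (forall t, D t -> f t <= g t) ->
  (\int[lebesgue_measure]_(t in D) (f t)%:E <= \int[lebesgue_measure]_(t in D) (g t)%:E)%E.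
Proof.
move=> f0 fg.
rewrite !ge0_integralE; last 2 first.
- by move=> t Dt; rewrite lee_fin (le_trans (f0 t Dt) (fg t Dt)).
- by move=> t Dt; rewrite lee_fin f0.
apply: ereal_sup_le => _ [h hf <-]; exists h => // t.
apply: le_trans (hf t) _; rewrite /patch; case: ifPn => // /set_mem Dt.
by rewrite lee_fin fg.
Qed.

(** No regularity of [g] is assumed beyond its sign. A continuous minorant of [g] built from [f] is
    integrated instead, and its integral is at most [gamma]. *)
Lemma primitive_growth (T K gamma : R) (F f g : R -> R) : 0 <= T -> 0 <= K ->
  deriv_on 0 T F f -> cont_on 0 T f -> (forall t, 0 <= t <= T -> 0 <= g t) ->
  (forall t, 0 <= t <= T -> f t <= g t * K) ->
  (\int[lebesgue_measure]_(t in [set t : R | (0 <= t <= T)%R]) (g t)%:E <= gamma%:E)%E ->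
  forall t, 0 <= t <= T -> F t - F 0 <= gamma * K.
Proof.
move=> T0 K0 dF cf g0 fg gint t tT.
have [K0'|Kpos] := leP K 0.
  have KE : K = 0 by apply/eqP; rewrite eq_le K0 K0'.
  have := @deriv_on_le _ 0 T F f (fun=> F 0) (fun=> 0) dF (deriv_on_cst _ _ _).
  have h s : 0 < s < T -> f s <= 0.
    by move=> /andP[/ltW s0 /ltW sT]; have := fg s; rewrite KE mulr0 s0 sT; apply.
  by move=> /(_ h (lexx _) t tT); rewrite KE mulr0 subr_le0.
(* The positive part makes the primitive of [f1] nondecreasing, so its value at any time is bounded
   by its value at [T]. *)
pose f1 s := Num.max (f s) 0 / K.
have cf1 : cont_on 0 T f1.
  apply: (@eq_cont_on _ _ _ (fun s => (f s + `|f s|) * (2^-1 * K^-1))).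
    by move=> s _; rewrite /f1 maxr_absE subr0 addr0 -mulrA.
  apply: cont_onM; last exact: cont_on_cst.
  apply: cont_onD => //; apply/cont_onP => s sT; apply: cvg_norm.
  by move/cont_onP : cf; apply.
have f10 s : 0 <= f1 s by rewrite divr_ge0// ?le_max ?lexx ?orbT.
have f1f s : f s <= K * f1 s by rewrite /f1 mulrC divfK ?gt_eqF// le_max lexx.
have f1g s : 0 <= s <= T -> f1 s <= g s.
  by move=> sT; rewrite /f1 ler_pdivrMr// ge_max fg//= mulr_ge0// g0.
have [P [P0 dP]] := primitive T0 (cont_on_clamp T0 cf1).
have {}dP : deriv_on 0 T P f1.
  by apply: (eq_deriv_on _ _ dP) => // s sT; rewrite /= clamp_id.
have PT : P T <= gamma.
  have := Rintegral_deriv dP cf1 (t := T); rewrite T0 lexx P0 subr0 => /(_ isT) <-.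
  have i1 := cont_on_integrable cf1.
  have fi := integrable_fin_num (mu := @lebesgue_measure R) (D := [set t : R | 0 <= t <= T]) _ i1.
  rewrite -lee_fin /Rintegral fineK; last by apply: fi; rewrite set_cc.
  by apply: le_trans gint; apply: integral_monotone.
have := deriv_on_le dF (deriv_onD (deriv_on_cst 0 T (F 0)) (deriv_onZ (c := K) dP)).
have h s : 0 < s < T -> f s <= 0 + K * f1 s by move=> _; rewrite add0r.
have h0 : F 0 <= F 0 + K * P 0 by rewrite P0 mulr0 addr0.
move=> /(_ h h0 t tT) Ft.
have Pt : P t <= P T.
  by case/andP: tT => t0 tT; apply: (deriv_on_ndecr dP).
have := ler_wpM2l (ltW Kpos) (le_trans Pt PT); lra.
Qed.

Lemma sup_ge0 (A : set R) : (forall x, A x -> 0 <= x) -> 0 <= sup A.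
Proof.
(* [sup] has the default value [0] on a set that is empty or unbounded above. *)
move=> A0; have [[[x Ax] uA]|nA] := pselect (has_sup A); last by rewrite sup_out.
by apply: le_trans (A0 _ Ax) _; exact: ub_le_sup.
Qed.

End LowerIntegral.

Section PolynomialBounds.
Variables (R : realType) (d : nat).
Local Notation point := 'rV[R]_d.

Lemma is_poly_bounded p (f : point -> R) (K : R) : is_poly p f ->
  exists C : R, forall x : point, (forall i, `|x ord0 i| <= K) -> `|f x| <= C.
Proof.
move=> /is_polyE[c ->].
exists (\sum_(a : {ffun 'I_d -> 'I_p.+1} | (\sum_i a i <= p)%N) `|c a| * \prod_(i < d) K ^+ a i) => x xK.
apply: le_trans (ler_norm_sum _ _ _) _; apply: ler_sum => a _.
rewrite normrM; apply: ler_wpM2l => //; rewrite /monom normr_prod.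
apply: ler_prod => i _; rewrite normr_ge0 normrX/=.
by apply: lerXn2r => //; rewrite nnegrE// (le_trans _ (xK i)).
Qed.

Lemma closure_poly_le p (f g : point -> R) (A : set point) : is_poly p f -> is_poly p g ->
  (forall x, A x -> f x <= g x) -> forall x, closure A x -> f x <= g x.
Proof.
move=> pf pg fg x cx; rewrite -subr_ge0.
suff : closure A `<=` (fun x => g x - f x) @^-1` [set r | 0 <= r] by apply.
apply: closure_sub_closed => [|y Ay]; last by rewrite /= subr_ge0 fg.
apply: closed_comp; last exact: closed_ge.
by move=> y _; apply: is_poly_continuous; exact: is_polyB pg pf.
Qed.

End PolynomialBounds.

(** * Time derivatives of the discrete forms *)

Section TimeDerivatives.
Variables (R : realType) (d : nat) (M : mesh R d) (T : R).
Local Notation point := 'rV[R]_d.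
Local Notation field := ('I_(nel M) -> point -> R).

(** Pointwise differentiability is enough because the degree is the same at all times: integrals and
    gradients are fixed finite combinations of point values. *)
Definition smooth_in p (u u' : R -> field) : Prop :=
  (forall t, 0 <= t <= T -> Vh M p (u t) /\ Vh M p (u' t)) /\
  (forall k x, deriv_on 0 T (fun t => u t k x) (fun t => u' t k x)).

Definition smooth_vec p (A A' : R -> point -> point) : Prop :=
  (forall t i, 0 <= t <= T -> is_poly p (fun x => A t x ord0 i) /\ is_poly p (fun x => A' t x ord0 i)) /\
  (forall x i, deriv_on 0 T (fun t => A t x ord0 i) (fun t => A' t x ord0 i)).

(** Every term of [ah] is an integral of a dot product of two vector fields, once the coefficients
    are moved into one of them, so a single product rule serves them all. *)
Lemma sint_dotp_deriv p k v (A A' B B' : R -> point -> point) :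
  smooth_vec p A A' -> smooth_vec p B B' ->
  deriv_on 0 T (fun t => sint k v (fun x => dotp (A t x) (B t x)))
    (fun t => sint k v (fun x => dotp (A' t x) (B t x)) + sint k v (fun x => dotp (A t x) (B' t x))).
Proof.
move=> [pA dA] [pB dB].
have := @sint_deriv_on R d T (p + p) k v (fun t x => dotp (A t x) (B t x))
  (fun t x => dotp (A' t x) (B t x) + dotp (A t x) (B' t x)).
move=> H; apply: (eq_deriv_on _ _ (H _ _)) => //.
- move=> t tT; rewrite sintD//; apply: is_pol_dotp => i; exists p;
    by [case: (pA t i tT)|case: (pB t i tT)].
- move=> t tT; split; first by apply: is_poly_sum => i _; apply: is_polyM; [have [] := pA t i tT|have [] := pB t i tT].
  by apply: is_polyD; apply: is_poly_sum => i _; apply: is_polyM; have [? ?] := pA t i tT; have [] := pB t i tT.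
move=> x; rewrite /dotp.
apply: (eq_deriv_on _ _ (@deriv_on_sum R 0 T _ (index_enum _) xpredT _ _
  (fun i _ => deriv_onM (dA x i) (dB x i)))) => // t _.
by rewrite big_split.
Qed.

Variables (p : nat) (u u' w w' : R -> field).
Hypotheses (su : smooth_in p u u') (sw : smooth_in p w w').

Lemma smooth_grad k v v' : smooth_in p v v' ->
  smooth_vec p (fun t => grad (v t k)) (fun t => grad (v' t k)).
Proof.
move=> [pv dv]; split=> [t i tT|x i].
  by have [p1 p2] := pv t tT; split; apply: is_poly_grad.
by apply: (grad_deriv_on (p := p)) => [t tT|y]; [have [] := pv t tT|exact: dv].
Qed.

Lemma smooth_vecZ (a : R) A A' : smooth_vec p A A' ->
  smooth_vec p (fun t x => a *: A t x) (fun t x => a *: A' t x).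
Proof.
move=> [pA dA]; split=> [t i tT|x i].
  have [p1 p2] := pA t i tT.
  by split; under eq_fun do rewrite mxE; exact: is_polyZ.
by have := deriv_onZ (c := a) (dA x i); apply: eq_deriv_on => t _; rewrite mxE.
Qed.

Lemma smooth_vecD A A' B B' : smooth_vec p A A' -> smooth_vec p B B' ->
  smooth_vec p (fun t x => A t x + B t x) (fun t x => A' t x + B' t x).
Proof.
move=> [pA dA] [pB dB]; split=> [t i tT|x i].
  have [p1 p2] := pA t i tT; have [p3 p4] := pB t i tT.
  by split; under eq_fun do rewrite mxE; exact: is_polyD.
by have := deriv_onD (dA x i) (dB x i); apply: eq_deriv_on => t _; rewrite mxE.
Qed.

Lemma smooth_avg f v v' : smooth_in p v v' ->
  smooth_vec p (fun t => avg_grad M f (v t)) (fun t => avg_grad M f (v' t)).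
Proof.
move=> sv; rewrite /avg_grad; case: (fminus f) => [l|]; last exact: smooth_grad.
by apply: smooth_vecZ; apply: smooth_vecD; exact: smooth_grad.
Qed.

Lemma smooth_jmp f v v' : smooth_in p v v' ->
  smooth_vec p (fun t => jmp M f (v t)) (fun t => jmp M f (v' t)).
Proof.
move=> [pv dv]; rewrite /jmp; split=> [t i tT|x i].
  have [p1 p2] := pv t tT.
  by split; case: (fminus f) => [l|]; under eq_fun do rewrite mxE mulrC; apply: is_polyZ => //;
    apply: is_polyB.
case: (fminus f) => [l|].
  have := deriv_onZ (c := fnormal f ord0 i) (deriv_onD (dv (fplus f) x) (deriv_onZ (c := -1) (dv l x))).
  by apply: eq_deriv_on => t _; rewrite mxE mulN1r mulrC.
have := deriv_onZ (c := fnormal f ord0 i) (dv (fplus f) x).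
by apply: eq_deriv_on => t _; rewrite mxE mulrC.
Qed.

Variables (c beta : R) (q : nat).

Lemma ah_deriv : deriv_on 0 T (fun t => ah M c beta q (u t) (w t))
  (fun t => ah M c beta q (u' t) (w t) + ah M c beta q (u t) (w' t)).
Proof.
have dS := @deriv_on_sum R 0 T _ (index_enum _) xpredT.
have d1 := dS _ _ _ (fun (k : 'I_(nel M)) _ => @deriv_on_sum R 0 T _ (subs k) xpredT _ _
   (fun s _ => sint_dotp_deriv (k := d) (v := s) (smooth_grad k su) (smooth_grad k sw))).
have d2 := dS _ _ _ (fun (f : 'I_(nfc M)) _ => sint_dotp_deriv (k := d.-1) (v := fvert f)
   (smooth_vecZ (c ^+ 2) (smooth_avg f su)) (smooth_jmp f sw)).
have d3 := dS _ _ _ (fun (f : 'I_(nfc M)) _ => sint_dotp_deriv (k := d.-1) (v := fvert f)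
   (smooth_jmp f su) (smooth_vecZ (c ^+ 2) (smooth_avg f sw))).
have d4 := dS _ _ _ (fun (f : 'I_(nfc M)) _ => sint_dotp_deriv (k := d.-1) (v := fvert f)
   (smooth_vecZ (chi M c beta q f) (smooth_jmp f su)) (smooth_jmp f sw)).
have chiE v z t : \sum_(f < nfc M) fint M f (fun x => chi M c beta q f * dotp (jmp M f (v t) x) (jmp M f (z t) x)) =
   \sum_(f < nfc M) sint d.-1 (fvert f) (fun x => dotp (chi M c beta q f *: jmp M f (v t) x) (jmp M f (z t) x)).
  by apply: eq_bigr => f _; congr sint; apply/funext => x; rewrite dotpZl.
have := deriv_onD (deriv_onD (deriv_onD (deriv_onZ (c := c ^+ 2) d1) (deriv_onZ (c := -1) d2)) (deriv_onZ (c := -1) d3)) d4.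
apply: eq_deriv_on => t tT; first by rewrite /ah !mulN1r chiE.
rewrite /ah !chiE.
under eq_bigr do rewrite big_split/=.
rewrite !big_split/=.
have alg (c2 g g' x x' y y' z z' : R) : c2 * (g + g') + -1 * (x + x') + -1 * (y + y') + (z + z') =
  (c2 * g - x - y + z) + (c2 * g' - x' - y' + z') by ring.
exact: alg.
Qed.

End TimeDerivatives.

Section Energy.
Variables (R : realType) (d : nat) (M : mesh R d) (Om : set 'rV[R]_d) (T : R) (p : nat).
Local Notation point := 'rV[R]_d.
Local Notation field := ('I_(nel M) -> point -> R).
Variables (alpha alphad : R -> field).
Hypothesis (salpha : smooth_in T p alpha alphad).

Lemma L2_weighted_deriv (u u' : R -> field) : smooth_in T p u u' ->
  deriv_on 0 T (fun t => L2 M (fun k x => alpha t k x * u t k x) (u t))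
    (fun t => L2 M (fun k x => alphad t k x * u t k x) (u t) +
      2 * L2 M (fun k x => alpha t k x * u t k x) (u' t)).
Proof.
case: salpha => pal dal [pu du].
pose F k t x := alpha t k x * u t k x * u t k x.
pose G k t x := alphad t k x * u t k x * u t k x + 2 * (alpha t k x * u t k x * u' t k x).
have dF k s : deriv_on 0 T (fun t => sint d s (F k t)) (fun t => sint d s (G k t)).
  apply: (@sint_deriv_on R d T (p + p + p)).
    move=> t tT; have [a1 a2] := pal t tT; have [u1 u2] := pu t tT.
    split; first by do 2! apply: is_polyM => //.
    by apply: is_polyD; [|apply: is_polyZ]; do 2! apply: is_polyM => //.
  move=> x; have := deriv_onM (deriv_onM (dal k x) (du k x)) (du k x).
  by apply: eq_deriv_on => // t _; rewrite /G; ring.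
have := @deriv_on_sum R 0 T _ (index_enum 'I_(nel M)) xpredT _ _
  (fun k _ => @deriv_on_sum R 0 T _ (subs k) xpredT _ _ (fun s _ => dF k s)).
apply: eq_deriv_on => // t tT.
have [a1 a2] := pal t tT; have [u1 u2] := pu t tT.
have V1 := Vh_Vpol a1; have V2 := Vh_Vpol a2; have V3 := Vh_Vpol u1; have V4 := Vh_Vpol u2.
rewrite /L2 mulr_sumr -big_split/=; apply: eq_bigr => k _.
rewrite mulr_sumr -big_split/=; apply: eq_bigr => s _.
rewrite -sintZ; last by do 2! apply: is_polM => //.
by rewrite -sintD//; [|apply: is_polZ]; do 2! apply: is_polM => //.
Qed.

Lemma L2_weighted_cont (w : R -> field) (u : R -> field) :
  (forall t, 0 <= t <= T -> Vh M p (w t) /\ Vh M p (u t)) ->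
  (forall k x, cont_on 0 T (fun t => w t k x)) -> (forall k x, cont_on 0 T (fun t => u t k x)) ->
  cont_on 0 T (fun t => L2 M (fun k x => w t k x * u t k x) (u t)).
Proof.
move=> pw cw cu; apply: cont_on_sum => k _; apply: cont_on_sum => s _.
apply: (@sint_cont_on R d T (p + p + p)).
  by move=> t /pw[p1 p2]; do 2! apply: is_polyM => //.
by move=> x; do 2! apply: cont_onM => //.
Qed.

Variables (c b beta gamma alpha0 : R).
Hypotheses (valid : valid_mesh M Om) (T0 : 0 < T) (c0 : 0 < c) (b0 : 0 <= b)
  (gamma01 : 0 < gamma < 1) (alpha00 : 0 < alpha0).
Hypothesis calphad : forall k x, cont_on 0 T (fun t => alphad t k x).
Hypothesis alpha_ge : forall t k x, 0 <= t <= T -> cl_el M k x -> alpha0 <= alpha t k x.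

Definition log_rate (t : R) : R :=
  sup [set y : R | exists k x, el M k x /\ y = `|alphad t k x / alpha t k x|%R].

Hypothesis log_rate_int :
  (\int[lebesgue_measure]_(t in [set t : R | (0 <= t <= T)%R]) (log_rate t)%:E <= gamma%:E)%E.

Lemma log_rate_ge0 t : 0 <= log_rate t.
Proof. by apply: sup_ge0 => _ [k [x [_ ->]]]. Qed.

(** The supremum is genuine: [alphad] is bounded on the bounded elements and [alpha] is at least
    [alpha0]. It is taken over open elements, and polynomial inequalities extend to their
    closures. *)
Lemma alphad_le t k x : 0 <= t <= T -> cl_el M k x -> alphad t k x <= log_rate t * alpha t k x.
Proof.
move=> tT xk; have [pa pa'] := salpha.1 t tT.
apply: (closure_poly_le (pa' k) (is_polyZ (log_rate t) (pa k))); last exact: (cl_el_closure valid xk).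
move=> y yk; have ay : 0 < alpha t k y.
  by apply: lt_le_trans alpha00 _; exact: (alpha_ge tT (el_cl_el yk)).
rewrite -ler_pdivrMr//; apply: le_trans (ler_norm _) _.
apply: ub_le_sup; last by exists k, y.
have /choice[C CP] : forall k', exists C, forall x, cl_el M k' x -> `|alphad t k' x| <= C.
  move=> k'; have [K _ KP] := cl_el_bounded k'.
  have [C CP] := is_poly_bounded K (pa' k').
  by exists C => z zk; apply: CP => i; exact: KP.
exists ((\sum_k' `|C k'|) / alpha0) => _ [k' [z [zk ->]]].
have zk' := el_cl_el zk; have az := alpha_ge tT zk'.
have az0 : 0 < alpha t k' z by exact: lt_le_trans az.
rewrite normf_div (gtr0_norm az0) ler_pdivrMr//.
apply: (@le_trans _ _ (\sum_k' `|C k'|)).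
  apply: le_trans (CP _ _ zk') _; apply: le_trans (ler_norm _) _.
  by rewrite (bigD1 k')//= lerDl sumr_ge0.
rewrite -mulrA ler_peMr ?sumr_ge0//.
by rewrite mulrC ler_pdivlMr// mul1r.
Qed.

Hypothesis coercive : forall v, Vh M p v -> 0 <= dg_norm c beta p v /\
  dg_norm c beta p v <= 2 * ah M c beta p v v /\ ah M c beta p v v <= 2 * dg_norm c beta p v.

Lemma energy_estimate (psi psid psidd : R -> field) :
  (forall t, 0 <= t <= T -> [/\ Vh M p (psi t), Vh M p (psid t) & Vh M p (psidd t)]) ->
  (forall k x, deriv_on 0 T (fun t => psi t k x) (fun t => psid t k x) /\
     deriv_on 0 T (fun t => psid t k x) (fun t => psidd t k x) /\
     cont_on 0 T (fun t => psidd t k x)) ->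
  (forall t v, 0 < t <= T -> Vh M p v ->
     L2 M (fun k x => alpha t k x * psidd t k x) v +
     ah M c beta p (fun k x => psi t k x + b / c ^+ 2 * psid t k x) v = 0) ->
  let tpsi t := (fun k x => psi t k x + b / c ^+ 2 * psid t k x) in
  let energy t := L2 M (fun k x => alpha t k x * psid t k x) (psid t) +
    b / c ^+ 2 * Rintegral lebesgue_measure [set s | 0 <= s <= t]
        (fun s => L2 M (fun k x => alpha s k x * psidd s k x) (psidd s)) +
    dg_norm c beta p (tpsi t) in
  forall t, 0 <= t <= T -> energy t <= 4 / (1 - gamma) * energy 0.
Proof.
move=> pV dV eqn tpsi energy.
set bc := b / c ^+ 2 in eqn tpsi energy *.
have bc0 : 0 <= bc by rewrite divr_ge0// exprn_ge0// ltW.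
have [pal dal] := salpha.
have T0' := ltW T0.
pose tpsi' t := (fun k x => psid t k x + bc * psidd t k x) : field.
have s1 : smooth_in T p psid psidd.
  by split=> [t /pV[]//|k x]; have [_ []] := dV k x.
have tV t : 0 <= t <= T -> Vh M p (tpsi t) /\ Vh M p (tpsi' t).
  move=> /pV[p0 p1 p2]; split=> k; apply: is_polyD => //; exact: is_polyZ.
have s2 : smooth_in T p tpsi tpsi'.
  split=> [//|k x]; have [d0 [d1 _]] := dV k x.
  by apply: deriv_onD => //; exact: deriv_onZ.
pose X t := L2 M (fun k x => alpha t k x * psid t k x) (psid t).
pose A t := ah M c beta p (tpsi t) (tpsi t).
pose H t := L2 M (fun k x => alphad t k x * psid t k x) (psid t).
pose Q t := L2 M (fun k x => alpha t k x * psidd t k x) (psidd t).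
have dX := L2_weighted_deriv s1.
have dA := @ah_deriv R d M T p _ _ _ _ s2 s2 c beta p.
have cpd k x : cont_on 0 T (fun t => psid t k x) by have [_ [d1 _]] := dV k x; exact: deriv_on_cont d1.
have cpdd k x : cont_on 0 T (fun t => psidd t k x) by have [_ []] := dV k x.
have cal k x : cont_on 0 T (fun t => alpha t k x) by exact: deriv_on_cont (dal k x).
have cH : cont_on 0 T H.
  apply: L2_weighted_cont => // t tT; have [_ p1 _] := pV t tT.
  by split=> //; have [] := pal t tT.
have cQ : cont_on 0 T Q.
  apply: L2_weighted_cont => // t tT; have [_ _ p2] := pV t tT.
  by split=> //; have [] := pal t tT.
(* [D] represents the time integral of the dissipation in a form that can be differentiated. *)
have [D [D0 dD]] := primitive T0' (cont_on_clamp T0' cQ).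
have {}dD : deriv_on 0 T D Q.
  by apply: (eq_deriv_on _ _ dD) => // t tT; rewrite /= clamp_id.
have [P [P0 dP]] := primitive T0' (cont_on_clamp T0' cH).
have {}dP : deriv_on 0 T P H.
  by apply: (eq_deriv_on _ _ dP) => // t tT; rewrite /= clamp_id.
have alpha_gt0 t k x : 0 <= t <= T -> cl_el M k x -> 0 < alpha t k x.
  by move=> tT xk; apply: lt_le_trans alpha00 _; exact: alpha_ge.
have Vpsi t : 0 <= t <= T -> [/\ Vpol (alpha t), Vpol (alphad t), Vpol (psid t) & Vpol (psidd t)].
  move=> tT; have [p1 p2] := pal t tT; have [_ p3 p4] := pV t tT.
  by split; exact: Vh_Vpol.
have Q0 t : 0 <= t <= T -> 0 <= Q t.
  move=> tT; have [V1 V2 V3 V4] := Vpsi t tT.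
  apply: L2_ge0 => // [|k x xk]; first exact: VpolM.
  by rewrite -mulrA mulr_ge0 ?sqr_ge0// ltW// alpha_gt0.
have X0 t : 0 <= t <= T -> 0 <= X t.
  move=> tT; have [V1 V2 V3 V4] := Vpsi t tT.
  apply: L2_ge0 => // [|k x xk]; first exact: VpolM.
  by rewrite -mulrA mulr_ge0 ?sqr_ge0// ltW// alpha_gt0.
have HX t : 0 <= t <= T -> H t <= log_rate t * X t.
  move=> tT; have [V1 V2 V3 V4] := Vpsi t tT.
  rewrite /X -L2Zr//; last exact: VpolM.
  apply: L2_le => //; do ?[exact: VpolM|exact: VpolZ].
  move=> k x xk; have := ler_wpM2r (sqr_ge0 (psid t k x)) (alphad_le tT xk).
  by rewrite expr2 => h; apply: le_trans (le_trans _ h) _; rewrite le_eqVlt; apply/orP; left; apply/eqP; ring.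
have HLe t : 0 < t < T ->
    H t + 2 * L2 M (fun k x => alpha t k x * psid t k x) (psidd t) +
    (ah M c beta p (tpsi' t) (tpsi t) + ah M c beta p (tpsi t) (tpsi' t)) + 2 * bc * Q t <= 0 + H t.
  move=> /andP[t0 tT]; have tT' : 0 <= t <= T by rewrite !ltW.
  have [V1 V2 V3 V4] := Vpsi t tT'.
  have tT2 : 0 < t <= T by rewrite t0 ltW.
  have := eqn t (tpsi' t) tT2 (tV t tT').2.
  rewrite L2Dr//; [|exact: VpolM|exact: VpolZ].
  rewrite L2Zr//; last exact: VpolM.
  rewrite (ahC c beta p (tpsi' t)) -/(tpsi t) -/(Q t).
  have -> : L2 M (fun k x => alpha t k x * psidd t k x) (psid t) =
      L2 M (fun k x => alpha t k x * psid t k x) (psidd t).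
    by apply: eq_bigr => k _; apply: eq_bigr => s _; congr sint; apply/funext => x; rewrite mulrAC.
  lra.
(* Its derivative is [H] by the tested equation. The dissipation carries twice its weight in the
   energy, because the squares produce a factor [2]. *)
pose Phi t := X t + A t + 2 * bc * D t.
have dPhi := deriv_onD (deriv_onD dX dA) (deriv_onZ (c := 2 * bc) dD).
have PhiP t : 0 <= t <= T -> Phi t <= Phi 0 + P t.
  move=> tT; apply: (deriv_on_le dPhi (deriv_onD (deriv_on_cst 0 T (Phi 0)) dP)) => //.
  by rewrite P0 addr0.
have cX : {within `[0, T], continuous X} by rewrite -set_cc; exact: deriv_on_cont dX.
(* At the time [ts] of maximal kinetic part the growth is at most [gamma * X ts], so it can be
   absorbed there; the resulting bound on [X ts] then controls [Phi] at all times. *)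
have [ts + Xmax] := EVT_max T0' cX; rewrite in_itv/= => tsT.
have Xs0 := X0 ts tsT.
have PX t : 0 <= t <= T -> P t <= gamma * X ts.
  move=> tT; rewrite -[P t]subr0 -P0.
  apply: (primitive_growth T0' Xs0 dP cH (fun t _ => log_rate_ge0 t) _ log_rate_int tT) => s sT.
  apply: le_trans (HX s sT) _; apply: ler_wpM2l; first exact: log_rate_ge0.
  by apply: Xmax; rewrite in_itv.
have Sc t : 0 <= t <= T -> 0 <= dg_norm c beta p (tpsi t) /\
    dg_norm c beta p (tpsi t) <= 2 * A t /\ A t <= 2 * dg_norm c beta p (tpsi t).
  by move=> tT; apply: coercive; exact: (tV t tT).1.
have D0' t : 0 <= t <= T -> 0 <= D t.
  move=> /andP[t0 tT]; rewrite -D0; apply: (deriv_on_ndecr dD) => // s /andP[/ltW ? /ltW ?].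
  by apply: Q0; apply/andP.
have g1 : 0 < 1 - gamma by case/andP: gamma01 => *; lra.
have Phi0E : Phi 0 = X 0 + A 0 by rewrite /Phi D0 mulr0 addr0.
have in0 : (0 : R) <= 0 <= T by rewrite lexx.
have XsB : X ts <= Phi 0 / (1 - gamma).
  rewrite ler_pdivlMr//.
  have := PhiP ts tsT; have := PX ts tsT; have [_ [? _]] := Sc ts tsT; have [? _] := Sc ts tsT.
  have := mulr_ge0 bc0 (D0' ts tsT); rewrite /Phi -/(Phi 0); lra.
have PhiB t : 0 <= t <= T -> Phi t <= Phi 0 / (1 - gamma).
  move=> tT; apply: le_trans (PhiP t tT) _; apply: (@le_trans _ _ (Phi 0 + gamma * (Phi 0 / (1 - gamma)))).
    rewrite lerD2l; apply: le_trans (PX t tT) _; apply: ler_wpM2l => //.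
    by case/andP: gamma01 => /ltW.
  rewrite le_eqVlt; apply/orP; left; apply/eqP; field; by rewrite gt_eqF.
have energyE t : 0 <= t <= T -> energy t = X t + bc * D t + dg_norm c beta p (tpsi t).
  by move=> tT; rewrite /energy (Rintegral_deriv dD cQ tT) D0 subr0.
move=> t tT; rewrite !energyE// D0 mulr0 addr0.
(* One factor [2] bounds the energy by [Phi] through coercivity, the other bounds [Phi 0] by the
   initial energy through boundedness. *)
apply: (@le_trans _ _ (2 * (Phi 0 / (1 - gamma)))).
  have := PhiB t tT; have [_ [? _]] := Sc t tT; have := X0 t tT; have := mulr_ge0 bc0 (D0' t tT).
  rewrite {1}/Phi; lra.
rewrite Phi0E; have [S0 [_ A02]] := Sc 0 in0; have X00 := X0 0 in0.
have -> : 2 * ((X 0 + A 0) / (1 - gamma)) = 2 * (X 0 + A 0) / (1 - gamma) by rewrite mulrA.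
rewrite [leRHS]mulrAC; apply: ler_wpM2r; first by rewrite invr_ge0 ltW.
lra.
Qed.

End Energy.

(** * The semi-discrete problem *)

Section ContinuousInverse.
Variable R : realType.

Lemma cont_on_det a b n (A : R -> 'M[R]_n) : (forall i j, cont_on a b (fun t => A t i j)) ->
  cont_on a b (fun t => \det (A t)).
Proof.
move=> cA; apply: cont_on_sum => s _; apply: cont_onM; first exact: cont_on_cst.
by apply: cont_on_prod => i _.
Qed.

(** By the adjugate formula, the entries are polynomials in those of [A] divided by a determinant
    that does not vanish. *)
Lemma cont_on_invmx a b n (A : R -> 'M[R]_n) : (forall i j, cont_on a b (fun t => A t i j)) ->
  (forall t, a <= t <= b -> A t \in unitmx) -> forall i j, cont_on a b (fun t => invmx (A t) i j).
Proof.
move=> cA uA i j.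
apply: (@eq_cont_on _ _ _ (fun t => (\det (A t))^-1 * \adj (A t) i j)).
  by move=> t /uA At; rewrite /invmx At [RHS]mxE.
apply: cont_onM.
  by apply: cont_onV; [exact: cont_on_det|move=> t /uA; rewrite unitmxE unitfE].
under eq_fun do rewrite mxE /cofactor; apply: cont_onM; first exact: cont_on_cst.
by apply: cont_on_det => k l; under eq_fun do rewrite !mxE; exact: cA.
Qed.

End ContinuousInverse.

(** * Existence of a solution *)

Section SemiDiscrete.
Variables (R : realType) (d : nat) (M : mesh R d) (Om : set 'rV[R]_d).
Local Notation point := 'rV[R]_d.
Local Notation field := ('I_(nel M) -> point -> R).

(** The basis consists of monomials attached to a single element. A field stores a polynomial on the
    whole space for every element, so independence reduces to uniqueness of coefficients element by
    element. *)
Lemma Vh_basis p : exists N (phi : 'I_N -> field), [/\ forall i, Vh M p (phi i),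
  forall v, Vh M p v -> exists u : 'rV[R]_N, v = fun k x => \sum_i u ord0 i * phi i k x &
  forall u : 'rV[R]_N, (forall k x, \sum_i u ord0 i * phi i k x = 0) -> u = 0].
Proof.
pose A : finType := {a : {ffun 'I_d -> 'I_p.+1} | (\sum_i a i <= p)%N}.
pose B : finType := ('I_(nel M) * A)%type.
have sumB (F : 'I_(nel M) -> {ffun 'I_d -> 'I_p.+1} -> R) :
    \sum_k \sum_(a : {ffun 'I_d -> 'I_p.+1} | (\sum_i a i <= p)%N) F k a =
    \sum_(i < #|B|) F (enum_val i).1 (val (enum_val i).2).
  transitivity (\sum_k \sum_(a : A) F k (val a)).
    apply: eq_bigr => k _.
    rewrite (reindex_omap (val : A -> _) insub)/=; last by move=> a ap; rewrite insubT.
    by apply: eq_bigl => a; rewrite valK eqxx andbT; exact: (valP a).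
  rewrite pair_bigA/= (reindex (fun i : 'I_#|B| => enum_val i))//.
  by exists enum_rank => a _; rewrite ?enum_valK ?enum_rankK.
exists #|B|, (fun (i : 'I_#|B|) (k : 'I_(nel M)) (x : point) => (k == (enum_val i).1)%:R * monom (fun j => val (enum_val i).2 j : nat) x).
have oneblock (c : 'I_(nel M) -> {ffun 'I_d -> 'I_p.+1} -> R) k (x : point) :
    \sum_(i < #|B|) c (enum_val i).1 (val (enum_val i).2) *
      ((k == (enum_val i).1)%:R * monom (fun j => val (enum_val i).2 j : nat) x) =
    \sum_(a : {ffun 'I_d -> 'I_p.+1} | (\sum_i a i <= p)%N) c k a * monom (fun j => a j) x.
  rewrite -(sumB (fun k' a => c k' a * ((k == k')%:R * monom (fun j => a j) x))).
  rewrite (bigD1 k)//= [X in _ + X]big1 ?addr0.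
    by apply: eq_bigr => a _; rewrite eqxx mul1r.
  move=> k' k'k; apply: big1 => a _.
  by rewrite eq_sym (negbTE k'k) mul0r mulr0.
split.
- by move=> i k; apply: is_polyZ; apply: is_poly_monom; exact: (valP (enum_val i).2).
- move=> v pv; have /choice[c cP] : forall k, exists c : {ffun 'I_d -> 'I_p.+1} -> R,
      v k = fun x => \sum_(a : {ffun 'I_d -> 'I_p.+1} | (\sum_i a i <= p)%N) c a * monom (fun i => a i) x.
    by move=> k; exact: is_polyE.
  exists (\row_i c (enum_val i).1 (val (enum_val i).2)).
  apply/funext => k; apply/funext => x; rewrite cP -oneblock.
  by apply: eq_bigr => i _; rewrite mxE.
- move=> u u0; apply/rowP => i; rewrite mxE.
  pose c k (a : {ffun 'I_d -> 'I_p.+1}) := if insub a is Some a' then u ord0 (enum_rank ((k, a') : B)) else 0.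
  have cE j : c (enum_val j).1 (val (enum_val j).2) = u ord0 j.
    by rewrite /c valK -surjective_pairing enum_valK.
  rewrite -cE; apply: (@is_poly0_coef R d p); last exact: (valP (enum_val i).2).
  move=> x; rewrite -oneblock -[RHS](u0 (enum_val i).1 x).
  by apply: eq_bigr => j _; rewrite cE.
Qed.

Variables (T : R) (p : nat) (alpha alphad : R -> field) (c b beta alpha0 : R).
Hypotheses (valid : valid_mesh M Om) (sub0 : forall k : 'I_(nel M), subs k <> [::]) (T0 : 0 < T)
  (alpha00 : 0 < alpha0) (salpha : smooth_in T p alpha alphad).
Hypothesis alpha_ge : forall t k x, 0 <= t <= T -> cl_el M k x -> alpha0 <= alpha t k x.

Lemma L2_alpha_definite t v : 0 <= t <= T -> Vh M p v ->
  L2 M (fun k x => alpha t k x * v k x) v <= 0 -> forall k x, v k x = 0.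
Proof.
move=> tT pv H; apply: (L2_definite valid sub0 pv); apply/eqP; rewrite eq_le.
have Vv := Vh_Vpol pv; have Va := Vh_Vpol (salpha.1 t tT).1.
apply/andP; split; last by apply: L2_ge0 => // k x _; exact: sqr_ge0.
have : alpha0 * L2 M v v <= 0.
  apply: le_trans H; rewrite -L2Zr// L2C; apply: L2_le => //; do ?[exact: VpolM|exact: VpolZ].
  move=> k x xk; rewrite -!mulrA; apply: ler_wpM2r; first exact: sqr_ge0.
  exact: alpha_ge.
by rewrite pmulr_rle0.
Qed.

Lemma semidiscrete_solution (psi0 psi1 : field) : Vh M p psi0 -> Vh M p psi1 ->
  exists psi psid psidd : R -> field,
    (forall t, 0 <= t <= T -> [/\ Vh M p (psi t), Vh M p (psid t) & Vh M p (psidd t)]) /\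
    (forall k x, deriv_on 0 T (fun t => psi t k x) (fun t => psid t k x) /\
       deriv_on 0 T (fun t => psid t k x) (fun t => psidd t k x) /\
       cont_on 0 T (fun t => psidd t k x)) /\
    (forall t v, 0 < t <= T -> Vh M p v ->
       L2 M (fun k x => alpha t k x * psidd t k x) v
       + ah M c beta p (fun k x => psi t k x + b / c ^+ 2 * psid t k x) v = 0) /\
    (forall k x, psi 0 k x = psi0 k x /\ psid 0 k x = psi1 k x).
Proof.
have [N [phi [pphi span indep]]] := Vh_basis p.
move=> /span[u0 ->] /span[u1 ->].
have T0' := ltW T0.
have Vphi i : Vpol (phi i) by exact: Vh_Vpol.
have [pal dal] := salpha.
have cal k x : cont_on 0 T (fun t => alpha t k x) by exact: deriv_on_cont (dal k x).
pose bc := b / c ^+ 2.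
pose Mt t : 'M[R]_N := \matrix_(i, j) L2 M (fun k x => alpha t k x * phi j k x) (phi i).
pose A : 'M[R]_N := \matrix_(i, j) ah M c beta p (phi j) (phi i).
pose comb (u : 'I_N -> R) : field := fun k x => \sum_i u i * phi i k x.
have pcomb u : Vh M p (comb u) by move=> k; apply: is_poly_sum => i _; apply: is_polyZ; exact: pphi.
have L2_comb t (u : 'I_N -> R) j : 0 <= t <= T ->
    L2 M (fun k x => alpha t k x * comb u k x) (phi j) = \sum_i u i * Mt t i j.
  move=> tT; have Va := Vh_Vpol (pal t tT).1.
  transitivity (L2 M (fun k x => alpha t k x * phi j k x) (comb u)).
    by apply: eq_bigr => k _; apply: eq_bigr => s _; congr sint; apply/funext => x; rewrite mulrAC.
  rewrite /comb L2_sumr//; last exact: VpolM.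
  by apply: eq_bigr => i _; rewrite mxE.
have ah_comb (u : 'I_N -> R) j : ah M c beta p (comb u) (phi j) = \sum_i u i * A i j.
  by rewrite ahC /comb ah_sumr//; apply: eq_bigr => i _; rewrite mxE.
have Mu t : 0 <= t <= T -> Mt t \in unitmx.
  move=> tT; apply: definite_unitmx => u uM; apply: indep => k x.
  apply: (L2_alpha_definite tT (pcomb (fun i => u ord0 i))).
  have Va := Vh_Vpol (pal t tT).1.
  have Vc := Vh_Vpol (pcomb (fun i => u ord0 i)).
  rewrite [X in L2 _ _ X]/comb L2_sumr//; last exact: VpolM.
  suff -> : \sum_i u ord0 i * L2 M (fun k x => alpha t k x * comb (fun i => u ord0 i) k x) (phi i) =
      (u *m Mt t *m u^T) ord0 ord0 by rewrite uM mxE.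
  rewrite mxE; apply: eq_bigr => j _; rewrite L2_comb// [u^T _ _]mxE mulrC; congr (_ * _).
  by rewrite mxE.
have cMt i j : cont_on 0 T (fun t => Mt t i j).
  under eq_fun do rewrite mxE; apply: cont_on_sum => k _; apply: cont_on_sum => s _.
  apply: (@sint_cont_on R d T (p + p + p)).
    by move=> t /pal[p1 p2]; apply: is_polyM; [apply: is_polyM; [exact: p1|exact: pphi]|exact: pphi].
  by move=> x; apply: cont_onM; [apply: cont_onM => //|]; exact: cont_on_cst.
(* With coefficients as row vectors, the equation reads [acc *m Mt t + z *m A = 0] for [z] the
   coefficients of [psi + bc * psid], so that [acc = - z *m K t]. *)
pose K t := A *m invmx (Mt t).
have cK i j : cont_on 0 T (fun t => K t i j).
  under eq_fun do rewrite mxE; apply: cont_on_sum => k _; apply: cont_onM; first exact: cont_on_cst.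
  exact: cont_on_invmx.
(* First-order reduction: [inl] indexes the coefficients of [psi], [inr] those of [psid]. *)
pose I : finType := ('I_N + 'I_N)%type.
pose B t (i j : I) : R := match i, j with
  | inl i, inl j => 0
  | inl i, inr j => (i == j)%:R
  | inr i, inl j => - K t j i
  | inr i, inr j => - (bc * K t j i)
  end.
pose y0 (i : I) : R := match i with inl i => u0 ord0 i | inr i => u1 ord0 i end.
have cB i j : cont_on 0 T (fun t => B t i j).
  case: i j => i [j|j]; rewrite /B; [exact: cont_on_cst|exact: cont_on_cst| |].
    by under eq_fun do rewrite -mulN1r; apply: cont_onM => //; exact: cont_on_cst.
  under eq_fun do rewrite -mulNr; apply: cont_onM => //; exact: cont_on_cst.
have [y [y0E dy]] := linear_ode y0 T0' cB.
pose acc t i := \sum_j B t (inr i : I) j * y t j.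
have cy i : cont_on 0 T (fun t => y t i) by exact: deriv_on_cont (dy i).
have accE t i : acc t i = - \sum_j (y t (inl j : I) + bc * y t (inr j : I)) * K t j i.
  rewrite /acc big_sumType/= -sumrN -big_split/=; apply: eq_bigr => j _; ring.
have dcomb (f f' : R -> 'I_N -> R) : (forall i, deriv_on 0 T (fun t => f t i) (fun t => f' t i)) ->
    forall k x, deriv_on 0 T (fun t => comb (f t) k x) (fun t => comb (f' t) k x).
  move=> df k x; have := @deriv_on_sum R 0 T _ (index_enum 'I_N) xpredT _ _
     (fun i _ => deriv_onM (df i) (deriv_on_cst 0 T (phi i k x))).
  apply: eq_deriv_on => // t _; apply: eq_bigr => i _; by rewrite mulr0 addr0.
exists (fun t => comb (fun i => y t (inl i : I))), (fun t => comb (fun i => y t (inr i : I))),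
  (fun t => comb (acc t)).
split; first by move=> t tT; split; exact: pcomb.
split.
  move=> k x; split.
    apply: dcomb => i; apply: (eq_deriv_on _ _ (dy (inl i : I))) => // t _.
    rewrite big_sumType/= big1 ?add0r => [|j _]; last by rewrite mul0r.
    rewrite (bigD1 i)//= eqxx mul1r big1 ?addr0// => j ji.
    by rewrite eq_sym (negbTE ji) mul0r.
  split; first by apply: dcomb => i; exact: dy.
  apply: cont_on_sum => i _; apply: cont_onM; last exact: cont_on_cst.
  by apply: cont_on_sum => j _; exact: cont_onM.
split; last first.
  move=> k x; split; apply: eq_bigr => i _; by rewrite y0E.
move=> t v /andP[t0 tT] /span[w ->].
have tT' : 0 <= t <= T by rewrite ltW.
have Va := Vh_Vpol (pal t tT').1.
have Vcomb u := Vh_Vpol (pcomb u).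
rewrite L2_sumr//; last exact: VpolM.
have -> : (fun k x => comb (fun i => y t (inl i : I)) k x + b / c ^+ 2 * comb (fun i => y t (inr i : I)) k x) =
    comb (fun i => y t (inl i : I) + bc * y t (inr i : I)).
  apply/funext => k; apply/funext => x; rewrite /comb mulr_sumr -big_split/=.
  by apply: eq_bigr => i _; rewrite mulrDl mulrA.
rewrite ah_sumr// -big_split/= big1// => j _; rewrite -mulrDr L2_comb// ah_comb.
pose z : 'rV[R]_N := \row_i (y t (inl i : I) + bc * y t (inr i : I)).
have -> : \sum_i acc t i * Mt t i j = - (z *m K t *m Mt t) ord0 j.
  rewrite mxE -sumrN; apply: eq_bigr => i _; rewrite accE mulNr; congr (- (_ * _)).
  by rewrite [RHS]mxE; apply: eq_bigr => l _; rewrite [z _ _]mxE.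
rewrite /K mulmxA mulmxKV ?Mu// [X in - X]mxE.
under [X in - X]eq_bigr do rewrite mxE.
by rewrite addNr mulr0.
Qed.

End SemiDiscrete.

Lemma le0_of_estimate (R : realFieldType) (y q s r e : R) : 0 <= q -> 0 <= s -> 0 <= r -> e <= 0 ->
  y + q + s <= r * (0 + e) -> y <= 0.
Proof. by move=> q0 s0 r0 e0; have := ler_wpM2l r0 e0; lra. Qed.

(** * Uniqueness through the energy estimate *)

Section WellPosedness.
Variables (R : realType) (d : nat) (M : mesh R d) (Om : set 'rV[R]_d) (T : R) (p : nat).
Local Notation point := 'rV[R]_d.
Local Notation field := ('I_(nel M) -> point -> R).
Variables (alpha alphad : R -> field) (c b beta gamma alpha0 : R).

Definition semidiscrete_sol (psi psid psidd : R -> field) : Prop :=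
  (forall t, 0 <= t <= T -> [/\ Vh M p (psi t), Vh M p (psid t) & Vh M p (psidd t)]) /\
  (forall k x, deriv_on 0 T (fun t => psi t k x) (fun t => psid t k x) /\
     deriv_on 0 T (fun t => psid t k x) (fun t => psidd t k x) /\
     cont_on 0 T (fun t => psidd t k x)) /\
  (forall t v, 0 < t <= T -> Vh M p v ->
     L2 M (fun k x => alpha t k x * psidd t k x) v
     + ah M c beta p (fun k x => psi t k x + b / c ^+ 2 * psid t k x) v = 0).

Hypotheses (valid : valid_mesh M Om) (sub0 : forall k : 'I_(nel M), subs k <> [::])
  (T0 : 0 < T) (c0 : 0 < c) (b0 : 0 <= b) (gamma01 : 0 < gamma < 1) (alpha00 : 0 < alpha0)
  (salpha : smooth_in T p alpha alphad)
  (calphad : forall k x, cont_on 0 T (fun t => alphad t k x))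
  (alpha_ge : forall t k x, 0 <= t <= T -> cl_el M k x -> alpha0 <= alpha t k x)
  (log_rate_int : (\int[lebesgue_measure]_(t in [set t : R | (0 <= t <= T)%R])
     (log_rate alpha alphad t)%:E <= gamma%:E)%E)
  (coercive : forall v, Vh M p v -> 0 <= dg_norm c beta p v /\
     dg_norm c beta p v <= 2 * ah M c beta p v v /\ ah M c beta p v v <= 2 * dg_norm c beta p v).

Lemma semidiscrete_sol_sub phi phid phidd psi psid psidd :
  semidiscrete_sol phi phid phidd -> semidiscrete_sol psi psid psidd ->
  semidiscrete_sol (fun t k x => phi t k x + -1 * psi t k x)
    (fun t k x => phid t k x + -1 * psid t k x) (fun t k x => phidd t k x + -1 * psidd t k x).
Proof.
move=> [fV [fD fE]] [gV [gD gE]]; split; last split.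
- move=> t tT; have [? ? ?] := fV t tT; have [? ? ?] := gV t tT.
  by split=> k; apply: is_polyD => //; exact: is_polyZ.
- move=> k x; have [f1 [f2 f3]] := fD k x; have [g1 [g2 g3]] := gD k x.
  split; first by apply: deriv_onD => //; exact: deriv_onZ.
  split; first by apply: deriv_onD => //; exact: deriv_onZ.
  by apply: cont_onD => //; apply: cont_onM => //; exact: cont_on_cst.
move=> t v /andP[t0 tT] pv; have tT' : 0 <= t <= T by rewrite ltW.
have tT2 : 0 < t <= T by rewrite t0.
have [/Vh_Vpol f0 /Vh_Vpol f1 /Vh_Vpol f2] := fV t tT'.
have [/Vh_Vpol g0 /Vh_Vpol g1 /Vh_Vpol g2] := gV t tT'.
have Va := Vh_Vpol (salpha.1 t tT').1; have Vv := Vh_Vpol pv.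
have -> : (fun k x => alpha t k x * (phidd t k x + -1 * psidd t k x)) =
    (fun k x => alpha t k x * phidd t k x + -1 * (alpha t k x * psidd t k x)).
  by apply/funext => k; apply/funext => x; ring.
have -> : (fun k x => phi t k x + -1 * psi t k x + b / c ^+ 2 * (phid t k x + -1 * psid t k x)) =
    (fun k x => (phi t k x + b / c ^+ 2 * phid t k x) + -1 * (psi t k x + b / c ^+ 2 * psid t k x)).
  by apply/funext => k; apply/funext => x; ring.
rewrite L2C L2Dr//; [|exact: VpolM|by apply: VpolZ; exact: VpolM].
rewrite L2Zr//; last exact: VpolM.
have V1 : Vpol (fun k x => phi t k x + b / c ^+ 2 * phid t k x) by apply: VpolD => //; exact: VpolZ.
have V2 : Vpol (fun k x => psi t k x + b / c ^+ 2 * psid t k x) by apply: VpolD => //; exact: VpolZ.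
rewrite ahC ahDr//; last exact: VpolZ.
rewrite ahZr// !(L2C v) !(ahC c beta p v).
have := fE t v tT2 pv; have := gE t v tT2 pv; lra.
Qed.

Lemma semidiscrete_sol_estimate psi psid psidd : semidiscrete_sol psi psid psidd ->
  let energy t := L2 M (fun k x => alpha t k x * psid t k x) (psid t) +
    b / c ^+ 2 * Rintegral lebesgue_measure [set s | 0 <= s <= t]
        (fun s => L2 M (fun k x => alpha s k x * psidd s k x) (psidd s)) +
    dg_norm c beta p (fun k x => psi t k x + b / c ^+ 2 * psid t k x) in
  forall t, 0 <= t <= T -> energy t <= 4 / (1 - gamma) * energy 0.
Proof.
move=> [pV [dV eqn]].
exact: (energy_estimate salpha valid T0 c0 b0 gamma01 alpha00 calphad alpha_ge log_rate_int coercive pV dV eqn).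
Qed.

(** With zero data the initial energy is at most zero, so the kinetic part vanishes at all times;
    [psid] is then zero and [psi] keeps its initial value. *)
Lemma semidiscrete_sol0 psi psid psidd : semidiscrete_sol psi psid psidd ->
  (forall k x, psi 0 k x = 0 /\ psid 0 k x = 0) ->
  forall t k x, 0 <= t <= T -> psi t k x = 0.
Proof.
move=> sol init; have [pV [dV eqn]] := sol.
have in0 : (0 : R) <= 0 <= T by rewrite lexx ltW.
have bc0 : 0 <= b / c ^+ 2 by rewrite divr_ge0// exprn_ge0// ltW.
have V00 : Vh M p (fun _ _ => 0) by move=> k; exact: is_poly_cst.
have E1 : psid 0 = fun _ _ => 0 by apply/funext => k; apply/funext => x; have [] := init k x.
have E2 : (fun k x => psi 0 k x + b / c ^+ 2 * psid 0 k x) = fun _ _ => 0.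
  by apply/funext => k; apply/funext => x; have [-> ->] := init k x; rewrite mulr0 addr0.
(* Coercivity bounds the norm of the zero field by the value of [ah] there, which is zero by
   homogeneity. *)
have dg0 : dg_norm c beta p (fun (_ : 'I_(nel M)) (_ : point) => 0 : R) <= 0.
  have [_ [+ _]] := coercive V00.
  suff -> : ah M c beta p (fun _ _ => 0) (fun _ _ => 0) = 0 by rewrite mulr0.
  have -> : ah M c beta p (fun _ _ => 0) (fun _ _ => 0) =
      ah M c beta p (fun _ _ => 0) (fun k x => 0 * (fun _ _ => 0) k x).
    by congr ah; apply/funext => k; apply/funext => x; rewrite mul0r.
  by rewrite ahZr ?mul0r//; exact: Vh_Vpol V00.
have psid0 t k x : 0 <= t <= T -> psid t k x = 0.
  move=> tT; have [p0' p1' p2'] := pV t tT.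
  apply: (L2_alpha_definite valid sub0 alpha00 salpha alpha_ge tT p1').
  have dgt : 0 <= dg_norm c beta p (fun k x => psi t k x + b / c ^+ 2 * psid t k x).
    have [] // := coercive (v := (fun k x => psi t k x + b / c ^+ 2 * psid t k x)).
    by move=> k'; apply: is_polyD => //; exact: is_polyZ.
  have Q0 : 0 <= Rintegral lebesgue_measure [set s | 0 <= s <= t]
      (fun s => L2 M (fun k x => alpha s k x * psidd s k x) (psidd s)).
    apply: Rintegral_ge0 => s /= /andP[s0 st].
    have sT : 0 <= s <= T by case/andP: tT => _ tT; rewrite s0 (le_trans st).
    have [_ _ ps2] := pV s sT; have Va := Vh_Vpol (salpha.1 s sT).1; have V2 := Vh_Vpol ps2.
    apply: L2_ge0 => // [|k' y yk]; first exact: VpolM.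
    rewrite -mulrA mulr_ge0 ?sqr_ge0//; apply: le_trans (ltW alpha00) _; exact: alpha_ge.
  have g1 : 0 <= 4 / (1 - gamma) by case/andP: gamma01 => _ g1; rewrite divr_ge0// subr_ge0 ltW.
  apply: (le0_of_estimate (mulr_ge0 bc0 Q0) dgt g1 dg0).
  have := semidiscrete_sol_estimate sol tT.
  have -> : [set s : R | 0 <= s <= 0] = [set 0].
    by apply/seteqP; split => s /=; [rewrite -eq_le eq_sym => /eqP|move=> ->; rewrite lexx].
  rewrite Rintegral_set1 mulr0 addr0 E2 E1.
  have -> : L2 M (fun k x => alpha 0 k x * 0) (fun _ _ => 0) = 0.
    have -> : L2 M (fun k x => alpha 0 k x * 0) (fun _ _ => 0) =
        L2 M (fun k x => alpha 0 k x * 0) (fun k x => 0 * (fun _ _ => 0) k x).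
      by congr L2; apply/funext => k'; apply/funext => y; rewrite mul0r.
    rewrite L2Zr ?mul0r//; last exact: Vh_Vpol V00.
    by apply: VpolM; [exact: Vh_Vpol (salpha.1 0 in0).1|exact: Vh_Vpol V00].
  exact.
move=> t k x tT; have [d0 _] := dV k x.
by rewrite (deriv_on0_cst d0 (fun s sT => psid0 s k x sT) tT); have [] := init k x.
Qed.

Lemma semidiscrete_unique phi phid phidd psi psid psidd :
  semidiscrete_sol phi phid phidd -> semidiscrete_sol psi psid psidd ->
  (forall k x, phi 0 k x = psi 0 k x /\ phid 0 k x = psid 0 k x) ->
  forall t k x, 0 <= t <= T -> phi t k x = psi t k x.
Proof.
move=> sphi spsi init t k x tT.
have := semidiscrete_sol0 (semidiscrete_sol_sub sphi spsi) _ k x tT.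
have h k' y : phi 0 k' y + -1 * psi 0 k' y = 0 /\ phid 0 k' y + -1 * psid 0 k' y = 0.
  by have [-> ->] := init k' y; rewrite mulN1r mulN1r !subrr.
by move=> /(_ h) /eqP; rewrite mulN1r subr_eq0 => /eqP.
Qed.

End WellPosedness.

Theorem mainTheorem2 (R : realType) (d : nat) (p : nat) (gamma : R)
  (Cr sigma Cq : R) (m : nat) (Om : set 'rV[R]_d) (T alpha0 alpha1 : R) :
  (d = 2%N \/ d = 3%N) -> (1 <= p)%N -> 0 < gamma < 1 ->
  0 < Cr -> 0 < sigma -> 0 < Cq ->
  convex_polytope_domain Om ->
  0 < T -> 0 < alpha0 -> 0 < alpha1 ->
  exists beta0 C : R, 0 < C /\
  forall (beta : R) (M : mesh R d), beta0 <= beta ->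
  valid_mesh M Om -> regular_mesh M Cr sigma m Cq ->
  forall (c b : R) (alpha alphad : R -> 'I_(nel M) -> 'rV[R]_d -> R)
         (psi0 psi1 : 'I_(nel M) -> 'rV[R]_d -> R),
  0 < c -> 0 <= b ->
  (* alpha_h in C^1([0,T]; V_h) with derivative alphad *)
  (forall t, 0 <= t <= T -> Vh M p (alpha t) /\ Vh M p (alphad t)) ->
  (forall k x, deriv_on 0 T (fun t => alpha t k x) (fun t => alphad t k x) /\
     {within [set t | 0 <= t <= T], continuous (fun t => alphad t k x)}) ->
  (* alpha0 <= alpha_h <= alpha1 on closure(Omega) x [0,T] *)
  (forall t k x, 0 <= t <= T -> cl_el M k x -> alpha0 <= alpha t k x <= alpha1) ->
  (* || alpha_h' / alpha_h ||_{L^1(0,T; L^oo(Omega))} <= gamma *)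
  (\int[lebesgue_measure]_(t in [set t : R | (0 <= t <= T)%R])
     (sup [set y : R | exists k x, el M k x /\ y = `|alphad t k x / alpha t k x|%R])%:E
     <= gamma%:E)%E ->
  Vh M p psi0 -> Vh M p psi1 ->
  let is_sol (psi psid psidd : R -> 'I_(nel M) -> 'rV[R]_d -> R) :=
    (forall t, 0 <= t <= T -> [/\ Vh M p (psi t), Vh M p (psid t) & Vh M p (psidd t)]) /\
    (forall k x, deriv_on 0 T (fun t => psi t k x) (fun t => psid t k x) /\
       deriv_on 0 T (fun t => psid t k x) (fun t => psidd t k x) /\
       {within [set t | 0 <= t <= T], continuous (fun t => psidd t k x)}) /\
    (forall t (v : 'I_(nel M) -> 'rV[R]_d -> R), 0 < t <= T -> Vh M p v ->
       L2 M (fun k x => alpha t k x * psidd t k x) v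
       + ah M c beta p (fun k x => psi t k x + b / c ^+ 2 * psid t k x) v = 0) /\
    (forall k x, psi 0 k x = psi0 k x /\ psid 0 k x = psi1 k x) in
  let energy (psi psid psidd : R -> 'I_(nel M) -> 'rV[R]_d -> R) (t : R) :=
    let tpsi := fun k x => psi t k x + b / c ^+ 2 * psid t k x in
    L2 M (fun k x => alpha t k x * psid t k x) (psid t)
    + b / c ^+ 2 * Rintegral lebesgue_measure [set s | 0 <= s <= t]
        (fun s => L2 M (fun k x => alpha s k x * psidd s k x) (psidd s))
    + c ^+ 2 * gradL2 M tpsi tpsi
    + \sum_(f < nfc M) fint M f (fun x => chi M c beta p f * dotp (jmp M f tpsi x) (jmp M f tpsi x)) in
  exists psi psid psidd, is_sol psi psid psidd /\
    (forall phi phid phidd, is_sol phi phid phidd ->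
       forall t k x, 0 <= t <= T -> phi t k x = psi t k x) /\
    (forall t, 0 <= t <= T -> energy psi psid psidd t <= C * energy psi psid psidd 0).
Proof.
move=> d23 p1 gamma01 Cr0 _ _ poly T0 alpha00 _.
have [n dE n12] : exists2 n, d = n.+1 & (n = 1%N) \/ (n = 2%N).
  by case: d23 => ->; [exists 1%N => //; left|exists 2%N => //; right].
subst d.
have [beta0 _ coer] := ah_coercive sigma Cq m n12 Cr0 poly p1.
(* Both constants are fixed before the mesh, [c] and [b] are introduced; this order of quantifiers
   expresses the claimed independence. *)
exists beta0, (4 / (1 - gamma)); split; first by rewrite divr_gt0// subr_gt0; case/andP: gamma01.
move=> beta M betaM valid reg c b alpha alphad psi0 psi1 c0 b0 alphaV alphaD alphaB alphaI pV0 pV1 is_sol energy.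
have sub0 : forall k : 'I_(nel M), subs k <> [::].
  by move=> k; apply: (subs_neq0 valid _ _ reg) => //; case: poly.
have salpha : smooth_in T p alpha alphad by split=> // k x; have [] := alphaD k x.
have calphad k x : cont_on 0 T (fun t => alphad t k x) by have [] := alphaD k x.
have alpha_ge t k x : 0 <= t <= T -> cl_el M k x -> alpha0 <= alpha t k x.
  by move=> tT /(alphaB t k x tT)/andP[].
have coercive v : Vh M p v -> 0 <= dg_norm c beta p v /\
    dg_norm c beta p v <= 2 * ah M c beta p v v /\ ah M c beta p v v <= 2 * dg_norm c beta p v.
  by move=> pv; exact: coer.
have [psi [psid [psidd [sV [sD [sE sI]]]]]] :=
  semidiscrete_solution c b beta valid sub0 T0 alpha00 salpha alpha_ge pV0 pV1.
have sol : semidiscrete_sol T p alpha c b beta psi psid psidd by [].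
exists psi, psid, psidd; split; first by [].
split.
  move=> phi phid phidd [fV [fD [fE fI]]].
  have sphi : semidiscrete_sol T p alpha c b beta phi phid phidd by [].
  apply: (semidiscrete_unique valid sub0 T0 c0 b0 gamma01 alpha00 salpha calphad alpha_ge alphaI coercive sphi sol).
  by move=> k x; have [-> ->] := fI k x; have [-> ->] := sI k x.
move=> t tT.
have := semidiscrete_sol_estimate valid T0 c0 b0 gamma01 alpha00 salpha calphad alpha_ge alphaI coercive sol tT.
by rewrite /dg_norm !addrA.
Qed.
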